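(* Let $T\ge2$, $\delta\in(0,1)$, $\eta=1+RS$, $\alpha=\frac{3\eta}{2}$, and $$\lambda=\max\left\{\frac{6\eta Rk_\mu S}{g(\tau)},\ \frac{32\alpha dR^2}{7},\ \frac{c_\mu}{g(\tau)}\right\}.$$ Let $\Gamma_T:=\sum_{t=1}^{T-1}\mathbf 1\{\theta_{t+1}^\star\ne\theta_t^\star\}$ be the number of parameter changes. Then, for every $\gamma\in[1/T,1)$, with probability at least $1-\delta$, the algorithm DOMD-GLB (described in the context) run with parameters $\gamma,\lambda,\delta$ has dynamic regret $$\mathrm{Reg}_T=\widetilde{\mathcal O}\left(\frac{k_\mu}{\sqrt{c_\mu}}\,d\sqrt T+\frac{k_\mu}{\sqrt{c_\mu}}\,dT\sqrt{1-\gamma}+\frac{\Gamma_T}{1-\gamma}\right).$$ Moreover, with the choice $$\gamma=1-\min\left\{1-\frac1T,\ \max\left\{\frac1T,\ \left(\frac{\Gamma_T\sqrt{c_\mu}}{k_\mu dT}\right)^{2/3}\right\}\right\},$$ with probability at least $1-\delta$, $$\mathrm{Reg}_T=\begin{cases}\widetilde{\mathcal O}\left(\frac{k_\mu}{\sqrt{c_\mu}}\,d\sqrt T\right),&\text{if }0\le\Gamma_T<\frac{k_\mu d}{\sqrt{c_\mu T}},\\[1ex]\widetilde{\mathcal O}\left(\frac{k_\mu^{2/3}}{c_\mu^{1/3}}\,d^{2/3}\Gamma_T^{1/3}T^{2/3}\right),&\text{if }\frac{k_\mu d}{\sqrt{c_\mu T}}\le\Gamma_T\le\frac{k_\mu dT}{\sqrt{c_\mu}}\left(1-\frac1T\right)^{3/2},\\[1ex]\widetilde{\mathcal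 O}\left(\Gamma_T\right),&\text{if }\Gamma_T>\frac{k_\mu dT}{\sqrt{c_\mu}}\left(1-\frac1T\right)^{3/2}.\end{cases}$$
   Context: Notation: $\|x\|_M:=\sqrt{x^\top Mx}$ for positive semidefinite $M$; $I_d$ is the identity. Nonstationary generalized linear bandit. Fix $d\ge1$, $R,S>0$. At each round $t=1,2,\dots$ a learner observes a set $\mathcal X_t\subset\mathbb R^d$, chooses $x_t\in\mathcal X_t$ (based on the past), and receives a reward $r_t$. There is an unknown parameter sequence $(\theta_t^\star)_{t\ge1}$ in $\mathbb R^d$, fixed independently of the reward noise (exogenous). Let $p(r\mid z)=\exp\left(\frac{rz-m(z)}{g(\tau)}+h(r,\tau)\right)$, a probability density in $r$ (with respect to a fixed reference measure) for every $z\in\mathbb R$, where $m:\mathbb R\to\mathbb R$ is convex and three times continuously differentiable and $g(\tau)>0$ is a known constant. Put $\mu:=m'$ (the link function). With $\widetilde{\mathcal F}_t:=\sigma(x_1,r_1,\dots,x_{t-1},r_{t-1},x_t)\vee\sigma(\theta_s^\star:s\ge1)$, the conditional law of $r_t$ given $\widetilde{\mathcal F}_t$ has density $p(\cdot\mid x_t^\top\theta_t^\star)$; in particular its conditional mean is $\mu(x_t^\top\theta_t^\star)$. Assumptions. (Boundedness) for all $t$: $\theta_t^\star\in\Theta:=\{\theta\in\mathbb R^d:\|\theta\|_2\le S\}$, $\|x\|_2\le1$ for all $x\in\mathcal X_t$, and $r_t\in[0,R]$ almost surely. (Bounded link) there are constants $c_\mu,k_\mu>0$ with $c_\mu\le\mu'(z)\le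 k_\mu$ for all $z\in[-S,S]$. (Self-concordance, a standing property of the link in this setting) $|\mu''(z)|\le R\,\mu'(z)$ for all $z\in\mathbb R$. Maxima over $\mathcal X_t$ below are taken to be attained. Piecewise-stationary environment: nonstationarity is measured by the number $\Gamma_T$ of parameter changes. Dynamic regret. $\mathrm{Reg}_T:=\sum_{t=1}^T\left(\mu((x_t^\star)^\top\theta_t^\star)-\mu(x_t^\top\theta_t^\star)\right)$ with $x_t^\star\in\arg\max_{x\in\mathcal X_t}\mu(x^\top\theta_t^\star)$. Algorithm DOMD-GLB (discount $\gamma\in(0,1)$, regularization $\lambda>0$, confidence $\delta$). Loss: $\ell_t(\theta):=\frac{m(x_t^\top\theta)-r_tx_t^\top\theta}{g(\tau)}$. Start from $\theta_1\in\Theta$, $H_1=\lambda I_d$. For $t=1,\dots,T$: set $A_t:=\gamma H_t+(1-\gamma)\lambda I_d$; play $$x_t\in\arg\max_{x\in\mathcal X_t}\left\{x^\top\theta_t+\beta_t(\delta)\|x\|_{H_t^{-1}}\right\}$$ and observe $r_t$; update $$\theta_{t+1}\in\arg\min_{\theta\in\Theta}\left\{\widetilde\ell_t(\theta)+\frac1{2\eta}\|\theta-\theta_t\|_{A_t}^2\right\},\quad \widetilde\ell_t(\theta):=\ell_t(\theta_t)+\langle\nabla\ell_t(\theta_t),\theta-\theta_t\rangle+\tfrac12\|\theta-\theta_t\|^2_{\nabla^2\ell_t(\theta_t)};$$ set $H_{t+1}:=A_t+\nabla^2\ell_t(\theta_{t+1})$. Here $\beta_t(\delta)\ge 0$ is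 given by $$\beta_t^2(\delta):=4\lambda S^2+2\eta\left(1+\frac{R^2}{g(\tau)k_\mu}\right)\log\left(\frac{\pi^2t^2}{3\delta}\right)+2\eta\left(3\eta+\frac12\right)d\log\left(1+\frac{k_\mu(1-\gamma^{t-1})}{\lambda d\,g(\tau)(1-\gamma)}\right).$$ Convention for $\widetilde{\mathcal O}$: $X=\widetilde{\mathcal O}(Y)$ means $X\le C\cdot L\cdot Y$, where $C$ depends only on $R,S,g(\tau),k_\mu$ (not on $d,T,\gamma,\delta,c_\mu$ or the environment) and $L$ is a fixed polynomial in $\log(eT)$, $\log(e/\delta)$, $\log(e/(1-\gamma))$. *)

(* Defs.v *)
From HB Require Import structures.
From mathcomp Require Import all_boot all_order all_algebra.
From mathcomp Require Import all_classical all_reals all_analysis.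

Set Implicit Arguments.
Unset Strict Implicit.
Unset Printing Implicit Defensive.

Import Order.TTheory GRing.Theory Num.Theory.
Import numFieldNormedType.Exports.

Local Open Scope classical_set_scope.
Local Open Scope ring_scope.

(* Vectors are columns.  The library norm on matrices is the sup norm, hence
   the explicit Euclidean norm [norm2]. *)
Definition dot (K : realType) (d : nat) (u v : 'cV[K]_d) : K :=
  (u^T *m v) 0 0.

Definition norm2 (K : realType) (d : nat) (u : 'cV[K]_d) : K :=
  Num.sqrt (dot u u).

Definition wnorm (K : realType) (d : nat) (M : 'M[K]_d) (u : 'cV[K]_d) : K :=
  Num.sqrt ((u^T *m M *m u) 0 0).

Definition ball2 (K : realType) (d : nat) (S : K) : set 'cV[K]_d :=
  [set u | norm2 u <= S].

Definition is_argmax (K : realType) (T : Type) (A : set T) (f : T -> K)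
    (a : T) : Prop :=
  A a /\ forall b, A b -> f b <= f a.

Definition is_argmin (K : realType) (T : Type) (A : set T) (f : T -> K)
    (a : T) : Prop :=
  A a /\ forall b, A b -> f a <= f b.

Definition grad (K : realType) (d : nat) (f : 'cV[K]_d -> K)
    (u : 'cV[K]_d) : 'cV[K]_d :=
  \col_i 'D_(delta_mx i 0) f u.

Definition hess (K : realType) (d : nat) (f : 'cV[K]_d -> K)
    (u : 'cV[K]_d) : 'M[K]_d :=
  \matrix_(i, j) 'D_(delta_mx j 0) ('D_(delta_mx i 0) f) u.

Definition class_C3 (K : realType) (f : K -> K) : Prop :=
  (forall (k : nat) (z : K), (k < 3)%N -> derivable (f^`(k)%classic) z 1) /\
  continuous f^`(3)%classic.

(* Q holds with probability at least p: the event {w | Q w} need not be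
   measurable, since the action sets below are arbitrary set-valued maps; it
   is required to contain a measurable event of probability at least p. *)
Definition with_prob_ge (K : realType) (disp : measure_display)
    (Omega : measurableType disp) (P : probability Omega K) (p : K)
    (Q : Omega -> Prop) : Prop :=
  exists E : set Omega,
    [/\ measurable E, (p%:E <= P E)%E & forall w, E w -> Q w].

(* R^d carries the Borel sigma-algebra, generated by the coordinates. *)
Definition vec_measurable (K : realType) (disp : measure_display)
    (Omega : measurableType disp) (d : nat) (f : Omega -> 'cV[K]_d) : Prop :=
  forall i : 'I_d, measurable_fun setT (fun w => f w i 0).

Definition preimages (K : realType) (Omega : Type) (f : Omega -> K) :
    set (set Omega) :=
  preimage_set_system setT f (@measurable _ (measurableTypeR K)).

Definition vec_preimages (K : realType) (Omega : Type) (d : nat)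
    (f : Omega -> 'cV[K]_d) : set (set Omega) :=
  \bigcup_(i : 'I_d) preimages (fun w => f w i 0).

(* sigma(x_1, r_1, ..., x_(t-1), r_(t-1), x_t) \/ sigma(thstar_s : s >= 1) *)
Definition history (K : realType) (Omega : Type) (d : nat)
    (thstar x : nat -> Omega -> 'cV[K]_d) (r : nat -> Omega -> K) (t : nat) :
    set (set Omega) :=
  <<s \bigcup_(s in [set s | (1 <= s <= t)%N]) vec_preimages (x s)
      `|` \bigcup_(s in [set s | (1 <= s < t)%N]) preimages (r s)
      `|` \bigcup_(s in [set s | (1 <= s)%N]) vec_preimages (thstar s) >>.

(* Conditionally on the sigma-algebra F, the law of X has the random density
   [q w] with respect to nu. *)
Definition cond_law_density (K : realType) (disp : measure_display)
    (Omega : measurableType disp) (P : probability Omega K)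
    (F : set (set Omega)) (X : Omega -> K)
    (nu : {measure set (measurableTypeR K) -> \bar K})
    (q : Omega -> K -> K) : Prop :=
  forall (A : set Omega) (B : set (measurableTypeR K)),
    F A -> measurable B ->
    P (A `&` X @^-1` B) = (\int[P]_(w in A) \int[nu]_(y in B) (q w y)%:E)%E.

Definition glm_density (K : realType) (g : K) (m h : K -> K) (z y : K) : K :=
  expR ((y * z - m z) / g + h y).

(* g and h stand for g(tau) and h(., tau) at the fixed dispersion tau; the
   link function is m^`(). *)
Record glm_model (K : realType) (R S g kmu cmu : K) (m h : K -> K)
    (nu : {measure set (measurableTypeR K) -> \bar K}) : Prop := {
  glm_convex : convex_function (setT : set (convex_lmodType K^o)) m;
  glm_C3 : class_C3 m;
  glm_base_measurable : measurable_fun [set: measurableTypeR K] h;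
  glm_normalized : forall z : K,
    (\int[nu]_y (glm_density g m h z y)%:E = 1)%E;
  glm_link_bounds : forall z : K, - S <= z <= S ->
    cmu <= m^`(2)%classic z <= kmu;
  glm_self_concordant : forall z : K,
    `|m^`(3)%classic z| <= R * m^`(2)%classic z }.

(* Rounds are numbered from 1; the values at index 0 are irrelevant.  The
   parameters and the action sets may be random: they are deterministic when
   they do not depend on w. *)
Record glb_environment (K : realType) (disp : measure_display)
    (Omega : measurableType disp) (P : probability Omega K) (d : nat)
    (R S g : K) (m h : K -> K)
    (nu : {measure set (measurableTypeR K) -> \bar K})
    (arms : nat -> Omega -> set 'cV[K]_d)
    (thstar x : nat -> Omega -> 'cV[K]_d) (r : nat -> Omega -> K) : Prop := {
  glb_param_measurable : forall t, (1 <= t)%N -> vec_measurable (thstar t);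
  glb_action_measurable : forall t, (1 <= t)%N -> vec_measurable (x t);
  glb_reward_measurable : forall t, (1 <= t)%N -> measurable_fun setT (r t);
  glb_param_bound : forall t w, (1 <= t)%N -> ball2 S (thstar t w);
  glb_arms_bound : forall t w, (1 <= t)%N -> arms t w `<=` ball2 1;
  glb_reward_bound : forall t, (1 <= t)%N ->
    {ae P, forall w, 0 <= r t w <= R};
  glb_action : forall t w, (1 <= t)%N -> arms t w (x t w);
  glb_reward_law : forall t, (1 <= t)%N ->
    cond_law_density P (history thstar x r t) (r t) nu
      (fun w => glm_density g m h (dot (x t w) (thstar t w))) }.

Definition glb_loss (K : realType) (d : nat) (g : K) (m : K -> K)
    (x : 'cV[K]_d) (r : K) (th : 'cV[K]_d) : K :=
  (m (dot x th) - r * dot x th) / g.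

Definition quad_loss (K : realType) (d : nat) (l : 'cV[K]_d -> K)
    (th0 th : 'cV[K]_d) : K :=
  l th0 + dot (grad l th0) (th - th0)
    + 2^-1 * wnorm (hess l th0) (th - th0) ^+ 2.

Definition conf_radius (K : realType) (d : nat)
    (R S g kmu gamma lambda eta delta : K) (t : nat) : K :=
  Num.sqrt (4 * lambda * S ^+ 2
    + 2 * eta * (1 + R ^+ 2 / (g * kmu))
        * ln (pi ^+ 2 * t%:R ^+ 2 / (3 * delta))
    + 2 * eta * (3 * eta + 2^-1) * d%:R
        * ln (1 + kmu * (1 - gamma ^+ t.-1)
                  / (lambda * d%:R * g * (1 - gamma)))).

Definition discounted_reg (K : realType) (d : nat) (gamma lambda : K)
    (H : 'M[K]_d) : 'M[K]_d :=
  gamma *: H + ((1 - gamma) * lambda)%:M.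

(* One trajectory of DOMD-GLB over T rounds.  The starting point theta1 is a
   parameter so that it can be the same on all trajectories. *)
Record domd_glb_run (K : realType) (d : nat)
    (R S g kmu : K) (m : K -> K) (gamma lambda eta delta : K) (T : nat)
    (theta1 : 'cV[K]_d) (arms : nat -> set 'cV[K]_d)
    (x : nat -> 'cV[K]_d) (r : nat -> K)
    (theta : nat -> 'cV[K]_d) (H : nat -> 'M[K]_d) : Prop := {
  domd_init_theta : theta 1%N = theta1;
  domd_init_H : H 1%N = lambda%:M;
  domd_play : forall t, (1 <= t <= T)%N ->
    is_argmax (arms t)
      (fun y => dot y (theta t)
         + conf_radius d R S g kmu gamma lambda eta delta t
             * wnorm (invmx (H t)) y)
      (x t);
  domd_update_theta : forall t, (1 <= t <= T)%N ->
    is_argmin (ball2 S)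
      (fun th => quad_loss (glb_loss g m (x t) (r t)) (theta t) th
         + (2 * eta)^-1
             * wnorm (discounted_reg gamma lambda (H t)) (th - theta t) ^+ 2)
      (theta t.+1);
  domd_update_H : forall t, (1 <= t <= T)%N ->
    H t.+1 = discounted_reg gamma lambda (H t)
             + hess (glb_loss g m (x t) (r t)) (theta t.+1) }.

Definition dyn_regret (K : realType) (d : nat) (mu : K -> K)
    (thstar xstar x : nat -> 'cV[K]_d) (T : nat) : K :=
  \sum_(1 <= t < T.+1)
    (mu (dot (xstar t) (thstar t)) - mu (dot (x t) (thstar t))).

Definition num_changes (K : realType) (d : nat)
    (thstar : nat -> 'cV[K]_d) (T : nat) : nat :=
  (\sum_(1 <= t < T) (thstar t.+1 != thstar t))%N.

(* The polylogarithmic factor hidden in O-tilde: a trivariate polynomial in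
   log(eT), log(e/delta) and log(e/(1-gamma)). *)
Definition polylog (K : realType) (L : {poly {poly {poly K}}}) (T : nat)
    (delta gamma : K) : K :=
  L.[(ln (expR 1 * T%:R))%:P%:P].[(ln (expR 1 / delta))%:P]
   .[ln (expR 1 / (1 - gamma))].

Definition domd_lambda (K : realType) (d : nat) (R S g kmu cmu : K) : K :=
  let eta := 1 + R * S in
  let alpha := 3 * eta / 2 in
  Num.max (6 * eta * R * kmu * S / g)
    (Num.max (32 * alpha * d%:R * R ^+ 2 / 7) (cmu / g)).

Definition tuned_gamma (K : realType) (d T Gamma : nat) (kmu cmu : K) : K :=
  1 - Num.min (1 - T%:R^-1)
        (Num.max T%:R^-1
           ((Gamma%:R * Num.sqrt cmu / (kmu * d%:R * T%:R)) `^ (2 / 3))).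

(* Main.v *)
(* One mirror step in the metric [A_t] bounds the growth of the squared distance
   of the iterate to the true parameter by the gap between the losses at the true
   parameter and at [theta_{t+1}].  The loss at [theta_{t+1}] dominates minus the
   logarithm of a one-dimensional Gaussian mixture of likelihoods along [x_t], up
   to the movement of the iterate and [(3 eta + 1/2) ln (1 + c_t q_t)], where
   [q_t] is the leverage of [x_t] in [A_t] and [c_t] the curvature at
   [theta_{t+1}].  The ratio of the mixture to the true likelihood has conditional
   mean one, and [y^w <= w y + 1 - w] makes the product of its discounted powers
   integrable with mean at most one, so by Markov's inequality the discounted loss
   gap is at most logarithmic once the leverage terms are absorbed by the
   log-determinant of [H_t].  Thus [theta_t] lies in a confidence ellipsoid around
   [thstar_t] in all rounds at distance more than [D ~ log T / (1 - gamma)] from a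
   parameter change, and the other rounds, at most [D * Gamma_T] many, have bounded
   regret.  Optimism and the undiscounted log-determinant bound conclude.  A
   discount tuned to [Gamma_T] is random, but measurable with respect to the
   parameter sequence, hence with respect to every history. *)

From HB Require Import structures.
Require Import Defs.
From mathcomp Require Import all_boot all_order all_algebra.
From mathcomp Require Import all_classical all_reals all_analysis.
From mathcomp Require Import measurable_realfun ring lra.

Set Implicit Arguments.
Unset Strict Implicit.
Unset Printing Implicit Defensive.

Import Order.TTheory GRing.Theory Num.Theory.
Import numFieldNormedType.Exports.

Local Open Scope classical_set_scope.
Local Open Scope ring_scope.

(** * Linear algebra of positive definite forms *)

Section QuadraticForms.
Context {K : realType}.
Implicit Types (n : nat).

Definition bform n (M : 'M[K]_n) (u v : 'cV[K]_n) : K := (u^T *m M *m v) 0 0.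

Lemma bformDl n (M : 'M[K]_n) u v w :
  bform M (u + v) w = bform M u w + bform M v w.
Proof. by rewrite /bform linearD /= !mulmxDl mxE. Qed.

Lemma bformDr n (M : 'M[K]_n) u v w :
  bform M u (v + w) = bform M u v + bform M u w.
Proof. by rewrite /bform mulmxDr mxE. Qed.

Lemma bformZl n (M : 'M[K]_n) a u v : bform M (a *: u) v = a * bform M u v.
Proof. by rewrite /bform linearZ /= -!scalemxAl mxE. Qed.

Lemma bformZr n (M : 'M[K]_n) a u v : bform M u (a *: v) = a * bform M u v.
Proof. by rewrite /bform -scalemxAr mxE. Qed.

Lemma bformNl n (M : 'M[K]_n) u v : bform M (- u) v = - bform M u v.
Proof. by rewrite -scaleN1r bformZl mulN1r. Qed.

Lemma bformNr n (M : 'M[K]_n) u v : bform M u (- v) = - bform M u v.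
Proof. by rewrite -scaleN1r bformZr mulN1r. Qed.

Lemma bform_addmx n (M N : 'M[K]_n) u v :
  bform (M + N) u v = bform M u v + bform N u v.
Proof. by rewrite /bform mulmxDr mulmxDl mxE. Qed.

Lemma bform_scalemx n a (M : 'M[K]_n) u v :
  bform (a *: M) u v = a * bform M u v.
Proof. by rewrite /bform -scalemxAr -scalemxAl mxE. Qed.

Lemma dotE n (u v : 'cV[K]_n) : dot u v = \sum_i u i 0 * v i 0.
Proof. by rewrite /dot mxE; apply: eq_bigr => i _; rewrite mxE. Qed.

Lemma dotC n (u v : 'cV[K]_n) : dot u v = dot v u.
Proof. by rewrite !dotE; apply: eq_bigr => i _; rewrite mulrC. Qed.

Lemma bform_scalar n a (u v : 'cV[K]_n) : bform a%:M u v = a * dot u v.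
Proof. by rewrite /bform mul_mx_scalar -scalemxAl mxE. Qed.

Lemma dot_bform n (u v : 'cV[K]_n) : dot u v = bform 1%:M u v.
Proof. by rewrite bform_scalar mul1r. Qed.

Lemma bform_outer n (x u v : 'cV[K]_n) :
  bform (x *m x^T) u v = dot x u * dot x v.
Proof.
rewrite /bform mulmxA -(mulmxA _ _ v) [LHS]mxE big_ord1 -/(dot u x) -/(dot x v).
by rewrite (dotC u x).
Qed.

Lemma dotDr n (u v w : 'cV[K]_n) : dot u (v + w) = dot u v + dot u w.
Proof. by rewrite !dot_bform bformDr. Qed.

Lemma dotNr n (u v : 'cV[K]_n) : dot u (- v) = - dot u v.
Proof. by rewrite !dot_bform bformNr. Qed.

Lemma dotBr n (u v w : 'cV[K]_n) : dot u (v - w) = dot u v - dot u w.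
Proof. by rewrite dotDr dotNr. Qed.

Lemma dotZr n a (u v : 'cV[K]_n) : dot u (a *: v) = a * dot u v.
Proof. by rewrite !dot_bform bformZr. Qed.

Lemma dot_ge0 n (u : 'cV[K]_n) : 0 <= dot u u.
Proof. by rewrite dotE sumr_ge0 // => i _; rewrite -expr2 sqr_ge0. Qed.

Lemma dot_eq0 n (u : 'cV[K]_n) : (dot u u == 0) = (u == 0).
Proof.
apply/idP/eqP => [|->]; last by rewrite dotE big1 // => i _; rewrite mxE mul0r.
rewrite dotE psumr_eq0 => [/allP h|i _]; last by rewrite -expr2 sqr_ge0.
apply/colP => i; rewrite mxE.
by have := h i (mem_index_enum _); rewrite /= -expr2 sqrf_eq0 => /eqP.
Qed.

Lemma bform_sym n (M : 'M[K]_n) u v : M^T = M -> bform M u v = bform M v u.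
Proof.
move=> sM; rewrite /bform -[in LHS]sM.
have -> : u^T *m M^T *m v = (v^T *m M *m u)^T.
  by rewrite !trmx_mul trmxK mulmxA.
by rewrite mxE.
Qed.

Lemma sqr_norm2 n (u : 'cV[K]_n) : norm2 u ^+ 2 = dot u u.
Proof. by rewrite sqr_sqrtr ?dot_ge0. Qed.

Lemma norm2_ge0 n (u : 'cV[K]_n) : 0 <= norm2 u.
Proof. exact: sqrtr_ge0. Qed.

Definition psd n (M : 'M[K]_n) := forall u, 0 <= bform M u u.
Definition spd n (M : 'M[K]_n) :=
  M^T = M /\ forall u, u != 0 -> 0 < bform M u u.

Lemma spd_psd n (M : 'M[K]_n) : spd M -> psd M.
Proof.
move=> [_ pM] u; have [->|/pM/ltW//] := eqVneq u 0.
by rewrite /bform mulmx0 mxE.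
Qed.

Lemma bform_cs n (M : 'M[K]_n) u v : M^T = M -> psd M ->
  bform M u v ^+ 2 <= bform M u u * bform M v v.
Proof.
move=> sM pM; set a := bform M u u; set b := bform M u v; set c := bform M v v.
have key s t : 0 <= s ^+ 2 * a + 2 * s * t * b + t ^+ 2 * c.
  have := pM (s *: u + t *: v).
  rewrite !(bformDl, bformDr, bformZl, bformZr) (bform_sym v u sM) -/a -/b -/c.
  by congr (0 <= _); ring.
have a0 : 0 <= a by exact: pM.
have [a_gt0|a_le0] := ltP 0 a.
  have := key b (- a).
  have -> : b ^+ 2 * a + 2 * b * - a * b + (- a) ^+ 2 * c
            = a * (a * c - b ^+ 2) by ring.
  by rewrite pmulr_rge0 // subr_ge0.
have aE : a = 0 by apply/eqP; rewrite eq_le a_le0 a0.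
have [->|b0] := eqVneq b 0; first by rewrite aE mul0r expr0n.
have := key (- (c + 1) / (2 * b)) 1; rewrite aE.
have -> : (- (c + 1) / (2 * b)) ^+ 2 * 0 + 2 * (- (c + 1) / (2 * b)) * 1 * b
          + 1 ^+ 2 * c = -1 by field.
by rewrite ler0N1.
Qed.

Lemma dot_cs n (u v : 'cV[K]_n) : dot u v <= norm2 u * norm2 v.
Proof.
apply: le_trans (ler_norm _) _.
rewrite -(@ler_pXn2r _ 2) ?nnegrE ?mulr_ge0 ?norm2_ge0 // exprMn !sqr_norm2.
rewrite real_normK ?num_real // !dot_bform; apply: bform_cs; first exact: trmx1.
by move=> w; rewrite -dot_bform dot_ge0.
Qed.

Lemma dot_abs_le n (u v : 'cV[K]_n) : `|dot u v| <= norm2 u * norm2 v.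
Proof.
rewrite ler_norml dot_cs andbT lerNl -dotNr.
apply: le_trans (dot_cs _ _) _; rewrite /norm2 !dot_bform.
by rewrite bformNl bformNr opprK.
Qed.

Lemma spd_unit n (M : 'M[K]_n) : spd M -> M \in unitmx.
Proof.
move=> [sM pM]; rewrite -row_free_unit -kermx_eq0; apply/eqP/row_matrixP => i.
rewrite row0; apply/eqP; rewrite -[_ == 0]negbK; apply/negP => r0.
have rM : row i (kermx M) *m M = 0 by rewrite -row_mul mulmx_ker row0.
have := pM (row i (kermx M))^T; rewrite /bform trmxK rM mul0mx mxE ltxx.
by move=> /(_ _)/negP []; rewrite // trmx_eq0.
Qed.

Lemma spd_ler n (M : 'M[K]_n) l : M^T = M -> 0 < l ->
  (forall u, l * dot u u <= bform M u u) -> spd M.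
Proof.
move=> sM l0 lM; split=> // u u0; apply: lt_le_trans (lM u).
by rewrite mulr_gt0 // lt0r dot_eq0 u0 dot_ge0.
Qed.

Lemma invmx_sym n (M : 'M[K]_n) : M^T = M -> (invmx M)^T = invmx M.
Proof. by move=> sM; rewrite trmx_inv sM. Qed.

Lemma bform_inv n (M : 'M[K]_n) x : spd M ->
  bform (invmx M) x x = bform M (invmx M *m x) (invmx M *m x)
  /\ bform (invmx M) x x = dot x (invmx M *m x).
Proof.
move=> [sM pM]; have uM : M \in unitmx by exact: spd_unit.
rewrite /bform /dot trmx_mul invmx_sym // !mulmxA mulmxKV //.
Qed.

Lemma invmx_psd n (M : 'M[K]_n) : spd M -> psd (invmx M).
Proof. by move=> sM u; rewrite (bform_inv u sM).1; apply: spd_psd. Qed.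

Lemma dot_cs_inv n (M : 'M[K]_n) x u : spd M ->
  dot x u ^+ 2 <= bform (invmx M) x x * bform M u u.
Proof.
move=> sM; rewrite (bform_inv x sM).1.
have -> : dot x u = bform M (invmx M *m x) u.
  rewrite /bform /dot trmx_mul invmx_sym ?sM.1 // mulmxKV //.
  exact: spd_unit.
by apply: bform_cs; [exact: sM.1 | exact: spd_psd].
Qed.

Lemma bform_inv_mono n (A H : 'M[K]_n) x : spd A -> spd H ->
  (forall u, bform A u u <= bform H u u) ->
  bform (invmx H) x x <= bform (invmx A) x x.
Proof.
move=> sA sH AH; set y := invmx H *m x.
have [e1 e2] := bform_inv x sH.
have h := dot_cs_inv x y sA; rewrite -e2 in h.
have q0 := invmx_psd sH x.
have [q_gt0|] := ltP 0 (bform (invmx H) x x); last first.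
  by move=> h0; apply: le_trans h0 (invmx_psd sA x).
rewrite -(ler_pM2r q_gt0) -expr2; apply: le_trans h _.
by rewrite ler_wpM2l ?(invmx_psd sA) // [leRHS]e1.
Qed.

Lemma bform_inv_le n (M : 'M[K]_n) l x : M^T = M -> 0 < l ->
  (forall u, l * dot u u <= bform M u u) ->
  bform (invmx M) x x <= dot x x / l.
Proof.
move=> sM l0 lM; have pM := spd_ler sM l0 lM.
have [e1 e2] := bform_inv x pM; set y := invmx M *m x in e1 e2.
have h := bform_cs x y (@trmx1 K n) _; rewrite -!dot_bform -e2 in h.
have {}h := h (fun w => le_trans (dot_ge0 w) (eq_ind _ (fun t => t <= _) (lexx _) _ (esym (dot_bform w w)))).
have q0 := invmx_psd pM x.
have [q_gt0|h0] := ltP 0 (bform (invmx M) x x); last first.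
  by apply: le_trans h0 _; rewrite divr_ge0 ?dot_ge0 // ltW.
rewrite ler_pdivlMr // -(ler_pM2r q_gt0) mulrAC -expr2.
apply: le_trans (ler_wpM2r (ltW l0) h) _.
rewrite -mulrA ler_wpM2l ?dot_ge0 // mulrC e1; exact: lM.
Qed.

Lemma schur_reduction n (A : 'M[K]_(1 + n)) : spd A ->
  exists (E : 'M[K]_(1 + n)) a C,
    [/\ \det E = 1, E^T *m A *m E = block_mx a%:M 0 0 C, 0 < a, spd C
      & a + \tr C <= \tr A].
Proof.
move=> [sA pA]; pose a := A 0 0; pose b := dlsubmx A; pose C := drsubmx A.
have ulE : ulsubmx A = a%:M.
  by apply/matrixP => i j; rewrite !ord1 !mxE eqxx mulr1n /a; congr (A _ _);
     apply/val_inj.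
have urE : ursubmx A = b^T by rewrite -[in LHS]sA /b trmx_dlsub.
have AE : A = block_mx a%:M b^T b C.
  by rewrite -ulE -urE /b /C submxK.
have a0 : 0 < a.
  have e0 : (delta_mx 0 0 : 'cV[K]_(1 + n)) != 0.
    apply/eqP => /matrixP /(_ 0 0); rewrite !mxE !eqxx => /eqP.
    by rewrite oner_eq0.
  have := pA _ e0; rewrite /bform trmx_delta -rowE.
  by rewrite -colE !mxE.
have sC : C^T = C by rewrite /C -[in RHS]sA trmx_drsub.
pose E : 'M[K]_(1 + n) := block_mx 1%:M (- a^-1 *: b^T) 0 1%:M.
pose C' := C - a^-1 *: (b *m b^T).
exists E, a, C'.
have EAE : E^T *m A *m E = block_mx a%:M 0 0 C'.
  rewrite AE /E tr_block_mx !mulmx_block !trmx1 trmx0 !mul1mx !mul0mx !mulmx1.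
  have tE : (- a^-1 *: b^T)^T = - a^-1 *: b.
    by apply/matrixP => i j; rewrite !mxE.
  rewrite tE !mulmx0 !addr0 -!scalemxAl -!scalemxAr.
  rewrite mul_mx_scalar !scalerA mul_scalar_mx scalerA.
  have aa : a * - a^-1 = -1 by rewrite mulrN divff ?gt_eqF.
  have aa' : - a^-1 * a = -1 by rewrite mulrC.
  rewrite aa' !scaleN1r !addNr !mul0mx scaler0 add0r; congr block_mx.
  by rewrite addrC scaleNr /C'.
split=> //.
- by rewrite /E det_ublock !det1 mulr1.
- split.
    by rewrite /C' linearB /= sC linearZ /= trmx_mul trmxK.
  move=> u u0; pose v : 'cV[K]_(1 + n) := E *m col_mx 0 u.
  have -> : bform C' u u = bform A v v.
    rewrite /v /bform trmx_mul.
    have -> : (col_mx 0 u)^T *m E^T *m A *m (E *m col_mx 0 u) =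
              (col_mx 0 u)^T *m (E^T *m A *m E) *m col_mx 0 u.
      by rewrite !mulmxA.
    rewrite EAE tr_col_mx mul_row_block mul_row_col.
    by rewrite !(mulmx0, trmx0, mul0mx, add0r, addr0).
  apply: pA; apply/eqP => v0; case/eqP: u0.
  have uE : E \in unitmx by rewrite unitmxE /E det_ublock !det1 mulr1 unitr1.
  have : invmx E *m v = 0 by rewrite v0 mulmx0.
  by rewrite /v mulKmx // => /eqP; rewrite col_mx_eq0 => /andP[_ /eqP].
- have -> : \tr A = a + \tr C.
    rewrite AE mxtrace_block mxtrace_scalar mulr1n //.
  rewrite lerD2l /C' linearB /= lerBlDr lerDl mxtraceZ.
  rewrite mulr_ge0 ?invr_ge0 ?(ltW a0) // sumr_ge0 // => i _.
  by rewrite mxE big_ord1 (mxE _ _ 0 i) -expr2 sqr_ge0.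
Qed.

Lemma spd_congr_id n (A : 'M[K]_n) : spd A ->
  exists2 P, P \in unitmx & P^T *m A *m P = 1%:M.
Proof.
elim: n A => [|n IH] A sA.
  by exists 1%:M; [exact: unitmx1 | apply/matrixP => -[]].
rewrite -[n.+1]/(1 + n)%N in A sA *.
have [E [a [C [dE EAE a0 sC _]]]] := schur_reduction sA.
have [Q uQ QCQ] := IH C sC.
pose D : 'M[K]_(1 + n) := block_mx (Num.sqrt a)^-1%:M 0 0 Q.
exists (E *m D).
  rewrite unitmx_mul unitmxE dE unitr1 unitmxE /D det_ublock det_scalar expr1.
  by rewrite unitrM -unitmxE uQ unitfE invr_eq0 gt_eqF ?sqrtr_gt0.
have -> : (E *m D)^T *m A *m (E *m D) = D^T *m (E^T *m A *m E) *m D.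
  by rewrite trmx_mul !mulmxA.
rewrite EAE /D tr_block_mx !mulmx_block !trmx0 tr_scalar_mx.
rewrite !(mul0mx, mulmx0, addr0, add0r) QCQ -!scalar_mxM.
rewrite mulrAC -invfM -expr2 sqr_sqrtr ?(ltW a0) // mulVf ?gt_eqF //.
by rewrite -scalar_mx_block.
Qed.

Lemma spd_det_gt0 n (A : 'M[K]_n) : spd A -> 0 < \det A.
Proof.
move=> sA; have [P uP e] := spd_congr_id sA.
have := congr1 determinant e; rewrite !det_mulmx det_tr det1 mulrAC -expr2.
move=> d1; rewrite -(@pmulr_rgt0 _ (\det P ^+ 2)) ?d1 //.
by rewrite lt0r sqr_ge0 andbT sqrf_eq0 -unitfE -unitmxE.
Qed.

Lemma ln_det_le_tr n (A : 'M[K]_n) : spd A -> ln (\det A) <= \tr A - n%:R.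
Proof.
elim: n A => [|n IH] A sA.
  by rewrite det_mx00 ln1 /mxtrace big_ord0 subr0.
rewrite -[n.+1]/(1 + n)%N in A sA *.
have [E [a [C [dE EAE a0 sC trA]]]] := schur_reduction sA.
have := congr1 determinant EAE.
rewrite !det_mulmx det_tr dE mul1r mulr1 det_ublock det_scalar expr1 => ->.
rewrite lnM ?posrE ?(spd_det_gt0 sC) //.
have h1 : ln a <= a - 1.
  have := @le_ln1Dx K (a - 1); rewrite addrCA subrr addr0; apply.
  by rewrite ltrBrDr addNr.
have h2 := IH C sC.
rewrite natrD; lra.
Qed.

Lemma ln_det_tangent n (A H : 'M[K]_n) : spd A -> spd H ->
  ln (\det H) <= ln (\det A) + \tr (invmx A *m H) - n%:R.
Proof.
move=> sA sH; have [P uP e] := spd_congr_id sA.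
have uA := spd_unit sA.
have sZ : spd (P^T *m H *m P).
  split; first by rewrite !trmx_mul trmxK sH.1 mulmxA.
  move=> u u0; have -> : bform (P^T *m H *m P) u u = bform H (P *m u) (P *m u).
    by rewrite /bform trmx_mul !mulmxA.
  apply: sH.2; apply/eqP => Pu; case/eqP: u0.
  by rewrite -[u](mulKmx uP) Pu mulmx0.
have := ln_det_le_tr sZ.
have dA := spd_det_gt0 sA; have dH := spd_det_gt0 sH.
have -> : \det (P^T *m H *m P) = \det H / \det A.
  have := congr1 determinant e; rewrite !det_mulmx det_tr det1 => e1.
  apply: (mulIf (lt0r_neq0 dA)); rewrite divfK ?gt_eqF //.
  by rewrite -[RHS]mul1r -e1; ring.
have -> : \tr (P^T *m H *m P) = \tr (invmx A *m H).
  rewrite mxtrace_mulC mulmxA; congr (\tr (_ *m _)).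
  have uPt : P^T \in unitmx by rewrite unitmx_tr.
  apply: (can_inj (mulKmx uPt)); apply: (can_inj (mulmxK uA)).
  rewrite mulmxA -[RHS]mulmxA mulVmx // mulmx1.
  apply: (can_inj (mulmxK uP)).
  have -> : P^T *m P *m P^T *m A *m P = P^T *m P *m (P^T *m A *m P).
    by rewrite !mulmxA.
  by rewrite e mulmx1.
by rewrite ln_div ?posrE // lerBlDr => h; lra.
Qed.

Lemma ln_det_concave n (H : 'M[K]_n) (c l : K) : spd H -> 0 < c <= 1 -> 0 < l ->
  c * ln (\det H) + (1 - c) * (n%:R * ln l)
  <= ln (\det (c *: H + ((1 - c) * l)%:M)).
Proof.
move=> sH /andP[c0 c1] l0; set A := c *: H + _.
have sL : spd (l%:M : 'M[K]_n).
  split; first exact: tr_scalar_mx.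
  by move=> u u0; rewrite bform_scalar mulr_gt0 // lt0r dot_eq0 u0 dot_ge0.
have sA : spd A.
  split; first by rewrite linearD linearZ /= sH.1 tr_scalar_mx.
  move=> u u0; rewrite bform_addmx bform_scalemx bform_scalar.
  rewrite ltr_wpDr ?mulr_gt0 ?sH.2 // !mulr_ge0 ?dot_ge0 ?subr_ge0 // ltW //.
have h1 := ln_det_tangent sA sH; have h2 := ln_det_tangent sA sL.
have : c * \tr (invmx A *m H) + (1 - c) * \tr (invmx A *m l%:M) = n%:R.
  rewrite -!mxtraceZ -mxtraceD !scalemxAr -mulmxDr scale_scalar_mx -/A.
  by rewrite mulVmx ?spd_unit // mxtrace1.
rewrite det_scalar lnXn // -mulr_natl in h2.
have c1' : 0 <= 1 - c by rewrite subr_ge0.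
move: (ler_wpM2l (ltW c0) h1) (ler_wpM2l c1' h2) => {}h1 {}h2 h3.
lra.
Qed.

Lemma ln_det_le_ln_tr n (H : 'M[K]_n) t : spd H -> (0 < n)%N ->
  \tr H <= n%:R * t -> ln (\det H) <= n%:R * ln t.
Proof.
move=> sH n0 trH.
have n0' : 0 < n%:R :> K by rewrite ltr0n.
have t0 : 0 < t.
  rewrite -(pmulr_rgt0 _ n0'); apply: lt_le_trans trH.
  rewrite /mxtrace (bigD1 (Ordinal n0)) //= ltr_pwDl ?sumr_ge0 // => [|i _].
    have e0 : (delta_mx (Ordinal n0) 0 : 'cV[K]_n) != 0.
      apply/eqP => /matrixP /(_ (Ordinal n0) 0); rewrite !mxE !eqxx => /eqP.
      by rewrite oner_eq0.
    by have := sH.2 _ e0; rewrite /bform trmx_delta -rowE -colE !mxE.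
  by have := spd_psd sH (delta_mx i 0); rewrite /bform trmx_delta -rowE -colE !mxE.
have sL : spd (t%:M : 'M[K]_n).
  split; first exact: tr_scalar_mx.
  by move=> u u0; rewrite bform_scalar mulr_gt0 // lt0r dot_eq0 u0 dot_ge0.
have := ln_det_tangent sL sH.
rewrite invmx_scalar mul_scalar_mx mxtraceZ det_scalar lnXn //.
rewrite -(mulr_natl (ln _)) => h.
apply: le_trans h _; rewrite -addrA gerDl subr_le0 mulrC ler_pdivrMr //.
Qed.

Lemma det_rank1 n (A : 'M[K]_n) c x : A \in unitmx ->
  \det (A + c *: (x *m x^T)) = \det A * (1 + c * bform (invmx A) x x).
Proof.
move=> uA.
pose B : 'M[K]_(1 + n) := block_mx 1%:M (- x^T) (c *: x) A.
have d1 : \det B = \det (A + c *: (x *m x^T)).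
  have e : B *m block_mx 1%:M x^T 0 1%:M =
           block_mx 1%:M 0 (c *: x) (A + c *: (x *m x^T)).
    rewrite /B mulmx_block !mul1mx !mulmx0 !mulmx1 !addr0 subrr.
    by rewrite -scalemxAl addrC.
  have := congr1 determinant e; rewrite det_mulmx det_ublock !det1 !mulr1.
  by rewrite det_lblock det1 mul1r.
have d2 : \det B = \det A * (1 + c * bform (invmx A) x x).
  have e : B *m block_mx 1%:M 0 (- c *: (invmx A *m x)) 1%:M =
           block_mx (1 + c * bform (invmx A) x x)%:M (- x^T) 0 A.
    rewrite /B mulmx_block !mulmx1 !mulmx0 !add0r.
    congr block_mx.
      rewrite scaleNr mulmxN mulNmx opprK -scalemxAr.
      apply/matrixP => i j; rewrite !ord1 mulmxA !mxE eqxx !mulr1n.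
      by congr (_ + _ * _); rewrite /bform !mxE.
    by rewrite -scalemxAr mulKVmx // scaleNr subrr.
  have := congr1 determinant e; rewrite det_mulmx det_lblock !det1 !mulr1.
  by rewrite det_ublock det_scalar expr1 mulrC.
by rewrite -d1 d2.
Qed.

End QuadraticForms.

(** * Self-concordant links *)

Section SelfConcordance.
Context {K : realType}.

Lemma derive_ge0_le (f df : K -> K) (a b : K) : a <= b ->
  (forall x : K, is_derive x 1 f (df x)) ->
  (forall x, a <= x -> 0 <= df x) -> f a <= f b.
Proof.
move=> ab fdf df0.
have [|c cab e] := @MVT_segment K f df a b ab.
  apply: continuous_subspaceT => x; apply: differentiable_continuous.
  by apply/derivable1_diffP; case: (fdf x).
rewrite -subr_ge0 e mulr_ge0 ?subr_ge0 // df0 //.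
by move: cab; rewrite in_itv /= => /andP[].
Qed.

Definition self_concordant (R : K) (m f1 f2 f3 : K -> K) : Prop :=
  [/\ forall x : K, is_derive x 1 m (f1 x), forall x : K, is_derive x 1 f1 (f2 x),
      forall x : K, is_derive x 1 f2 (f3 x) & forall x, `|f3 x| <= R * f2 x].

Lemma is_derive_affine (f : K -> K) (l a c x : K) :
  is_derive (a + c * x) 1 f l ->
  is_derive x 1 (fun t => f (a + c * t)) (c * l).
Proof. by move=> d; apply: is_derive_eq; rewrite /GRing.scale /=; ring. Qed.

Lemma is_derive_shift (f : K -> K) (l a x : K) :
  is_derive (a + x) 1 f l -> is_derive x 1 (fun t => f (a + t)) l.
Proof. by move=> d; apply: is_derive_eq; rewrite /GRing.scale /=; ring. Qed.

Lemma is_derive_reflect (f : K -> K) (l x : K) :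
  is_derive (- x) 1 f l -> is_derive x 1 (fun t => f (- t)) (- l).
Proof. by move=> d; apply: is_derive_eq; rewrite /GRing.scale /=; ring. Qed.

Lemma self_concordant_opp R m f1 f2 f3 : self_concordant R m f1 f2 f3 ->
  self_concordant R (fun x => m (- x)) (fun x => - f1 (- x))
    (fun x => f2 (- x)) (fun x => - f3 (- x)).
Proof.
move=> [d1 d2 d3 sc]; split=> x.
- exact: is_derive_reflect.
- have d := is_derive_reflect (d2 (- x)).
  by apply: is_derive_eq; rewrite opprK.
- exact: is_derive_reflect.
- by rewrite normrN.
Qed.

Variables (R : K) (R0 : 0 < R).

Lemma sc_ge0 m f1 f2 f3 x : self_concordant R m f1 f2 f3 -> 0 <= f2 x.
Proof.
by move=> [_ _ _ sc]; rewrite -(pmulr_rge0 _ R0) (le_trans _ (sc x)).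
Qed.

Lemma sc_growth_pos m f1 f2 f3 a v : self_concordant R m f1 f2 f3 -> 0 <= v ->
  f2 a * expR (- (R * v)) <= f2 (a + v) <= f2 a * expR (R * v).
Proof.
move=> [d1 d2 d3 sc] v0; apply/andP; split.
- rewrite expRN ler_pdivrMr ?expR_gt0 //.
  pose f t := f2 (a + t) * expR (R * t).
  pose df t := (f3 (a + t) + R * f2 (a + t)) * expR (R * t).
  suff : f 0 <= f v by rewrite /f addr0 mulr0 expR0 mulr1.
  apply: (@derive_ge0_le f df) => // x; last first.
    move=> _; rewrite /df mulr_ge0 ?expR_ge0 //.
    by have := sc (a + x); rewrite ler_norml => /andP[h _]; lra.
  have d := is_derive_shift (d3 (a + x)).
  apply: is_derive_eq; by rewrite /df /GRing.scale /=; ring.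
- rewrite -ler_pdivrMr ?expR_gt0 // -expRN.
  pose f t := - (f2 (a + t) * expR (- (R * t))).
  pose df t := (R * f2 (a + t) - f3 (a + t)) * expR (- (R * t)).
  suff : f 0 <= f v by rewrite /f addr0 mulr0 oppr0 expR0 mulr1 lerN2.
  apply: (@derive_ge0_le f df) => // x; last first.
    move=> _; rewrite /df mulr_ge0 ?expR_ge0 //.
    by have := sc (a + x); rewrite ler_norml => /andP[_ h]; lra.
  have d := is_derive_shift (d3 (a + x)).
  apply: is_derive_eq; by rewrite /df /GRing.scale /=; ring.
Qed.

Let psi (c : K) (v : K) : K := (expR (c * v) - 1 - c * v) / c ^+ 2.

Let psi_derive (c v : K) : c != 0 ->
  is_derive v 1 (psi c) ((expR (c * v) - 1) / c) .
Proof.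
by move=> c0; rewrite /psi; apply: is_derive_eq; rewrite /GRing.scale /=; field.
Qed.

Lemma sc_bregman_pos m f1 f2 f3 a v : self_concordant R m f1 f2 f3 -> 0 <= v ->
  f2 a * psi (- R) v <= m (a + v) - m a - f1 a * v <= f2 a * psi R v.
Proof.
move=> sc v0; have [d1 d2 d3 _] := sc.
have R0' : R != 0 by rewrite gt_eqF.
have R0n : - R != 0 by rewrite oppr_eq0.
apply/andP; split.
- have h1 u : 0 <= u -> f2 a * ((1 - expR (- R * u)) / R) <= f1 (a + u) - f1 a.
    move=> u0.
    pose f t := f1 (a + t) - f2 a * ((1 - expR (- R * t)) / R).
    pose df t := f2 (a + t) - f2 a * expR (- R * t).
    suff : f 0 <= f u.
      by rewrite /f addr0 mulr0 expR0 subrr mul0r mulr0 subr0 => h; lra.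
    apply: (@derive_ge0_le f df) => // x; last first.
      move=> x0; rewrite /df subr_ge0 mulNr.
      by case/andP: (sc_growth_pos a sc x0).
    have d := is_derive_shift (d2 (a + x)).
    by rewrite /f; apply: is_derive_eq; rewrite /df /GRing.scale /=; field.
  pose f t := m (a + t) - m a - f1 a * t - f2 a * psi (- R) t.
  pose df t := f1 (a + t) - f1 a - f2 a * ((expR (- R * t) - 1) / - R).
  suff : f 0 <= f v.
    have -> : f 0 = 0.
      by rewrite /f /psi !(mulr0, addr0, subr0, subrr, mul0r, expR0).
    by rewrite /f => h; lra.
  apply: (@derive_ge0_le f df) => // x; last first.
    move=> x0; rewrite /df subr_ge0; apply: le_trans (h1 x x0).
    by rewrite invrN mulrN -mulNr opprB.
  have d := is_derive_shift (d1 (a + x)).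
  have d' := @psi_derive (- R) x R0n.
  by rewrite /f; apply: is_derive_eq; rewrite /df /GRing.scale /=; field.
- have h1 u : 0 <= u -> f1 (a + u) - f1 a <= f2 a * ((expR (R * u) - 1) / R).
    move=> u0.
    pose f t := f2 a * ((expR (R * t) - 1) / R) - f1 (a + t).
    pose df t := f2 a * expR (R * t) - f2 (a + t).
    suff : f 0 <= f u.
      by rewrite /f addr0 mulr0 expR0 subrr mul0r mulr0 sub0r => h; lra.
    apply: (@derive_ge0_le f df) => // x; last first.
      move=> x0; rewrite /df subr_ge0.
      by case/andP: (sc_growth_pos a sc x0).
    have d := is_derive_shift (d2 (a + x)).
    by rewrite /f; apply: is_derive_eq; rewrite /df /GRing.scale /=; field.
  pose f t := f2 a * psi R t - (m (a + t) - m a - f1 a * t).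
  pose df t := f2 a * ((expR (R * t) - 1) / R) - (f1 (a + t) - f1 a).
  suff : f 0 <= f v.
    have -> : f 0 = 0.
      by rewrite /f /psi !(mulr0, addr0, subr0, subrr, mul0r, expR0).
    by rewrite /f => h; lra.
  apply: (@derive_ge0_le f df) => // x; last first.
    by move=> x0; rewrite /df subr_ge0; exact: h1.
  have d := is_derive_shift (d1 (a + x)).
  have d' := @psi_derive R x R0'.
  by rewrite /f; apply: is_derive_eq; rewrite /df /GRing.scale /=; ring.
Qed.

Let sc_bregman m f1 f2 f3 a v : self_concordant R m f1 f2 f3 ->
  f2 a * psi (- R) `|v| <= m (a + v) - m a - f1 a * v <= f2 a * psi R `|v|.
Proof.
move=> sc; have [v0|v0] := leP 0 v.
  by rewrite ger0_norm //; exact: sc_bregman_pos sc v0.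
rewrite ltr0_norm //; have nv0 : 0 <= - v by rewrite oppr_ge0 ltW.
have := sc_bregman_pos (- a) (self_concordant_opp sc) nv0.
by rewrite -opprD !opprK mulrNN.
Qed.

Lemma expRN_lower (x : K) : 0 <= x ->
  x ^+ 2 / (2 + x) <= expR (- x) - 1 + x.
Proof.
move=> x0; rewrite ler_pdivrMr ?ltr_pwDl //.
pose f t : K := 2 + t - (2 - t) * expR t.
pose df t : K := 1 - (1 - t) * expR t.
have key : f 0 <= f x.
  apply: (@derive_ge0_le f df) => // t; last first.
    move=> _; rewrite /df subr_ge0 -ler_pdivlMr ?expR_gt0 // mul1r -expRN.
    exact: expR_ge1Dx.
  by rewrite /f; apply: is_derive_eq; rewrite /df /GRing.scale /=; ring.
have e1 : expR (- x) * expR x = 1 by rewrite -expRD addNr expR0.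
have : 0 <= expR (- x) * f x.
  by rewrite mulr_ge0 ?expR_ge0 // (le_trans _ key) // /f expR0; lra.
rewrite /f => h; rewrite -subr_ge0; apply: le_trans h _.
have -> : expR (- x) * (2 + x - (2 - x) * expR x)
  = expR (- x) * (2 + x) - (2 - x) * (expR (- x) * expR x) by ring.
rewrite e1; lra.
Qed.

Lemma sc_bregman_lower m f1 f2 f3 a v : self_concordant R m f1 f2 f3 ->
  f2 a * (v ^+ 2 / (2 + R * `|v|)) <= m (a + v) - m a - f1 a * v.
Proof.
move=> sc; have /andP[h _] := sc_bregman a v sc; apply: le_trans h.
apply: (ler_wpM2l (sc_ge0 a sc)).
have Rv0 : 0 <= R * `|v| by rewrite mulr_ge0 // ltW.
rewrite /psi sqrrN ler_pdivlMr ?exprn_gt0 //.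
have := expRN_lower Rv0; rewrite mulNr opprK exprMn real_normK ?num_real //.
by rewrite [in X in _ -> X]mulrAC (mulrC (v ^+ 2)).
Qed.

Lemma sc_bregman_upper m f1 f2 f3 a v : self_concordant R m f1 f2 f3 ->
  m (a + v) - m a - f1 a * v
  <= f2 a * ((expR (R * v) + expR (- (R * v)) - 2) / R ^+ 2).
Proof.
move=> sc; have /andP[_ h] := sc_bregman a v sc; apply: le_trans h _.
apply: (ler_wpM2l (sc_ge0 a sc)); rewrite /psi ler_pM2r ?invr_gt0 ?exprn_gt0 //.
have -> : expR (R * v) + expR (- (R * v))
  = expR (R * `|v|) + expR (- (R * `|v|)).
  by have [v0|v0] := leP 0 v; [rewrite ger0_norm | rewrite ltr0_norm // mulrN opprK addrC].
by have := @expR_ge1Dx K (- (R * `|v|)); lra.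
Qed.

Lemma sc_mean_increasing m f1 f2 f3 a b : self_concordant R m f1 f2 f3 ->
  a <= b -> f1 a <= f1 b.
Proof.
move=> sc ab; have [_ d2 _ _] := sc; apply: (@derive_ge0_le f1 f2) => //.
by move=> x _; apply: sc_ge0 sc.
Qed.

Let clip_derive_le m f1 f2 f3 S k a b : self_concordant R m f1 f2 f3 ->
  (forall x, - S <= x <= S -> f2 x <= k) -> a <= b -> - S <= a -> b <= S ->
  exists2 c, a <= c <= b & f1 b - f1 a = f2 c * (b - a).
Proof.
move=> sc hk ab Sa bS; have [_ d2 _ _] := sc.
have [|c cab e] := @MVT_segment K f1 f2 a b ab.
  apply: continuous_subspaceT => x; apply: differentiable_continuous.
  by apply/derivable1_diffP; case: (d2 x).
by exists c => //; move: cab; rewrite in_itv.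
Qed.

Lemma sc_mean_lip m f1 f2 f3 S k a b : self_concordant R m f1 f2 f3 ->
  (forall x, - S <= x <= S -> f2 x <= k) -> a <= b -> - S <= a -> b <= S ->
  f1 b - f1 a <= k * (b - a).
Proof.
move=> sc hk ab Sa bS; have [c /andP[ac cb] ->] := clip_derive_le sc hk ab Sa bS.
by rewrite ler_wpM2r ?subr_ge0 // hk // (le_trans Sa ac) (le_trans cb bS).
Qed.

Lemma sc_taylor_pos m f1 f2 f3 S k a v : self_concordant R m f1 f2 f3 ->
  (forall x, - S <= x <= S -> f2 x <= k) -> 0 <= v -> - S <= a -> a + v <= S ->
  `|f1 (a + v) - f1 a - f2 a * v| <= R * k / 2 * v ^+ 2.
Proof.
move=> sc hk v0 Sa vS; have [d1 d2 d3 s3] := sc.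
have h2 c : a <= c -> c <= a + v -> `|f2 c - f2 a| <= R * k * (c - a).
  move=> ac cv; have [|e eac ->] := @MVT_segment K f2 f3 a c ac.
    apply: continuous_subspaceT => x; apply: differentiable_continuous.
    by apply/derivable1_diffP; case: (d3 x).
  move: eac; rewrite in_itv /= => /andP[ae ec].
  rewrite normrM (ger0_norm (_ : 0 <= c - a)) ?subr_ge0 //.
  rewrite ler_wpM2r ?subr_ge0 //; apply: le_trans (s3 e) _.
  rewrite ler_pM2l // hk // (le_trans Sa ae) /= (le_trans ec) //.
  exact: le_trans cv vS.
have bnd (s : K) : `|s| = 1 ->
  s * (f1 (a + v) - f1 a - f2 a * v) <= R * k / 2 * v ^+ 2.
  move=> s1.
  pose g t := R * k / 2 * t ^+ 2 - s * (f1 (a + t) - f1 a - f2 a * t).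
  pose dg t := R * k * t - s * (f2 (a + t) - f2 a).
  have dgE (t : K) : is_derive t 1 g (dg t).
    have d := is_derive_shift (d2 (a + t)).
    by rewrite /g; apply: is_derive_eq; rewrite /dg /GRing.scale /=; field.
  have [|c cv e] := @MVT_segment K g dg 0 v v0.
    apply: continuous_subspaceT => x; apply: differentiable_continuous.
    by apply/derivable1_diffP; case: (dgE x).
  have g0 : g 0 = 0 by rewrite /g addr0 expr0n /= !(mulr0, subrr, subr0).
  move: e; rewrite g0 subr0 subr0 => e.
  rewrite -subr_ge0 -/(g v) e mulr_ge0 //.
  move: cv; rewrite in_itv /= => /andP[c0 cv].
  rewrite /dg subr_ge0; apply: le_trans (ler_norm _) _; rewrite normrM s1 mul1r.
  by have := h2 (a + c); rewrite addrAC subrr add0r lerDl lerD2l; apply.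
rewrite ler_norml; apply/andP; split.
  by have := bnd (-1); rewrite normrN normr1 => /(_ erefl); lra.
by have := bnd 1; rewrite normr1 mul1r; apply.
Qed.

Lemma sc_taylor m f1 f2 f3 S k a b : self_concordant R m f1 f2 f3 ->
  (forall x, - S <= x <= S -> f2 x <= k) -> - S <= a <= S -> - S <= b <= S ->
  `|f1 b - f1 a - f2 a * (b - a)| <= R * k / 2 * (b - a) ^+ 2.
Proof.
move=> sc hk /andP[Sa aS] /andP[Sb bS]; have [ab|ba] := leP a b.
  have ab0 : 0 <= b - a by rewrite subr_ge0.
  have := sc_taylor_pos sc hk ab0 Sa; rewrite addrCA subrr addr0; apply.
  exact: bS.
have ba0 : 0 <= a - b by rewrite subr_ge0 ltW.
have hk' x : - S <= x <= S -> f2 (- x) <= k.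
  by move=> /andP[h1 h2]; apply: hk; rewrite lerN2 h2 /= lerNl.
have Sa' : - S <= - a by rewrite lerN2.
have := sc_taylor_pos (self_concordant_opp sc) hk' ba0 Sa'.
have -> : - a + (a - b) = - b by ring.
rewrite !opprK lerNl => /(_ Sb).
rewrite -normrN.
have -> : - (- f1 b + f1 a - f2 a * (a - b)) = f1 b - f1 a - f2 a * (b - a).
  by ring.
by rewrite -[(a - b) ^+ 2]sqrrN opprB.
Qed.

End SelfConcordance.

(** * Gaussian mixtures of self-concordant losses *)

Section GaussianMixture.
Context {K : realType}.
Local Notation leb := (@lebesgue_measure K).

Lemma normal_pdf_expE (a s x : K) : 0 < s ->
  normal_pdf a s x
  = s^-1 * (Num.sqrt (2 * pi))^-1 * expR (- ((x - a) / s) ^+ 2 / 2).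
Proof.
move=> s0; rewrite normal_pdfE ?gt_eqF // /normal_peak /normal_fun.
congr (_ * expR _).
  rewrite -mulrnAr -mulr_natl sqrtrM ?sqr_ge0 // sqrtr_sqr gtr0_norm //.
  by rewrite invfM.
by rewrite !mulNr exprMn exprVn -mulr_natl invfM; congr (- _); rewrite mulrA mulrAC.
Qed.

Lemma normal_pdf_tilt (a s b x : K) : 0 < s ->
  normal_pdf a s x * expR (b * (x - a))
  = expR ((b * s) ^+ 2 / 2) * normal_pdf (a + b * s ^+ 2) s x.
Proof.
move=> s0; rewrite !normal_pdf_expE //.
have e : expR (- ((x - a) / s) ^+ 2 / 2) * expR (b * (x - a))
  = expR ((b * s) ^+ 2 / 2) * expR (- ((x - (a + b * s ^+ 2)) / s) ^+ 2 / 2).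
  by rewrite -!expRD; congr expR; field; rewrite gt_eqF.
by rewrite -[LHS]mulrA e; ring.
Qed.

Lemma normal_pdf_std_ge (a s x : K) : 0 < s <= 1 ->
  s * normal_pdf a s x * expR (- a ^+ 2 / 2 - a * (x - a)) <= normal_pdf 0 1 x.
Proof.
move=> /andP[s0 s1]; rewrite !normal_pdf_expE // -!mulrA mulVKf ?gt_eqF //.
rewrite invr1 mul1r ler_pM2l ?invr_gt0 ?sqrtr_gt0 ?mulr_gt0 ?pi_gt0 //.
rewrite -expRD ler_expR mulr1 subr0 exprMn.
have : (x - a) ^+ 2 <= (x - a) ^+ 2 * s^-1 ^+ 2.
  by rewrite ler_peMr ?sqr_ge0 // exprn_ege1 // invf_ge1.
by set t := (x - a) ^+ 2 * _; lra.
Qed.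

Lemma expR_le_inv (x : K) : x < 1 -> expR x <= (1 - x)^-1.
Proof.
move=> x1; rewrite -[x in expR x]opprK expRN lef_pV2 ?posrE ?expR_gt0 ?subr_gt0 //.
exact: expR_ge1Dx.
Qed.

Lemma ln1D_ge (v : K) : 0 <= v -> v / (1 + v) <= ln (1 + v).
Proof.
move=> v0; have v1 : 0 < 1 + v by rewrite ltr_pwDl.
have e : - (v / (1 + v)) = (1 + v)^-1 - 1 by field; rewrite gt_eqF.
have := @le_ln1Dx K ((1 + v)^-1 - 1).
rewrite addrCA subrr addr0 lnV ?posrE // ltrBrDr addNr invr_gt0 => /(_ v1).
by rewrite -e lerN2.
Qed.

(* Only the part [s * normal_pdf u0 s], [s ^+ 2 = 1 / (1 + c q)], of the standard
   normal density is kept and Jensen's inequality is applied to it: the factor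
   [s] costs [2^-1 ln (1 + c q)], the self-concordant quadratic upper bound of
   [m] on the scale [sg s] costs [3 eta ln (1 + c q)]. *)
Lemma gaussian_mixture_ge (R g : K) (m f1 f2 f3 : K -> K)
    (r z0 zh sg q eta E : K) :
  0 < R -> 0 < g -> self_concordant R m f1 f2 f3 -> 0 < f2 zh ->
  0 <= sg -> sg ^+ 2 = 3 * eta / 2 * q -> 0 <= q -> 1 <= eta ->
  (R * sg) ^+ 2 <= 2^-1 ->
  (zh - z0) ^+ 2 <= 2 * sg ^+ 2 * E -> 0 <= E ->
  ((expR ((r * zh - m zh) / g - E - (3 * eta + 2^-1) * ln (1 + f2 zh / g * q)))%:E
   <= \int[leb]_u (normal_pdf 0 1 u
        * expR ((r * (z0 + sg * u) - m (z0 + sg * u)) / g))%:E)%E.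
Proof.
move=> R0 g0 sc c0 sg0 sgE q0 eta1 Rsg hE E0.
have mpdf a b : measurable_fun setT (normal_pdf a b : K -> K).
  exact: measurable_normal_pdf.
pose c := f2 zh / g; have c_gt0 : 0 < c by rewrite divr_gt0.
have cE : f2 zh / g = c by [].
rewrite cE; clearbody c.
pose v := c * q; have v0 : 0 <= v by rewrite mulr_ge0 // ltW.
have v1 : 0 < 1 + v by rewrite ltr_pwDl.
have lnv : 0 <= ln (1 + v) by rewrite ln_ge0 // lerDl.
have [sgE0|sgn0] := eqVneq sg 0.
  have -> : z0 = zh.
    move: hE; rewrite sgE0 expr0n /= mulr0 mul0r => hE.
    by apply/esym/eqP; rewrite -subr_eq0 -sqrf_eq0 eq_le hE sqr_ge0.
  rewrite sgE0; under eq_integral => u _ do rewrite mul0r addr0 EFinM.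
  rewrite ge0_integralZr //=; last 2 first.
    by apply/measurable_EFinP; exact: mpdf.
    by move=> x _; rewrite lee_fin normal_pdf_ge0.
  rewrite integral_normal_pdf mul1e lee_fin ler_expR -/v.
  rewrite -[leRHS]subr0 -addrA lerD2l -opprD lerN2.
  by rewrite addr_ge0 // mulr_ge0 //; lra.
have sg_gt0 : 0 < sg by rewrite lt0r sgn0.
pose u0 := (zh - z0) / sg.
have zhE : zh = z0 + sg * u0 by rewrite /u0 mulrC divfK // addrC subrK.
pose s := Num.sqrt (1 + v)^-1.
have s0 : 0 < s by rewrite sqrtr_gt0 invr_gt0.
have s2E : s ^+ 2 = (1 + v)^-1 by rewrite sqr_sqrtr // invr_ge0 ltW.
have s1 : s <= 1.
  rewrite -(@expr_le1 _ 2) ?(ltW s0) // s2E invf_le1 // lerDl //.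
pose k := u0 + (f1 zh - r) / g * sg.
pose w := s ^+ 2 * sg ^+ 2.
have w0 : 0 < w by rewrite mulr_gt0 ?exprn_gt0.
pose Kc := 2 * c * w.
pose t := c * sg ^+ 2 / 2.
have t0 : 0 < t by apply: divr_gt0 => //; apply: mulr_gt0 => //; exact: exprn_gt0.
have k1 : 0 < 1 + k ^+ 2 by rewrite ltr_pwDl ?sqr_ge0.
pose ep := t / ((1 + k ^+ 2) * (1 + t)).
have t1 : 0 < 1 + t by rewrite ltr_pwDl // ltW.
have ep0 : 0 < ep by apply: divr_gt0 => //; apply: mulr_gt0.
have epE : ep * ((1 + k ^+ 2) * (1 + t)) = t.
  by rewrite divfK // gt_eqF //; apply: mulr_gt0.
have tE : t = c * sg ^+ 2 / 2 by [].
clearbody ep; clearbody t.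
have ek1 : ep * k ^+ 2 * (1 + t) <= t.
  by rewrite -[leRHS]epE -mulrA ler_pM2l // ler_pM2r // lerDr.
have ekt : ep * k ^+ 2 <= t.
  have ek0 : 0 <= ep * k ^+ 2 by rewrite mulr_ge0 ?sqr_ge0 // ltW.
  by apply: le_trans (ek1); rewrite mulrDr mulr1 lerDl mulr_ge0 // ltW.
have ek2 : ep * k ^+ 2 <= 1.
  rewrite -(ler_pM2r t1) mul1r; apply: le_trans ek1 _; lra.
have ep1 : ep <= 1.
  have : ep * (1 + t) <= t.
    by rewrite -[leRHS]epE ler_pM2l // ler_peMl ?(ltW t1) // lerDl sqr_ge0.
  move=> h; rewrite -(ler_pM2r t1) mul1r; apply: le_trans h _; lra.
pose A := 1 + Kc + ep^-1 + 2 * c / R ^+ 2.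
pose B := ep^-1 * expR ((ep * k * s) ^+ 2 / 2).
pose C := c / R ^+ 2 * expR ((R * sg * s) ^+ 2 / 2).
have ABC : 1 <= A - B - 2 * C.
  have y0 : (ep * k * s) ^+ 2 / 2 <= ep * (ep * k ^+ 2 * s ^+ 2) / 2.
    by rewrite le_eqVlt; apply/orP; left; apply/eqP; ring.
  set y := (ep * k * s) ^+ 2 / 2 in y0 *.
  have sw : s ^+ 2 <= 1 by rewrite expr_le1 // ltW.
  have s20 : 0 <= s ^+ 2 by rewrite sqr_ge0.
  have eks : ep * k ^+ 2 * s ^+ 2 <= t * s ^+ 2 by rewrite ler_wpM2r.
  have yle : y <= ep * (t * s ^+ 2) / 2.
    by apply: le_trans y0 _; rewrite ler_pM2r ?invr_gt0 // ler_pM2l.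
  have yh : y <= 2^-1.
    apply: le_trans y0 _; rewrite ler_pdivrMr // mulVf //.
    have ek0 : 0 <= ep * k ^+ 2 by apply: mulr_ge0; [exact: ltW | exact: sqr_ge0].
    by apply: mulr_ile1 (ltW ep0) _ ep1 _; [exact: mulr_ge0 | exact: mulr_ile1].
  have yn : 0 <= y by rewrite divr_ge0 ?sqr_ge0.
  have ey : expR y <= 1 + 2 * y.
    apply: le_trans (expR_le_inv _) _; first by lra.
    by rewrite -div1r ler_pdivrMr; [nra | lra].
  have xE : (R * sg * s) ^+ 2 / 2 = R ^+ 2 * w / 2 by rewrite /w; ring.
  set x := (R * sg * s) ^+ 2 / 2 in xE *.
  have xn : 0 <= x by rewrite divr_ge0 ?sqr_ge0.
  have xh : x <= 4^-1.
    have : (R * sg) ^+ 2 * s ^+ 2 <= 2^-1 * 1 by rewrite ler_pM ?sqr_ge0.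
    by rewrite mulr1 -exprMn => h; rewrite /x; lra.
  have ex : expR x <= 1 + 3 / 2 * x.
    apply: le_trans (expR_le_inv _) _; first by lra.
    by rewrite -div1r ler_pdivrMr; [nra | lra].
  have hB : B - ep^-1 <= t * s ^+ 2.
    have -> : B - ep^-1 = (expR y - 1) / ep by rewrite /B -/y; field; rewrite gt_eqF.
    by rewrite ler_pdivrMr //; lra.
  have hC : 2 * C - 2 * c / R ^+ 2 <= 3 / 2 * c * w.
    have -> : 2 * C - 2 * c / R ^+ 2 = (expR x - 1) * (2 * c / R ^+ 2).
      by rewrite /C -/x; ring.
    apply: le_trans (_ : 3 / 2 * x * (2 * c / R ^+ 2) <= _).
      by rewrite ler_pM2r ?divr_gt0 ?mulr_gt0 ?exprn_gt0 //; lra.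
    by rewrite xE le_eqVlt; apply/orP; left; apply/eqP; field; rewrite gt_eqF.
  have tw : t * s ^+ 2 = c * w / 2 by rewrite tE /w; ring.
  by rewrite /A /Kc; lra.
pose L := (r * zh - m zh) / g - u0 ^+ 2 / 2 - Kc.
pose k0 := s * expR L.
have k00 : 0 < k0 by rewrite mulr_gt0 ?expR_gt0.
pose F u := normal_pdf 0 1 u * expR ((r * (z0 + sg * u) - m (z0 + sg * u)) / g).
pose G u := k0 * B * normal_pdf (u0 + ep * k * s ^+ 2) s u
  + (k0 * C * normal_pdf (u0 + R * sg * s ^+ 2) s u
    + k0 * C * normal_pdf (u0 + (- (R * sg)) * s ^+ 2) s u).
(* The linear term [k y] of the tangent has mean zero; bounding it by
   [(expR (ep k y) - 1) / ep] keeps every integrand a multiple of a normal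
   density. *)
have key u : k0 * A * normal_pdf u0 s u <= F u + G u.
  pose y := u - u0.
  have phi0 : 0 <= normal_pdf u0 s u by exact: normal_pdf_ge0.
  pose Q := (expR (R * (sg * y)) + expR (- (R * (sg * y))) - 2) / R ^+ 2.
  have hm : m (z0 + sg * u) <= m zh + f1 zh * (sg * y) + f2 zh * Q.
    have := sc_bregman_upper R0 zh (sg * y) sc.
    have -> : zh + sg * y = z0 + sg * u by rewrite zhE /y; ring.
    by rewrite -/Q; lra.
  have hF : k0 * normal_pdf u0 s u * expR (Kc - k * y - c * Q) <= F u.
    rewrite /F; have s01 : 0 < s <= 1 by rewrite s0.
    have h1 := normal_pdf_std_ge u0 u s01.
    set a1 := expR (- u0 ^+ 2 / 2 - u0 * (u - u0)) in h1.
    apply: le_trans (_ : s * normal_pdf u0 s u * a1 * _ <= _); last first.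
      apply: ler_wpM2r h1; exact: expR_ge0.
    have -> : k0 * normal_pdf u0 s u * expR (Kc - k * y - c * Q)
      = s * normal_pdf u0 s u * (expR L * expR (Kc - k * y - c * Q)).
      by rewrite /k0; ring.
    rewrite -[leRHS]mulrA ler_wpM2l ?mulr_ge0 ?(ltW s0) // /a1 -!expRD ler_expR.
    have : (r * zh - m zh - (f1 zh - r) * (sg * y) - f2 zh * Q) / g
        <= (r * (z0 + sg * u) - m (z0 + sg * u)) / g.
      rewrite ler_pM2r ?invr_gt0 //.
      have -> : z0 + sg * u = zh + sg * y by rewrite zhE /y; ring.
      have := hm; have -> : z0 + sg * u = zh + sg * y by rewrite zhE /y; ring.
      by move=> hm'; lra.
    move=> h; rewrite -lerBlDl; apply: le_trans h.
    rewrite /L -/y le_eqVlt; apply/orP; left; apply/eqP.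
    by rewrite /k /Kc -cE; field; rewrite gt_eqF.
  have tang : 1 + Kc - k * y - c * Q <= expR (Kc - k * y - c * Q).
    by apply: le_trans (expR_ge1Dx _); rewrite !addrA.
  have hG : G u = k0 * normal_pdf u0 s u * (ep^-1 * expR (ep * k * y)
     + c / R ^+ 2 * (expR (R * sg * y) + expR (- (R * sg) * y))).
    have e1 := normal_pdf_tilt u0 (ep * k) u s0.
    have e2 := normal_pdf_tilt u0 (R * sg) u s0.
    have e3 := normal_pdf_tilt u0 (- (R * sg)) u s0.
    rewrite -/y in e1 e2 e3.
    have eN : (- (R * sg) * s) ^+ 2 = (R * sg * s) ^+ 2 by ring.
    rewrite eN in e3.
    rewrite /G /B /C.
    transitivity (k0 * (ep^-1 * (expR ((ep * k * s) ^+ 2 / 2) * normal_pdf (u0 + ep * k * s ^+ 2) s u)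
      + c / R ^+ 2 * (expR ((R * sg * s) ^+ 2 / 2) * normal_pdf (u0 + R * sg * s ^+ 2) s u)
      + c / R ^+ 2 * (expR ((R * sg * s) ^+ 2 / 2) * normal_pdf (u0 + - (R * sg) * s ^+ 2) s u))).
      by ring.
    by rewrite -e1 -e2 -e3; ring.
  rewrite hG -lerBlDr.
  apply: le_trans hF.
  have -> : k0 * A * normal_pdf u0 s u - k0 * normal_pdf u0 s u * (ep^-1 * expR (ep * k * y)
     + c / R ^+ 2 * (expR (R * sg * y) + expR (- (R * sg) * y)))
    = k0 * normal_pdf u0 s u * (A - (ep^-1 * expR (ep * k * y)
     + c / R ^+ 2 * (expR (R * sg * y) + expR (- (R * sg) * y)))) by ring.
  apply: ler_wpM2l; first by rewrite mulr_ge0 // ltW.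
  apply: le_trans tang.
  have eQ : c * Q = c / R ^+ 2 * (expR (R * sg * y) + expR (- (R * sg) * y)) - 2 * c / R ^+ 2.
    by rewrite /Q !mulrA !mulNr; ring.
  have l1 : ep^-1 + k * y <= ep^-1 * expR (ep * k * y).
    rewrite -(ler_pM2l ep0) mulrDr mulVKf ?gt_eqF // mulfV ?gt_eqF // mulrA.
    exact: expR_ge1Dx.
  by rewrite eQ /A; lra.
have F0 u : 0 <= F u by rewrite mulr_ge0 ?normal_pdf_ge0 ?expR_ge0.
have k0e : k0 * 1 <= k0 * (A - B - 2 * C) by rewrite ler_pM2l.
have mm : measurable_fun setT m.
  apply: continuous_measurable_fun => x; apply: differentiable_continuous.
  by apply/derivable1_diffP; case: sc => d1 _ _ _; case: (d1 x).
have mF : measurable_fun setT F.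
  apply: measurable_funM => //; apply: measurableT_comp => //.
  have mz : measurable_fun setT (fun u : K => z0 + sg * u).
    by apply: measurable_funD => //; apply: measurable_funM.
  apply: measurable_funM => //; apply: measurable_funB.
    by apply: measurable_funM.
  exact: measurableT_comp.
have B0 : 0 <= B.
  by apply: mulr_ge0; [rewrite invr_ge0; exact: ltW | exact: expR_ge0].
have C0 : 0 <= C.
  apply: mulr_ge0; last exact: expR_ge0.
  by apply: divr_ge0; [exact: ltW | exact: sqr_ge0].
have A0 : 0 <= A by lra.
have k0n := ltW k00.
have kA := mulr_ge0 k0n A0; have kB := mulr_ge0 k0n B0; have kC := mulr_ge0 k0n C0.
have intZ a x : 0 <= a ->
    (\int[leb]_u (a * normal_pdf x s u)%:E = a%:E)%E.
  move=> a0; under eq_integral do rewrite EFinM.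
  rewrite ge0_integralZl //= ?integral_normal_pdf ?mule1 //.
  - by apply/measurable_EFinP; exact: mpdf.
  - by move=> ? _; rewrite lee_fin normal_pdf_ge0.
have mN a x : measurable_fun setT (fun u : K => a * normal_pdf x s u).
  by apply: measurable_funM; [exact: measurable_cst | exact: mpdf].
have meZ a x : measurable_fun setT (fun u : K => (a * normal_pdf x s u)%:E).
  by apply/measurable_EFinP; exact: mN.
have mG : measurable_fun setT G.
  by apply: measurable_funD; [exact: mN | apply: measurable_funD; exact: mN].
have G1 a x u : 0 <= a -> 0 <= a * normal_pdf x s u.
  by move=> a0; rewrite mulr_ge0 ?normal_pdf_ge0.
have intG : (\int[leb]_u (G u)%:E = (k0 * B + (k0 * C + k0 * C))%:E)%E.
  under eq_integral do rewrite 2!EFinD.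
  rewrite ge0_integralD //=; last 4 first.
  - by move=> u _; rewrite lee_fin G1.
  - exact: meZ.
  - by move=> u _; rewrite -EFinD lee_fin addr_ge0 ?G1.
  - by apply: emeasurable_funD; exact: meZ.
  rewrite ge0_integralD //=; last 4 first.
  - by move=> u _; rewrite lee_fin G1.
  - exact: meZ.
  - by move=> u _; rewrite lee_fin G1.
  - exact: meZ.
  by rewrite !intZ.
have main : ((k0 * A)%:E <= \int[leb]_u (F u)%:E + (k0 * B + (k0 * C + k0 * C))%:E)%E.
  rewrite -(intZ _ u0) // -intG -ge0_integralD //=; last 4 first.
  - by move=> u _; rewrite lee_fin.
  - by apply/measurable_EFinP; exact: mF.
  - by move=> u _; rewrite lee_fin !addr_ge0 ?G1.
  - by apply/measurable_EFinP; exact: mG.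
  apply: ge0_le_integral => //=.
  - by move=> u _; rewrite lee_fin G1.
  - exact: meZ.
  - by apply: emeasurable_funD; apply/measurable_EFinP; [exact: mF | exact: mG].
  - by move=> u _; rewrite -EFinD lee_fin.
have main2 : (k0%:E <= \int[leb]_u (F u)%:E)%E.
  case: (\int[leb]_u (F u)%:E)%E main => [x| |] /=.
  - by rewrite -EFinD !lee_fin => h; lra.
  - by move=> _; rewrite leey.
  - by rewrite addNye leeNy_eq.
apply: le_trans main2; rewrite lee_fin /k0.
have sE : s = expR (- (ln (1 + v) / 2)).
  apply: (@pexpIrn _ 2) => //; rewrite ?nnegrE ?expR_ge0 ?(ltW s0) //.
  rewrite s2E [RHS]expr2 -expRD.
  have -> : - (ln (1 + v) / 2) + - (ln (1 + v) / 2) = - ln (1 + v) by field.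
  by rewrite expRN lnK // posrE.
rewrite sE -expRD ler_expR /L -/v.
have hu : u0 ^+ 2 / 2 <= E.
  rewrite /u0 exprMn exprVn ler_pdivrMr // ler_pdivrMr ?exprn_gt0 //.
  by apply: le_trans hE _; rewrite le_eqVlt; apply/orP; left; apply/eqP; ring.
have hK : Kc <= 3 * eta * ln (1 + v).
  have -> : Kc = 3 * eta * (v / (1 + v)).
    by rewrite /Kc /w s2E sgE /v; field; rewrite gt_eqF.
  by rewrite ler_wpM2l ?ln1D_ge //; lra.
by lra.
Qed.

End GaussianMixture.

(** * Conditional densities *)

Section DensityMeasure.
Local Open Scope ereal_scope.
Context {disp : measure_display} {T : measurableType disp} {K : realType}.
Variables (mu : {measure set T -> \bar K}) (f : T -> K).
Hypotheses (mf : measurable_fun setT f) (f0 : forall x, (0 <= f x)%R).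

Definition density_measure (_ : measurable_fun setT f)
    (_ : forall x, (0 <= f x)%R) (A : set T) : \bar K :=
  \int[mu]_(x in A) (f x)%:E.

Local Notation dens := (density_measure mf f0).

Let dens0 : dens set0 = 0.
Proof. by rewrite /density_measure integral_set0. Qed.

Let dens_ge0 A : 0 <= dens A.
Proof. by apply: integral_ge0 => x _; rewrite lee_fin. Qed.

Let mfE : measurable_fun setT (EFin \o f).
Proof. exact/measurable_EFinP. Qed.

Let dens_sigma_additive : semi_sigma_additive dens.
Proof.
move=> F mF tF mUF; rewrite /density_measure ge0_integral_bigcup //; last 2 first.
  by apply: measurable_funTS.
  by move=> x _; rewrite lee_fin.
by apply: is_cvg_ereal_nneg_natsum_cond => n _ _; exact: dens_ge0.
Qed.

HB.instance Definition _ := isMeasure.Build _ _ _ dens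
  dens0 dens_ge0 dens_sigma_additive.

Import HBNNSimple.

Lemma ge0_integral_density (h : T -> \bar K) : measurable_fun setT h ->
  (forall x, 0 <= h x) ->
  \int[dens]_x h x = \int[mu]_x (h x * (f x)%:E).
Proof.
move=> mh h0; pose a := nnsfun_approx measurableT mh.
have ma n : measurable_fun setT (EFin \o a n) by exact/measurable_EFinP.
have ah x : EFin (a n x) @[n --> \oo] --> h x by exact: cvg_nnsfun_approx.
have nda x : {homo (fun n => (a n x)%:E) : m n / (m <= n)%N >-> m <= n}.
  by move=> m n mn; rewrite lee_fin; exact/lefP/nd_nnsfun_approx.
have -> : \int[dens]_x h x
    = limn (fun n => \int[dens]_x (a n x)%:E).
  rewrite -monotone_convergence //.
  - by apply: eq_integral => x _; apply/esym/cvg_lim => //; exact: ah.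
  - by move=> n x _; rewrite lee_fin.
have -> : \int[mu]_x (h x * (f x)%:E)
    = limn (fun n => \int[mu]_x ((a n x)%:E * (f x)%:E)).
  rewrite -monotone_convergence //.
  - apply: eq_integral => x _; apply/esym/cvg_lim => //.
    by apply: cvgeZr => //; exact: ah.
  - by move=> n; apply: emeasurable_funM; [exact: ma | exact: mfE].
  - by move=> n x _; rewrite mule_ge0 // lee_fin.
  - by move=> x _ m n mn; apply: lee_wpmul2r; [rewrite lee_fin | exact: nda].
congr (limn _); apply/funext => n.
rewrite integral_nnsfun //= sintegralE.
have -> : \int[mu]_x ((a n x)%:E * (f x)%:E)
    = \int[mu]_x \sum_(y \in range (a n))
        (y%:E * ((\1_(a n @^-1` [set y]) x)%:E * (f x)%:E)).
  apply: eq_integral => x _; rewrite [in LHS]fimfunE -fsumEFin //.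
  rewrite ge0_mule_fsuml => [|y]; last exact: nnfun_muleindic_ge0.
  by apply: eq_fsbigr => y _; rewrite EFinM muleA.
have mi y : measurable_fun setT (fun x => (\1_(a n @^-1` [set y]) x)%:E * (f x)%:E).
  by apply: emeasurable_funM => //; apply/measurable_EFinP; exact: measurable_indic.
rewrite ge0_integral_fsum //; last 2 first.
- by move=> y; exact: emeasurable_funM.
- move=> y x _; rewrite muleA mule_ge0 ?lee_fin // -lee_fin EFinM.
  exact: nnfun_muleindic_ge0.
rewrite patch_setT; apply: eq_fsbigr => y; rewrite inE => -[t _ yE].
rewrite ge0_integralZl //; last 2 first.
- by move=> x _; rewrite mule_ge0 // lee_fin.
- by rewrite -yE lee_fin.
congr (_ * _); rewrite -[LHS]/(dens _) /density_measure.
rewrite [LHS]integral_mkcond.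
by apply: eq_integral => x _; rewrite epatch_indic muleC.
Qed.

End DensityMeasure.

Section JointLaw.
Local Open Scope ereal_scope.
Context {d1 d2 : measure_display} {X : measurableType d1} {Y : measurableType d2}.
Context {K : realType}.

Lemma joint_density_integral (P : probability X K) (rho : probability Y K)
    (Q : probability (X * Y)%type K) (D : X * Y -> K)
    (mD : measurable_fun setT D) (D0 : forall p, (0 <= D p)%R)
    (QE : forall A B, measurable A -> measurable B ->
      Q (A `*` B) = \int[P]_(w in A) \int[rho]_(y in B) (D (w, y))%:E)
    (f : X * Y -> \bar K) (mf : measurable_fun setT f) (f0 : forall p, 0 <= f p) :
  \int[Q]_p f p = \int[P]_w \int[rho]_y (f (w, y) * (D (w, y))%:E).
Proof.
have mDE : measurable_fun setT (EFin \o D) by exact/measurable_EFinP.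
pose dm : {measure set (X * Y)%type -> \bar K} := density_measure (P \x rho) mD D0.
have dmE A B : measurable A -> measurable B -> dm (A `*` B) = Q (A `*` B).
  move=> mA mB; rewrite QE // -[LHS]/(density_measure _ _ _ _) /density_measure.
  rewrite [LHS]integral_mkcond fubini_tonelli1; last 2 first.
  - apply/(measurable_restrictT _ _).1; first exact: measurableX.
    exact: measurable_funTS.
  - by move=> p; rewrite /patch; case: ifP => // _; rewrite lee_fin.
  rewrite [RHS]integral_mkcond; apply: eq_integral => w _.
  rewrite /fubini_F patchE; case: ifPn => wA.
    rewrite [RHS]integral_mkcond; apply: eq_integral => y _.
    rewrite !patchE; congr (if _ then _ else _).
    rewrite inE in wA; apply/idP/idP; rewrite !inE; first by case.
    by move=> yB; split.
  rewrite integral0_eq // => y _; rewrite patchE; case: ifPn => //.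
  by rewrite inE => -[/= wA']; rewrite notin_setE in wA.
have dmQ : forall A, measurable A -> dm A = Q A.
  move=> A mA.
  apply: (measure_unique [set A `*` B | A in measurable & B in measurable]
    (fun=> setT)) => //.
  - by rewrite measurable_prod_measurableType.
  - move=> _ _ [A1 mA1 [B1 mB1 <-]] [A2 mA2 [B2 mB2 <-]].
    rewrite -setXI; exists (A1 `&` A2); first exact: measurableI.
    by exists (B1 `&` B2) => //; exact: measurableI.
  - by move=> _; exists setT => //; exists setT => //; rewrite setXTT.
  - by rewrite bigcup_const //; exists 0%N.
  - by move=> _ [A1 mA1 [B1 mB1 <-]]; exact: dmE.
  - move=> _; rewrite -setXTT dmE // setXTT probability_setT ltry //.
rewrite (eq_measure_integral dm); last by move=> A mA _; exact/esym/dmQ.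
rewrite ge0_integral_density // fubini_tonelli1 //.
- exact: emeasurable_funM.
- by move=> p; rewrite mule_ge0 // lee_fin.
Qed.

End JointLaw.

Section ConditionalDensity.
Local Open Scope ereal_scope.
Context {K : realType} {disp : measure_display} {Omega : measurableType disp}.
Variables (P : probability Omega K) (G : set (set Omega)).
Hypothesis (hG : G `<=` measurable).
Let X := g_sigma_algebraType G.
Let Y := measurableTypeR K.

Lemma measurable_sub_sigma d (T : measurableType d) (f : Omega -> T) :
  measurable_fun (setT : set X) f -> measurable_fun (setT : set Omega) f.
Proof.
move=> mf _ B mB.
have := mf measurableT B mB; rewrite !setTI.
by apply: smallest_sub; [exact: sigma_algebra_measurable | exact: hG].
Qed.

Variables (g : K) (m h : K -> K) (nu : {measure set Y -> \bar K}).
Hypotheses (mm : measurable_fun setT m) (mh : measurable_fun (setT : set Y) h).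
Hypothesis nu1 : forall z : K, \int[nu]_y (glm_density g m h z y)%:E = 1.
Variables (r z : Omega -> K).
Hypotheses (mr : measurable_fun setT r) (mz : measurable_fun (setT : set X) z).
Hypothesis law :
  cond_law_density P <<s G>> r nu (fun w => glm_density g m h (z w)).

Lemma cond_density_integral (f : X * Y -> \bar K) :
  measurable_fun setT f -> (forall p, 0 <= f p) ->
  \int[P]_w f (w, r w)
  = \int[P]_w \int[nu]_y (f (w, y) * (glm_density g m h (z w) y)%:E).
Proof.
move=> mf f0.
have mp (c : K) : measurable_fun (setT : set Y) (glm_density g m h c).
  apply: measurableT_comp => //; apply: measurable_funD => //.
  apply: measurable_funM => //; apply: measurable_funB => //.
  exact: measurable_funM.
have p0 (c y : K) : (0 <= glm_density g m h c y)%R by exact: expR_ge0.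
pose rho0 : {measure set Y -> \bar K} := density_measure nu (mp 0%R) (p0 0%R).
have rho1 : rho0 setT = 1 by exact: nu1.
pose rho : probability Y K :=
  HB.pack (density_measure nu (mp 0%R) (p0 0%R)) (Measure_isProbability.Build _ _ _ rho0 rho1).
pose D (p : X * Y) : K := expR ((p.2 * z p.1 - m (z p.1) + m 0) / g).
have mz1 : measurable_fun (setT : set (X * Y)) (fun p => z p.1).
  by apply: measurableT_comp.
have mD : measurable_fun setT D.
  apply: measurableT_comp => //; apply: measurable_funM => //.
  apply: measurable_funD => //; apply: measurable_funB.
    by apply: measurable_funM => //; exact: measurable_snd.
  by apply: measurableT_comp mm _.
have D0 p : (0 <= D p)%R by exact: expR_ge0.
have DE w y : (D (w, y) * glm_density g m h 0 y = glm_density g m h (z w) y)%R.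
  by rewrite /D /glm_density -expRD; congr expR; rewrite /= mulr0; ring.
have rhoE (u : Y -> \bar K) : measurable_fun setT u -> (forall y, 0 <= u y) ->
    \int[rho]_y u y = \int[nu]_y (u y * (glm_density g m h 0 y)%:E).
  by move=> mu u0; rewrite -(ge0_integral_density nu (mp 0%R) (p0 0%R)).
have mid : measurable_fun (setT : set Omega) (id : Omega -> X).
  exact: measurable_sub_sigma.
pose idX : {mfun Omega >-> X} :=
  HB.pack (id : Omega -> X) (isMeasurableFun.Build _ _ _ _ _ mid).
have mpair : measurable_fun (setT : set Omega) (fun w => (w : X, r w : Y)).
  exact: measurable_fun_pair.
pose pr : {mfun Omega >-> (X * Y)%type} :=
  HB.pack (fun w => (w : X, r w : Y)) (isMeasurableFun.Build _ _ _ _ _ mpair).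
have PX (u : X -> \bar K) : measurable_fun setT u -> (forall w, 0 <= u w) ->
    \int[distribution P idX]_w u w = \int[P]_w u w.
  by move=> mu u0; rewrite ge0_integral_distribution.
transitivity (\int[distribution P pr]_p f p).
  by rewrite ge0_integral_distribution.
have mDE : measurable_fun setT (EFin \o D) by exact/measurable_EFinP.
rewrite (@joint_density_integral _ _ _ _ _ (distribution P idX) rho _ D mD D0)
  //; last first.
  move=> A B mA mB.
  rewrite -[LHS]/(P (A `&` r @^-1` B)) law //.
  have mDB : measurable_fun setT ((EFin \o D) \_ (setT `*` B)).
    apply/(measurable_restrictT _ _).1; first exact: measurableX.
    exact: measurable_funTS.
  have DB0 p : 0 <= ((EFin \o D) \_ (setT `*` B)) p.
    by rewrite patchE; case: ifP => // _; rewrite lee_fin.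
  have eB (w : X) y : ((EFin \o D) \_ (setT `*` B)) (w, y)
      = ((fun y => (D (w, y))%:E) \_ B) y.
    rewrite !patchE; congr (if _ then _ else _).
    by apply/idP/idP; rewrite !inE; [case | move=> yB; split].
  have innerE (w : Omega) : \int[nu]_(y in B) (glm_density g m h (z w) y)%:E
      = \int[rho]_(y in B) (D (w, y))%:E.
    rewrite [RHS]integral_mkcond rhoE; last 2 first.
    - apply/(measurable_restrictT _ _).1 => //; apply: measurable_funTS.
      by apply/measurable_EFinP; exact: measurableT_comp mD _.
    - by move=> y; rewrite patchE; case: ifP => // _; rewrite lee_fin.
    rewrite [LHS]integral_mkcond; apply: eq_integral => y _.
    by rewrite !patchE; case: ifP; rewrite ?mul0e // -EFinM DE.
  have mF : measurable_fun (setT : set X) (fun w => \int[rho]_(y in B) (D (w, y))%:E).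
    have := measurable_fun_fubini_tonelli_F (m2 := rho) _ mDB DB0.
    apply: eq_measurable_fun => w _; rewrite /fubini_F [RHS]integral_mkcond.
    by apply: eq_integral => y _; rewrite eB.
  rewrite [LHS]integral_mkcond [RHS]integral_mkcond PX; last 2 first.
  - by apply/(measurable_restrictT _ _).1 => //; exact: measurable_funTS.
  - move=> w; rewrite patchE; case: ifP => // _; apply: integral_ge0 => y _.
    by rewrite lee_fin.
  by apply: eq_integral => w _; rewrite !patchE; case: ifP => // _; exact: innerE.
have mfD : measurable_fun setT (fun p => f p * (D p)%:E) by exact: emeasurable_funM.
have fD0 p : 0 <= f p * (D p)%:E by rewrite mule_ge0 // lee_fin.
rewrite PX; last 2 first.
- exact: (measurable_fun_fubini_tonelli_F (m2 := rho) _ mfD fD0).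
- by move=> w; apply: integral_ge0 => y _; exact: fD0.
apply: eq_integral => w _; rewrite rhoE; last 2 first.
- exact: (measurableT_comp mfD).
- by move=> y; exact: (fD0 (w, y)).
by apply: eq_integral => y _; rewrite -muleA -EFinM DE.
Qed.

End ConditionalDensity.

(** * Exponential martingale of discounted log-mixtures *)

Section MixtureMartingale.
Local Open Scope ereal_scope.
Context {K : realType}.
Let Y := measurableTypeR K.
Local Notation leb := (@lebesgue_measure K).

Definition mixture_ratio (g : K) (m : K -> K) (z0 sg z y : K) : \bar K :=
  \int[leb]_u (normal_pdf 0 1 u
    * expR ((y * (z0 + sg * u - z) - (m (z0 + sg * u) - m z)) / g))%:E.

Lemma mixture_ratio_ge0 g m z0 sg z y : 0 <= mixture_ratio g m z0 sg z y.
Proof.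
by apply: integral_ge0 => u _; rewrite lee_fin mulr_ge0 ?normal_pdf_ge0 ?expR_ge0.
Qed.

Lemma measurable_mixture_ratio d (T : measurableType d) g m (z0 sg z y : T -> K) :
  measurable_fun setT m -> measurable_fun setT z0 -> measurable_fun setT sg ->
  measurable_fun setT z -> measurable_fun setT y ->
  measurable_fun setT (fun w => mixture_ratio g m (z0 w) (sg w) (z w) (y w)).
Proof.
move=> mm mz0 msg mz my.
pose f (p : T * K) : \bar K := (normal_pdf 0 1 p.2
    * expR ((y p.1 * (z0 p.1 + sg p.1 * p.2 - z p.1)
             - (m (z0 p.1 + sg p.1 * p.2) - m (z p.1))) / g))%:E.
have c1 (h : T -> K) : measurable_fun setT h ->
    measurable_fun setT (fun p : T * K => h p.1).
  by move=> mh; exact: measurableT_comp.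
have mf : measurable_fun setT f.
  have mzz : measurable_fun setT (fun p : T * K => (z0 p.1 + sg p.1 * p.2)%R).
    apply: measurable_funD; first exact: c1.
    by apply: measurable_funM; [exact: c1 | exact: measurable_snd].
  apply/measurable_EFinP; apply: measurable_funM.
    by apply: measurableT_comp => //; exact: measurable_normal_pdf.
  apply: measurableT_comp => //; apply: measurable_funM => //.
  apply: measurable_funB.
    by apply: measurable_funM; [exact: c1 | apply: measurable_funB => //; exact: c1].
  apply: measurable_funB; first exact: measurableT_comp.
  by apply: measurableT_comp mm _; exact: c1.
apply: (measurable_fun_fubini_tonelli_F (m2 := leb) f mf) => p.
by rewrite lee_fin mulr_ge0 ?normal_pdf_ge0 ?expR_ge0.
Qed.

Variables (g : K) (m h : K -> K) (nu : {measure set Y -> \bar K}).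
Hypotheses (mm : measurable_fun setT m) (mh : measurable_fun (setT : set Y) h).
Hypothesis nu1 : forall z : K, \int[nu]_y (glm_density g m h z y)%:E = 1.

Let mp (c : K) : measurable_fun (setT : set Y) (glm_density g m h c).
Proof.
apply: measurableT_comp => //; apply: measurable_funD => //.
apply: measurable_funM => //; apply: measurable_funB => //.
exact: measurable_funM.
Qed.

Let p0 (c y : K) : (0 <= glm_density g m h c y)%R.
Proof. exact: expR_ge0. Qed.

Let mpE (c : K) : measurable_fun (setT : set Y) (EFin \o glm_density g m h c).
Proof. by apply/measurable_EFinP; exact: mp. Qed.

Let mY (z0 sg z : K) : measurable_fun (setT : set Y) (mixture_ratio g m z0 sg z).
Proof.
exact: (@measurable_mixture_ratio _ Y g m (cst z0) (cst sg) (cst z) id).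
Qed.

Lemma mixture_ratio_mean z0 sg z :
  \int[nu]_y (mixture_ratio g m z0 sg z y * (glm_density g m h z y)%:E) = 1.
Proof.
pose rho0 : {measure set Y -> \bar K} := density_measure nu (mp z) (p0 z).
have rho1 : rho0 setT = 1 by exact: nu1.
pose rho : probability Y K :=
  HB.pack (density_measure nu (mp z) (p0 z))
    (Measure_isProbability.Build _ _ _ rho0 rho1).
have rhoE (u : Y -> \bar K) : measurable_fun setT u -> (forall y, 0 <= u y) ->
    \int[rho]_y u y = \int[nu]_y (u y * (glm_density g m h z y)%:E).
  by move=> mu u0; rewrite -(ge0_integral_density nu (mp z) (p0 z)).
rewrite -rhoE; last 2 first.
- exact: mY.
- exact: mixture_ratio_ge0.
pose f (p : Y * K) : \bar K := (normal_pdf 0 1 p.2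
    * expR ((p.1 * (z0 + sg * p.2 - z) - (m (z0 + sg * p.2) - m z)) / g))%:E.
have f0 p : 0 <= f p by rewrite lee_fin mulr_ge0 ?normal_pdf_ge0 ?expR_ge0.
have mzz : measurable_fun setT (fun p : Y * K => (z0 + sg * p.2)%R).
  have msnd : measurable_fun setT (fun p : Y * K => p.2) by exact: measurable_snd.
  by apply: measurable_funD; [exact: measurable_cst | apply: measurable_funM].
have mf : measurable_fun setT f.
  apply/measurable_EFinP; apply: measurable_funM.
    by apply: measurableT_comp => //; exact: measurable_normal_pdf.
  apply: measurableT_comp => //; apply: measurable_funM => //.
  apply: measurable_funB.
    by apply: measurable_funM; [exact: measurable_fst | apply: measurable_funB].
  by apply: measurable_funB => //; exact: measurableT_comp mm _.
rewrite [LHS](fubini_tonelli (m1 := rho) (m2 := leb) f mf f0).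
rewrite -[RHS](@integral_normal_pdf K 0 1); apply: eq_integral => u _.
have mfu : measurable_fun setT (fun y : Y => f (y, u)) by exact: measurableT_comp mf _.
rewrite rhoE //.
transitivity (\int[nu]_y ((normal_pdf 0 1 u)%:E * (glm_density g m h (z0 + sg * u) y)%:E)).
  apply: eq_integral => y _; rewrite /f /= -!EFinM -mulrA /glm_density -expRD.
  by congr ((_ * expR _)%:E); ring.
rewrite ge0_integralZl //; last 3 first.
- exact: mpE.
- by move=> y _; rewrite lee_fin.
- by rewrite lee_fin normal_pdf_ge0.
by rewrite nu1 mule1.
Qed.

Context {disp : measure_display} {Omega : measurableType disp}.
Variables (P : probability Omega K) .

Lemma mixture_step (G : set (set Omega)) (r z z0 sg W : Omega -> K)
    (N : Omega -> \bar K) :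
  G `<=` measurable -> measurable_fun setT r ->
  measurable_fun (setT : set (g_sigma_algebraType G)) z ->
  measurable_fun (setT : set (g_sigma_algebraType G)) z0 ->
  measurable_fun (setT : set (g_sigma_algebraType G)) sg ->
  measurable_fun (setT : set (g_sigma_algebraType G)) W ->
  measurable_fun (setT : set (g_sigma_algebraType G)) N ->
  (forall w, (0 <= W w <= 1)%R) -> (forall w, 0 <= N w) ->
  cond_law_density P <<s G>> r nu (fun w => glm_density g m h (z w)) ->
  \int[P]_w (N w * ((W w)%:E * mixture_ratio g m (z0 w) (sg w) (z w) (r w)
                    + (1 - W w)%:E)) = \int[P]_w N w.
Proof.
move=> hG mr mz mz0 msg mW mN W01 N0 law.
pose X := g_sigma_algebraType G.
pose f (p : X * Y) : \bar K := N p.1 * ((W p.1)%:E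
  * mixture_ratio g m (z0 p.1) (sg p.1) (z p.1) p.2 + (1 - W p.1)%:E).
have W0 w : (0 <= W w)%R by case/andP: (W01 w).
have W1 w : (0 <= 1 - W w)%R by rewrite subr_ge0; case/andP: (W01 w).
have f0 p : 0 <= f p.
  rewrite mule_ge0 // adde_ge0 ?lee_fin // mule_ge0 ?lee_fin //.
  exact: mixture_ratio_ge0.
have c1 (u : X -> K) : measurable_fun setT u ->
    measurable_fun setT (fun p : X * Y => u p.1).
  by move=> mu; exact: measurableT_comp.
have mf : measurable_fun setT f.
  apply: emeasurable_funM; first exact: measurableT_comp mN _.
  apply: emeasurable_funD.
    apply: emeasurable_funM; first by apply/measurable_EFinP; exact: c1.
    have msnd : measurable_fun setT (fun p : X * Y => p.2) by exact: measurable_snd.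
    exact: (@measurable_mixture_ratio _ (X * Y)%type g m (fun p => z0 p.1)
      (fun p => sg p.1) (fun p => z p.1) (fun p => p.2) mm (c1 _ mz0) (c1 _ msg)
      (c1 _ mz) msnd).
  by apply/measurable_EFinP; apply: measurable_funB => //; exact: c1.
have := cond_density_integral hG mm mh nu1 mr mz law mf f0.
rewrite /f /= => ->; apply: eq_integral => w _.
transitivity (\int[nu]_y (N w * (((W w)%:E
    * (mixture_ratio g m (z0 w) (sg w) (z w) y * (glm_density g m h (z w) y)%:E)
    + (1 - W w)%:E * (glm_density g m h (z w) y)%:E)))).
  apply: eq_integral => y _; rewrite -muleA; congr (_ * _).
  rewrite ge0_muleDl ?muleA // ?lee_fin // mule_ge0 ?lee_fin //.
  exact: mixture_ratio_ge0.
have mMp : measurable_fun (setT : set Y) (fun y =>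
    mixture_ratio g m (z0 w) (sg w) (z w) y * (glm_density g m h (z w) y)%:E).
  by apply: emeasurable_funM; [exact: mY | exact: mpE].
have Mp0 y : 0 <= mixture_ratio g m (z0 w) (sg w) (z w) y * (glm_density g m h (z w) y)%:E.
  by rewrite mule_ge0 ?lee_fin ?mixture_ratio_ge0.
have mA : measurable_fun (setT : set Y) (fun y => (W w)%:E
    * (mixture_ratio g m (z0 w) (sg w) (z w) y * (glm_density g m h (z w) y)%:E)).
  by apply: emeasurable_funM.
have mB : measurable_fun (setT : set Y) (fun y =>
    (1 - W w)%:E * (glm_density g m h (z w) y)%:E).
  by apply: emeasurable_funM => //; exact: mpE.
rewrite ge0_integralZl //; last 2 first.
- exact: emeasurable_funD.
- by move=> y _; rewrite adde_ge0 // mule_ge0 ?lee_fin.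
rewrite ge0_integralD //; last 2 first.
- by move=> y _; rewrite mule_ge0 ?lee_fin.
- by move=> y _; rewrite mule_ge0 ?lee_fin.
rewrite !ge0_integralZl ?lee_fin //; last 2 first.
- exact: mpE.
- by move=> y _; rewrite lee_fin.
rewrite mixture_ratio_mean nu1 !mule1 -EFinD.
by rewrite addrC subrK mule1.
Qed.

End MixtureMartingale.

Section Concentration.
Local Open Scope ereal_scope.
Context {K : realType} {disp : measure_display} {Omega : measurableType disp}.

Lemma measurable_sigma_mono (G G' : set (set Omega)) d (T : measurableType d)
    (f : Omega -> T) : G `<=` <<s G'>> ->
  measurable_fun (setT : set (g_sigma_algebraType G)) f ->
  measurable_fun (setT : set (g_sigma_algebraType G')) f.
Proof.
move=> GG' mf _ B mB.
have := mf measurableT B mB; rewrite !setTI.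
by apply: smallest_sub => //; exact: smallest_sigma_algebra.
Qed.

Fixpoint run_prod (F : nat -> Omega -> \bar K) (n : nat) (w : Omega) : \bar K :=
  if n is s.+1 then run_prod F s w * F s.+1 w else 1.

Lemma run_prod_ge0 F n w : (forall s w, 0 <= F s w) -> 0 <= run_prod F n w.
Proof. by move=> F0; elim: n => [|n IH] //=; rewrite mule_ge0. Qed.

Lemma weighted_expR_le (a c : K) : (0 <= c <= 1)%R ->
  (expR (c * a) <= c * expR a + (1 - c))%R.
Proof.
move=> /andP[c0 c1]; pose u := (c * a)%R.
have h1 := @expR_ge1Dx K (a - u); have h2 := @expR_ge1Dx K (- u).
have e1 : (expR a = expR u * expR (a - u))%R by rewrite -expRD; congr expR; ring.
have e2 : (1 - c = expR u * ((1 - c) * expR (- u)))%R.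
  by rewrite mulrCA -expRD subrr expR0 mulr1.
rewrite -/u e1 [in leRHS]e2 mulrCA -mulrDr ler_peMr ?expR_ge0 //.
have c1' : (0 <= 1 - c)%R by rewrite subr_ge0.
have := ler_wpM2l c0 h1; have := ler_wpM2l c1' h2; rewrite /u.
set x := (c * expR (a - c * a))%R; set y := ((1 - c) * expR (- (c * a)))%R.
lra.
Qed.

Lemma run_prod_ge (F : nat -> Omega -> \bar K) (R : nat -> \bar K)
    (W a : nat -> K) n w :
  (forall s, (1 <= s <= n)%N -> (0 <= W s <= 1)%R) ->
  (forall s, (1 <= s <= n)%N -> F s w = (W s)%:E * R s + (1 - W s)%:E) ->
  (forall s, (1 <= s <= n)%N -> (expR (a s))%:E <= R s) ->
  (expR (\sum_(1 <= s < n.+1) W s * a s))%:E <= run_prod F n w.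
Proof.
elim: n => [|n IH] W01 FE aR; first by rewrite big_nil expR0.
have sub s : (1 <= s <= n)%N -> (1 <= s <= n.+1)%N.
  by move=> /andP[-> /leqW].
rewrite big_nat_recr //= expRD EFinM.
have n1 : (1 <= n.+1 <= n.+1)%N by rewrite leqnn.
apply: lee_pmul; rewrite ?lee_fin ?expR_ge0 //.
  apply: IH => s hs; [exact/W01/sub | exact/FE/sub | exact/aR/sub].
rewrite FE //; have /andP[W0 W1] := W01 _ n1.
apply: (@le_trans _ _ ((W n.+1)%:E * (expR (a n.+1))%:E + (1 - W n.+1)%:E)).
  by rewrite -EFinM -EFinD lee_fin weighted_expR_le // W0.
by rewrite leeD2r // lee_wpmul2l ?lee_fin // aR.
Qed.

Variables (P : probability Omega K) (g : K) (m h : K -> K)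
  (nu : {measure set (measurableTypeR K) -> \bar K}).
Hypotheses (mm : measurable_fun setT m)
  (mh : measurable_fun (setT : set (measurableTypeR K)) h).
Hypothesis nu1 : forall z : K, \int[nu]_y (glm_density g m h z y)%:E = 1.

Lemma mixture_tail (G : nat -> set (set Omega)) (r z z0 sg W : nat -> Omega -> K)
    (n : nat) (dl : K) :
  (forall s, G s `<=` measurable) -> (forall s, G s `<=` <<s G s.+1>>) ->
  (forall s, (1 <= s <= n)%N ->
     measurable_fun (setT : set (g_sigma_algebraType (G s.+1))) (r s)) ->
  (forall s, (1 <= s <= n)%N ->
     [/\ measurable_fun (setT : set (g_sigma_algebraType (G s))) (z s),
         measurable_fun (setT : set (g_sigma_algebraType (G s))) (z0 s),
         measurable_fun (setT : set (g_sigma_algebraType (G s))) (sg s)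
       & measurable_fun (setT : set (g_sigma_algebraType (G s))) (W s)]) ->
  (forall s w, (1 <= s <= n)%N -> (0 <= W s w <= 1)%R) ->
  (forall s, (1 <= s <= n)%N ->
     cond_law_density P <<s G s>> (r s) nu (fun w => glm_density g m h (z s w))) ->
  (0 < dl)%R ->
  exists E : set Omega, [/\ measurable E, P E <= dl%:E &
    forall w, ~ E w -> forall a : nat -> K,
      (forall s, (1 <= s <= n)%N -> (expR (a s))%:E
         <= mixture_ratio g m (z0 s w) (sg s w) (z s w) (r s w)) ->
      (\sum_(1 <= s < n.+1) W s w * a s <= - ln dl)%R].
Proof.
move=> hG hGS mr mzs W01 law dl0.
pose R s w := mixture_ratio g m (z0 s w) (sg s w) (z s w) (r s w).
pose F s w := if (1 <= s <= n)%N then (W s w)%:E * R s w + (1 - W s w)%:E else 1.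
have F0 s w : 0 <= F s w.
  rewrite /F; case: ifP => // hs; have /andP[W0 W1] := W01 s w hs.
  by rewrite adde_ge0 ?mule_ge0 ?mixture_ratio_ge0 ?lee_fin ?subr_ge0.
have Gm s d (T : measurableType d) (f : Omega -> T) :
    measurable_fun (setT : set (g_sigma_algebraType (G s))) f ->
    measurable_fun (setT : set (g_sigma_algebraType (G s.+1))) f.
  exact: measurable_sigma_mono.
have key k : (k <= n)%N ->
    measurable_fun (setT : set (g_sigma_algebraType (G k.+1))) (run_prod F k)
    /\ \int[P]_w run_prod F k w = 1.
  elim: k => [|k IH] kn.
    split; first exact: measurable_cst.
    by rewrite integral_cst // mul1e; exact: probability_setT.
  have [mk ik] := IH (ltnW kn).
  have hk : (1 <= k.+1 <= n)%N by rewrite kn.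
  have [mz mz0 msg mW] := mzs _ hk.
  split.
    apply: emeasurable_funM; first exact: Gm.
    rewrite /F hk; apply: emeasurable_funD.
      apply: emeasurable_funM; first by apply/measurable_EFinP; exact: Gm.
      by apply: measurable_mixture_ratio => //; try exact: Gm; exact: mr.
    by apply/measurable_EFinP; apply: measurable_funB => //; exact: Gm.
  rewrite -ik /= /F hk.
  apply: (mixture_step mm mh nu1 (hG k.+1)) => //.
  - by apply: measurable_sub_sigma (mr _ hk); exact: hG.
  - by move=> w; exact: W01.
  - by move=> w; exact: run_prod_ge0.
  - exact: law.
have [mN iN] := key n (leqnn n).
have {}mN : measurable_fun setT (run_prod F n).
  by apply: measurable_sub_sigma mN; exact: hG.
pose E := [set w | (dl^-1)%:E <= run_prod F n w].
have mE : measurable E.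
  rewrite /E -[X in measurable X]setTI.
  exact: emeasurable_fun_c_infty.
exists E; split => //.
  have : \int[P]_(w in E) (dl^-1)%:E <= 1.
    rewrite -iN; apply: (@le_trans _ _ (\int[P]_(w in E) run_prod F n w)).
      apply: ge0_le_integral => //.
      - by move=> w _; rewrite lee_fin invr_ge0 ltW.
      - exact: measurable_funTS.
    apply: ge0_subset_integral => //.
    by move=> w _; exact: run_prod_ge0.
  rewrite integral_cst //= => h1.
  have -> : P E = dl%:E * ((dl^-1)%:E * P E).
    by rewrite muleA -EFinM divff ?gt_eqF // mul1e.
  by rewrite -[leRHS]mule1 lee_pmul2l // lte_fin.
move=> w Ew a aR.
have : (expR (\sum_(1 <= s < n.+1) W s w * a s))%:E < (dl^-1)%:E.
  rewrite ltNge; apply/negP => h1; apply: Ew; apply: le_trans h1 _.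
  apply: (@run_prod_ge F (R ^~ w) (W ^~ w)) => // s hs; first exact: W01.
  by rewrite /F hs.
rewrite lte_fin -lnV ?posrE // => /ltW hE.
by rewrite -ler_expR lnK // posrE invr_gt0.
Qed.

End Concentration.

(** * The mirror descent step *)

Section Loss.
Context {K : realType}.

Lemma is_derive_ridge n (F : K -> K) (l : K) (x th v : 'cV[K]_n) :
  is_derive (dot x th) 1 F l ->
  is_derive th v (fun u => F (dot x u)) (l * dot x v).
Proof.
move=> dF; pose G t := F (dot x th + dot x v * t).
have dG : is_derive (0 : K) 1 G (dot x v * l).
  by apply: is_derive_affine; rewrite mulr0 addr0.
have e : (fun t : K => t^-1 *: (((fun u => F (dot x u)) \o shift th) (t *: v)
      - F (dot x th)))
    = (fun t : K => t^-1 *: ((G \o shift 0) (t *: (1 : K)) - G 0)).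
  apply/funext => t; rewrite /G /= !addr0 mulr0 addr0; congr (_ *: (F _ - _)).
  by rewrite dotDr dotZr /GRing.scale /= mulr1 addrC mulrC.
have [dG1 dG2] := dG.
have d1 : derivable (fun u => F (dot x u)) th v.
  by move: dG1; rewrite /derivable e.
apply: (DeriveDef d1); rewrite /derive e mulrC; exact: dG2.
Qed.

Variables (g : K) (m f1 f2 : K -> K).
Hypotheses (d1 : forall x : K, is_derive x 1 m (f1 x))
  (d2 : forall x : K, is_derive x 1 f1 (f2 x)).

Lemma is_derive_glb_loss n (x th v : 'cV[K]_n) (r : K) :
  is_derive th v (glb_loss g m x r) ((f1 (dot x th) - r) / g * dot x v).
Proof.
pose F t := (m t - r * t) / g.
have dF : is_derive (dot x th) 1 F ((f1 (dot x th) - r) / g).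
  have d := d1 (dot x th).
  by rewrite /F; apply: is_derive_eq; rewrite /GRing.scale /=; ring.
exact: is_derive_ridge.
Qed.

Lemma dot_delta n (x : 'cV[K]_n) i : dot x (delta_mx i 0) = x i 0.
Proof.
rewrite dotE (bigD1 i) //= mxE !eqxx mulr1 big1 ?addr0 // => j ji.
by rewrite mxE (negbTE ji) mulr0.
Qed.

Lemma derive_glb_loss n (x v th : 'cV[K]_n) (r : K) :
  'D_v (glb_loss g m x r) th = (f1 (dot x th) - r) / g * dot x v.
Proof. by have [_ ->] := is_derive_glb_loss x th v r. Qed.

Lemma grad_glb_loss n (x th : 'cV[K]_n) (r : K) :
  grad (glb_loss g m x r) th = ((f1 (dot x th) - r) / g) *: x.
Proof. by apply/colP => i; rewrite !mxE derive_glb_loss dot_delta. Qed.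

Lemma hess_glb_loss n (x th : 'cV[K]_n) (r : K) :
  hess (glb_loss g m x r) th = (f2 (dot x th) / g) *: (x *m x^T).
Proof.
apply/matrixP => i j; rewrite !mxE big_ord1 mxE.
have -> : 'D_(delta_mx i 0) (glb_loss g m x r)
    = (fun u => (f1 (dot x u) - r) / g * x i 0).
  by apply/funext => u; rewrite derive_glb_loss dot_delta.
pose F t := (f1 t - r) / g * x i 0.
have dF : is_derive (dot x th) 1 F (f2 (dot x th) / g * x i 0).
  have d := d2 (dot x th).
  by rewrite /F; apply: is_derive_eq; rewrite /GRing.scale /=; ring.
have [_ ->] := is_derive_ridge (delta_mx j 0) dF.
by rewrite dot_delta mulrA.
Qed.

Lemma wnorm_sqr n (M : 'M[K]_n) u : 0 <= bform M u u -> wnorm M u ^+ 2 = bform M u u.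
Proof. by move=> h; rewrite sqr_sqrtr. Qed.

Lemma quad_glb_loss n (x th0 th : 'cV[K]_n) (r : K) :
  0 <= f2 (dot x th0) / g ->
  quad_loss (glb_loss g m x r) th0 th
  = glb_loss g m x r th0 + (f1 (dot x th0) - r) / g * dot x (th - th0)
    + 2^-1 * (f2 (dot x th0) / g * dot x (th - th0) ^+ 2).
Proof.
move=> c0; rewrite /quad_loss grad_glb_loss hess_glb_loss.
have e : bform ((f2 (dot x th0) / g) *: (x *m x^T)) (th - th0) (th - th0)
    = f2 (dot x th0) / g * dot x (th - th0) ^+ 2.
  by rewrite bform_scalemx bform_outer expr2.
rewrite wnorm_sqr e; last by apply: mulr_ge0 => //; exact: sqr_ge0.
by rewrite [dot (_ *: _) _]dotC dotZr (dotC (th - th0)).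
Qed.

End Loss.

Section Ball.
Context {K : realType} (n : nat).
Implicit Types u v : 'cV[K]_n.

Lemma norm2Z a u : norm2 (a *: u) = `|a| * norm2 u.
Proof.
rewrite /norm2 dotZr dotC dotZr mulrA -expr2 sqrtrM ?sqr_ge0 //.
by rewrite sqrtr_sqr.
Qed.

Lemma norm2D u v : norm2 (u + v) <= norm2 u + norm2 v.
Proof.
rewrite -(@ler_pXn2r _ 2) ?nnegrE ?addr_ge0 ?norm2_ge0 // sqr_norm2.
rewrite dotDr (dotC _ u) (dotC _ v) !dotDr sqrrD !sqr_norm2 (dotC v u).
by have := dot_cs u v; lra.
Qed.

Lemma ball2_convex S u v e : ball2 S u -> ball2 S v -> 0 <= e <= 1 ->
  ball2 S (u + e *: (v - u)).
Proof.
rewrite /ball2 /= => hu hv /andP[e0 e1].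
have -> : u + e *: (v - u) = (1 - e) *: u + e *: v.
  by rewrite scalerBr scalerBl scale1r addrA addrAC.
apply: le_trans (norm2D _ _) _; rewrite !norm2Z.
have e1' : 0 <= 1 - e by rewrite subr_ge0.
rewrite (ger0_norm e0) (ger0_norm e1').
by have := ler_wpM2l e0 hv; have := ler_wpM2l e1' hu; lra.
Qed.

Lemma ball2_dot S x u : ball2 1 x -> ball2 S u -> - S <= dot x u <= S.
Proof.
rewrite /ball2 /= => hx hu; rewrite -ler_norml; apply: le_trans (dot_abs_le _ _) _.
by rewrite -[S]mul1r ler_pM ?norm2_ge0.
Qed.

Lemma ball2_dist S u v : ball2 S u -> ball2 S v ->
  dot (u - v) (u - v) <= 4 * S ^+ 2.
Proof.
rewrite /ball2 /= => hu hv; rewrite -sqr_norm2.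
have h : norm2 (u - v) <= 2 * S.
  apply: le_trans (norm2D _ _) _; rewrite -scaleN1r norm2Z normrN normr1 mul1r.
  by lra.
have -> : 4 * S ^+ 2 = (2 * S) ^+ 2 by ring.
by rewrite ler_pXn2r // ?nnegrE ?norm2_ge0 // (le_trans _ h) ?norm2_ge0.
Qed.

End Ball.

Lemma linear_ge0_of_quadratic (K : realType) (L Q : K) :
  (forall e, 0 < e <= 1 -> 0 <= e * L + e ^+ 2 * Q) -> 0 <= L.
Proof.
move=> h; rewrite leNgt; apply/negP => L0.
pose q := `|Q| + 1; have q0 : 0 < q by rewrite ltr_wpDl.
pose e := Num.min 1 (- L / q / 2).
have Lq : 0 < - L / q / 2 by rewrite !divr_gt0 // oppr_gt0.
have e0 : 0 < e by rewrite /e lt_min ltr01 Lq.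
have e1 : e <= 1 by rewrite /e ge_min lexx.
have eL : e * q <= - L / 2.
  have -> : - L / 2 = - L / q / 2 * q by field; rewrite gt_eqF.
  by rewrite ler_pM2r // /e ge_min lexx orbT.
have := h e; rewrite e0 e1 => /(_ isT).
have -> : e * L + e ^+ 2 * Q = e * (L + e * Q) by ring.
rewrite pmulr_rge0 // => h2.
have : e * Q <= e * q by rewrite ler_pM2l // /q (le_trans (ler_norm _)) // lerDl.
by lra.
Qed.

Section MirrorStep.
Context {K : realType} (d : nat).
Variables (R S g k eta : K) (m f1 f2 f3 : K -> K).
Hypotheses (R0 : 0 < R) (S0 : 0 < S) (g0 : 0 < g).
Hypothesis sc : self_concordant R m f1 f2 f3.
Hypothesis f2k : forall z, - S <= z <= S -> f2 z <= k.
Hypothesis etaE : eta = 1 + R * S.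
Variables (A : 'M[K]_d) (l : K).
Hypotheses (sA : A^T = A) (l0 : 0 < l)
  (Al : forall u, l * dot u u <= bform A u u).
Variables (x th th' : 'cV[K]_d) (r : K).
Hypotheses (x1 : ball2 1 x) (thS : ball2 S th).

Let obj u := quad_loss (glb_loss g m x r) th u
  + (2 * eta)^-1 * wnorm A (u - th) ^+ 2.

Hypothesis th'min : is_argmin (ball2 S) obj th'.

Let eta0 : 0 < eta. Proof. by rewrite etaE ltr_pwDl // mulr_ge0 ?ltW. Qed.

Let c0 z : 0 <= f2 z / g.
Proof. by rewrite divr_ge0 ?(ltW g0) // (sc_ge0 R0 z sc). Qed.

Let A0 u : 0 <= bform A u u.
Proof. by apply: le_trans (Al u); rewrite mulr_ge0 ?dot_ge0 // ltW. Qed.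

Lemma mirror_objE u : obj u = glb_loss g m x r th + (f1 (dot x th) - r) / g * dot x (u - th)
  + 2^-1 * (f2 (dot x th) / g * dot x (u - th) ^+ 2)
  + (2 * eta)^-1 * bform A (u - th) (u - th).
Proof.
have [d1 d2 _ _] := sc.
by rewrite /obj (quad_glb_loss d1 d2) // wnorm_sqr.
Qed.

Let slope v := (f1 (dot x th) - r) / g * dot x v
  + f2 (dot x th) / g * dot x (th' - th) * dot x v + eta^-1 * bform A (th' - th) v.

Let obj_line v e : obj (th' + e *: v) - obj th' = e * slope v
  + e ^+ 2 * (2^-1 * (f2 (dot x th) / g * dot x v ^+ 2)
              + (2 * eta)^-1 * bform A v v).
Proof.
rewrite !mirror_objE /slope (addrAC th'); move: (th' - th) => D.
rewrite dotDr dotZr !(bformDl, bformDr, bformZl, bformZr).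
rewrite (bform_sym v D sA).
by field; rewrite !gt_eqF.
Qed.

Let slope_ge0 u : ball2 S u -> 0 <= slope (u - th').
Proof.
move=> uS; have [t1 t2] := th'min.
apply: (@linear_ge0_of_quadratic _ _
  (2^-1 * (f2 (dot x th) / g * dot x (u - th') ^+ 2)
   + (2 * eta)^-1 * bform A (u - th') (u - th'))) => e /andP[e0 e1].
rewrite -obj_line subr_ge0; apply: t2; apply: ball2_convex => //.
by rewrite (ltW e0).
Qed.

Lemma mirror_argmin_gap u : ball2 S u ->
  l / (2 * eta) * dot (u - th') (u - th') <= obj u - obj th'.
Proof.
move=> uS; have := obj_line (u - th') 1; rewrite scale1r (addrC th') subrK => ->.
rewrite expr1n !mul1r -[leLHS]add0r lerD ?slope_ge0 // -[leLHS]add0r lerD //.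
  by rewrite mulr_ge0 ?invr_ge0 // mulr_ge0 ?sqr_ge0.
by rewrite (mulrC l) -mulrA ler_pM2l // invr_gt0 mulr_gt0.
Qed.

Lemma mirror_obj_upper : exists2 C, 0 <= C &
  forall v : 'cV[K]_d, obj (th' + v) - obj th' <= C * (norm2 v + norm2 v ^+ 2).
Proof.
pose a := \sum_i \sum_j `|A i j|.
have a0 : 0 <= a by rewrite sumr_ge0 // => i _; rewrite sumr_ge0.
have nrm (v : 'cV[K]_d) i : `|v i 0| <= norm2 v.
  rewrite -dot_delta dotC -[leRHS]mul1r; apply: le_trans (dot_abs_le _ _) _.
  by rewrite /norm2 dot_delta mxE !eqxx sqrtr1.
have bA (u v : 'cV[K]_d) : `|bform A u v| <= a * (norm2 u * norm2 v).
  have -> : bform A u v = \sum_j \sum_i u i 0 * A i j * v j 0.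
    rewrite /bform mxE; apply: eq_bigr => j _; rewrite mxE mulr_suml.
    by apply: eq_bigr => i _; rewrite mxE.
  rewrite exchange_big /= /a mulr_suml; apply: le_trans (ler_norm_sum _ _ _) _.
  apply: ler_sum => i _; rewrite mulr_suml; apply: le_trans (ler_norm_sum _ _ _) _.
  apply: ler_sum => j _; rewrite !normrM mulrAC mulrC.
  by rewrite ler_wpM2l // ler_pM.
have x1' : norm2 x <= 1 by [].
have dx (v : 'cV[K]_d) : `|dot x v| <= norm2 v.
  by apply: le_trans (dot_abs_le _ _) _; rewrite ler_piMl ?norm2_ge0.
pose c := f2 (dot x th) / g; pose b := (f1 (dot x th) - r) / g.
have cg : 0 <= c by exact: c0.
have ie : 0 <= eta^-1 by rewrite invr_ge0 ltW.
pose D := norm2 (th' - th).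
have D0 : 0 <= D by exact: norm2_ge0.
exists (`|b| + c * D + eta^-1 * a * D + c + eta^-1 * a).
  by rewrite !addr_ge0 // ?(mulr_ge0 cg D0) ?(mulr_ge0 (mulr_ge0 ie a0) D0) ?(mulr_ge0 ie a0).
move=> v; have := obj_line v 1; rewrite scale1r => ->.
rewrite expr1n !mul1r invfM /slope -/c -/b; pose w := norm2 v.
have w0 : 0 <= w by exact: norm2_ge0.
have h1 : b * dot x v <= `|b| * w.
  by apply: le_trans (ler_norm _) _; rewrite normrM ler_wpM2l.
have h2 : c * dot x (th' - th) * dot x v <= c * (D * w).
  rewrite -mulrA ler_wpM2l //; apply: le_trans (ler_norm _) _.
  by rewrite normrM ler_pM.
have h3 : eta^-1 * bform A (th' - th) v <= eta^-1 * (a * (D * w)).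
  by rewrite ler_wpM2l // (le_trans (ler_norm _)).
have h4 : c * dot x v ^+ 2 <= c * w ^+ 2.
  rewrite ler_wpM2l // -[leLHS]real_normK ?num_real //.
  by rewrite ler_pXn2r ?nnegrE.
have h5 : eta^-1 * bform A v v <= eta^-1 * (a * (w * w)).
  by rewrite ler_wpM2l // (le_trans (ler_norm _)).
rewrite -expr2 in h5; rewrite -/w.
have w20 : 0 <= w ^+ 2 by exact: sqr_ge0.
have k1 := mulr_ge0 (normr_ge0 b) w20.
have k2 := mulr_ge0 (mulr_ge0 cg D0) w20.
have k3 := mulr_ge0 (mulr_ge0 (mulr_ge0 ie a0) D0) w20.
have k4 := mulr_ge0 cg w0.
have k5 := mulr_ge0 (mulr_ge0 ie a0) w0.
have k6 := mulr_ge0 cg w20.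
have k7 := mulr_ge0 ie (mulr_ge0 a0 w20).
by lra.
Qed.

Lemma mirror_step_bound u : ball2 S u -> 6 * eta * R * k * S / g <= l ->
  bform A (th' - u) (th' - u) + f2 (dot x th') / g * dot x (th' - u) ^+ 2
  <= bform A (th - u) (th - u)
     + 2 * eta * (glb_loss g m x r u - glb_loss g m x r th')
     - 2 / 3 * bform A (th' - th) (th' - th).
Proof.
move=> uS lk; have th'S := th'min.1.
pose z := dot x th; pose z' := dot x th'; pose zu := dot x u.
have zS : - S <= z <= S by exact: ball2_dot.
have z'S : - S <= z' <= S by exact: ball2_dot.
have zuS : - S <= zu <= S by exact: ball2_dot.
have breg : f2 z' / (2 * eta) * (zu - z') ^+ 2 <= m zu - m z' - f1 z' * (zu - z').
  have := sc_bregman_lower R0 z' (zu - z') sc; rewrite (addrC z') subrK.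
  apply: le_trans.
  have D0 : 0 < 2 + R * `|zu - z'| by rewrite ltr_pwDl // mulr_ge0 ?(ltW R0).
  have Dle : 2 + R * `|zu - z'| <= 2 * eta.
    have : `|zu - z'| <= 2 * S.
      by move: z'S zuS => /andP[? ?] /andP[? ?]; rewrite ler_norml; apply/andP; split; lra.
    by rewrite -(ler_pM2l R0) etaE; lra.
  rewrite -mulrA ler_wpM2l ?(sc_ge0 R0 z' sc) // [leRHS]mulrC ler_wpM2r ?sqr_ge0 //.
  by rewrite lef_pV2 ?posrE // mulr_gt0.
have tay := sc_taylor R0 sc f2k zS z'S.
have z2 : (z' - z) ^+ 2 <= l^-1 * bform A (th' - th) (th' - th).
  rewrite ler_pdivlMl //; apply: le_trans (Al _); rewrite ler_pM2l //.
  rewrite /z' /z -dotBr -[leLHS]real_normK ?num_real // -sqr_norm2.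
  rewrite ler_pXn2r ?nnegrE ?norm2_ge0 //; apply: le_trans (dot_abs_le _ _) _.
  by rewrite ler_piMl ?norm2_ge0.
have f1' := slope_ge0 uS.
rewrite /slope !dotBr -/z -/z' -/zu in f1'.
rewrite !dotBr -/z' -/zu /glb_loss -/zu -/z'.
set DA := bform A (th' - th) (th' - th) in z2 *.
have polar : 2 * bform A (th' - th) (u - th')
  = bform A (th - u) (th - u) - bform A (th' - u) (th' - u) - DA.
  rewrite /DA !(bformDl, bformDr, bformNl, bformNr).
  rewrite (bform_sym th th' sA) (bform_sym u th' sA) (bform_sym u th sA).
  by ring.
have rem : (f1 z' - f1 z - f2 z * (z' - z)) * (z' - zu)
    <= R * k / 2 * (z' - z) ^+ 2 * (2 * S).
  apply: le_trans (ler_norm _) _; rewrite normrM ler_pM //.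
  by move: z'S zuS => /andP[? ?] /andP[? ?]; rewrite ler_norml; apply/andP; split; lra.
have k0 : 0 <= k by apply: le_trans (f2k zS); exact: sc_ge0 sc.
have rem2 : 2 * eta / g * (R * k / 2 * (z' - z) ^+ 2 * (2 * S)) <= 3^-1 * DA.
  have -> : 2 * eta / g * (R * k / 2 * (z' - z) ^+ 2 * (2 * S))
    = 3^-1 * (6 * eta * R * k * S / g) * (z' - z) ^+ 2 by field; rewrite gt_eqF.
  rewrite -mulrA ler_pM2l ?invr_gt0 //.
  apply: le_trans (ler_wpM2r (sqr_ge0 _) lk) _.
  by rewrite -ler_pdivlMl.
have G2 : 0 < 2 * eta / g by rewrite divr_gt0 // mulr_gt0.
have {}breg := ler_wpM2l (ltW G2) breg.
have {}rem := ler_wpM2l (ltW G2) rem.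
have e2 : 0 < 2 * eta by rewrite mulr_gt0.
have {}f1' := ler_wpM2l (ltW e2) f1'.
have e3 : 2 * eta * ((f1 z - r) / g * (zu - z') + f2 z / g * (z' - z) * (zu - z')
    + eta^-1 * bform A (th' - th) (u - th'))
  = 2 * eta / g * ((f1 z - r + f2 z * (z' - z)) * (zu - z')) +
    2 * bform A (th' - th) (u - th') by field; rewrite !gt_eqF.
rewrite mulr0 e3 polar in f1'.
have e4 : 2 * eta / g * (f2 z' / (2 * eta) * (zu - z') ^+ 2)
  = f2 z' / g * (z' - zu) ^+ 2 by field; rewrite !gt_eqF.
rewrite e4 in breg.
have -> : 2 * eta * ((m zu - r * zu) / g - (m z' - r * z') / g)
  = 2 * eta / g * (m zu - m z' - r * (zu - z')) by field; rewrite gt_eqF.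
set B1 := bform A (th' - u) _ in f1' *; set B2 := bform A (th - u) _ in f1' *.
set c := 2 * eta / g in breg rem rem2 f1' *.
by lra.
Qed.

End MirrorStep.

(** * Measurability of minimizers *)

Section DenseBall.
Context {K : realType} (d : nat).

Lemma norm2_le_entries (u : 'cV[K]_d) (c : K) : 0 <= c ->
  (forall i, `|u i 0| <= c) -> norm2 u <= c * d%:R.
Proof.
move=> c0 uc; rewrite -(@ler_pXn2r _ 2) ?nnegrE ?norm2_ge0 ?mulr_ge0 //.
rewrite sqr_norm2 dotE.
apply: (@le_trans _ _ (\sum_(i < d) c ^+ 2)).
  apply: ler_sum => i _; rewrite -expr2 -real_normK ?num_real //.
  by rewrite ler_pXn2r ?nnegrE // uc.
rewrite sumr_const card_ord exprMn -[leLHS]mulr_natr ler_wpM2l ?sqr_ge0 //.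
by rewrite -natrX ler_nat; have [->//|d0] := posnP d; rewrite leq_pmulr.
Qed.

Definition ball_point (S : K) (k : nat) : 'cV[K]_d :=
  if (unpickle k : option 'cV[rat]_d) is Some q then
    let u := map_mx ratr q in if norm2 u <= S then u else 0
  else 0.

Lemma ball_point_ball S k : 0 <= S -> ball2 S (ball_point S k).
Proof.
move=> S0; have n0 : norm2 (0 : 'cV[K]_d) <= S.
  by rewrite -[0](scale0r 0) norm2Z normr0 mul0r.
by rewrite /ball2 /= /ball_point; case: unpickle => [q|] //=; case: ifP.
Qed.

Lemma ball_point_dense S u e : 0 < S -> ball2 S u -> 0 < e ->
  exists k, norm2 (ball_point S k - u) <= e.
Proof.
rewrite /ball2 /= => S0 uS e0.
pose rho := Num.min 1 (e / (2 * S)).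
have es0 : 0 < e / (2 * S) by rewrite divr_gt0 ?mulr_gt0.
have rho0 : 0 < rho by rewrite lt_min ltr01 es0.
have rho1 : rho <= 1 by rewrite ge_min lexx.
have rhoe : rho * (2 * S) <= e.
  by rewrite -ler_pdivlMr ?mulr_gt0 // ge_min lexx orbT.
have d1 : 0 < d%:R + 1 :> K by rewrite ltr_wpDl.
pose c := rho * S / (d%:R + 1).
have c0 : 0 < c by rewrite divr_gt0 ?mulr_gt0.
have cd : c * d%:R <= rho * S.
  rewrite -[leRHS](divfK (lt0r_neq0 d1)) -/c ler_pM2l // lerDl //.
pose v := (1 - rho) *: u.
have ex i : {q : rat | `|ratr q - v i 0| <= c}.
  apply: cid; have h : v i 0 - c < v i 0 + c by lra.
  have [q] := rat_in_itvoo h; rewrite in_itv /= => /andP[q1 q2].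
  by exists q; rewrite ler_norml; apply/andP; split; lra.
pose q : 'cV[rat]_d := \col_i sval (ex i).
have qv : norm2 (map_mx ratr q - v) <= rho * S.
  apply: le_trans cd; apply: norm2_le_entries (ltW c0) _ => i.
  suff -> : (map_mx ratr q - v) i 0 = ratr (sval (ex i)) - v i 0.
    exact: (svalP (ex i)).
  by rewrite mxE mxE [(- v) i 0]mxE /q mxE.
have qS : norm2 (map_mx ratr q : 'cV[K]_d) <= S.
  rewrite -[map_mx _ _](subrK v); apply: le_trans (norm2D _ _) _.
  rewrite /v norm2Z ger0_norm ?subr_ge0 //.
  have h : (1 - rho) * norm2 u <= (1 - rho) * S by rewrite ler_wpM2l ?subr_ge0.
  by rewrite -/v; lra.
exists (pickle q); rewrite /ball_point pickleK /= qS.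
have -> : map_mx ratr q - u = (map_mx ratr q - v) + (- rho) *: u.
  by move: (map_mx ratr q) => y; apply/colP => i; rewrite /v !mxE; ring.
apply: le_trans (norm2D _ _) _; rewrite norm2Z normrN gtr0_norm //.
have h : rho * norm2 u <= rho * S by rewrite ler_pM2l.
by lra.
Qed.

End DenseBall.

Section MeasurableArgmin.
Context {K : realType} {disp : measure_display} {T : measurableType disp}.
Variables (d : nat) (S kap : K) (obj : T -> 'cV[K]_d -> K) (th : T -> 'cV[K]_d).
Hypotheses (S0 : 0 < S) (kap0 : 0 < kap).
Hypothesis mobj : forall u, measurable_fun setT (fun w => obj w u).
Hypothesis thS : forall w, ball2 S (th w).
Hypothesis gap : forall w u, ball2 S u ->
  kap * dot (u - th w) (u - th w) <= obj w u - obj w (th w).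
Hypothesis upper : forall w, exists2 C, 0 <= C &
  forall v : 'cV[K]_d, obj w (th w + v) - obj w (th w) <= C * (norm2 v + norm2 v ^+ 2).

Fixpoint best_point (k : nat) (w : T) : 'cV[K]_d :=
  if k is j.+1 then
    if obj w (ball_point d S k) < obj w (best_point j w)
    then ball_point d S k else best_point j w
  else ball_point d S 0.

Let best_ball k w : ball2 S (best_point k w).
Proof. by elim: k => [|k IH] /=; [|case: ifP => // _]; exact: ball_point_ball (ltW S0). Qed.

Let best_le k w j : (j <= k)%N -> obj w (best_point k w) <= obj w (ball_point d S j).
Proof.
elim: k => [|k IH]; first by rewrite leqn0 => /eqP ->.
rewrite leq_eqVlt => /predU1P[->|jk] /=.
  by case: ltP => // /ltW.
case: ltP => [h|_]; last exact: IH.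
by apply: le_trans (ltW h) _; exact: IH.
Qed.

Let mbest k : measurable_fun setT (fun w => obj w (best_point k w))
  /\ vec_measurable (best_point k).
Proof.
elim: k => [|k [IH1 IH2]].
  split; first exact: (mobj (ball_point d S 0)).
  by move=> i; exact: (measurable_cst (ball_point d S 0 i 0)).
have mb : measurable_fun setT
    (fun w => obj w (ball_point d S k.+1) < obj w (best_point k w)).
  exact: measurable_fun_ltr.
split=> [|i].
  rewrite (_ : (fun w => _) = (fun w =>
    if obj w (ball_point d S k.+1) < obj w (best_point k w)
    then obj w (ball_point d S k.+1) else obj w (best_point k w))).
    exact: measurable_fun_ifT.
  by apply/funext => w /=; case: ifP.
rewrite (_ : (fun w => _) = (fun w =>
    if obj w (ball_point d S k.+1) < obj w (best_point k w)
    then ball_point d S k.+1 i 0 else best_point k w i 0)).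
  by apply: measurable_fun_ifT => //; exact: IH2.
by apply/funext => w /=; case: ifP.
Qed.

(* A strongly convex objective has its argmin as the limit of the best of the
   first [k] points of a dense sequence. *)
Lemma measurable_argmin : vec_measurable th.
Proof.
move=> i; apply: (@measurable_fun_cvg _ _ _ _ (fun k w => best_point k w i 0)).
  by move=> k; have [_] := mbest k; apply.
move=> w _; apply/cvgrPdist_le => e e0.
have [C C0 hC] := upper w.
pose ep := kap * e ^+ 2; have ep0 : 0 < ep by rewrite mulr_gt0 ?exprn_gt0.
pose dl := Num.min 1 (ep / (2 * (C + 1))).
have C1 : 0 < C + 1 by rewrite ltr_wpDl.
have q0 : 0 < ep / (2 * (C + 1)) by rewrite divr_gt0 ?mulr_gt0.
have dl0 : 0 < dl by rewrite lt_min ltr01 q0.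
have dl1 : dl <= 1 by rewrite ge_min lexx.
have dle : dl * (2 * (C + 1)) <= ep.
  by rewrite -ler_pdivlMr ?mulr_gt0 // ge_min lexx orbT.
have [j hj] := ball_point_dense S0 (thS w) dl0.
near=> k.
have jk : (j <= k)%N by near: k; exact: nbhs_infty_ge.
have h1 := best_le w jk.
have h2 := gap w (best_ball k w).
have h3 := hC (ball_point d S j - th w); rewrite (addrC (th w)) subrK in h3.
set n := norm2 _ in hj h3.
have n0 : 0 <= n by exact: norm2_ge0.
have h4 : C * (n + n ^+ 2) <= C * (dl + dl).
  rewrite ler_wpM2l // lerD // (le_trans _ hj) // expr2 ler_piMl //.
  exact: le_trans hj dl1.
have h5 : kap * dot (best_point k w - th w) (best_point k w - th w) <= ep.
  by lra.
rewrite /ep ler_pM2l // in h5.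
rewrite distrC -(@ler_pXn2r _ 2) ?nnegrE ?(ltW e0) //; apply: le_trans h5.
rewrite real_normK ?num_real // dotE (bigD1 i) //= !mxE -expr2 lerDl.
by rewrite sumr_ge0 // => a _; rewrite -expr2 sqr_ge0.
Unshelve. all: by end_near. Qed.

End MeasurableArgmin.

(** * Trajectories *)

Section Model.
Context {K : realType}.

Lemma class_C3_self_concordant (R : K) (m : K -> K) : class_C3 m ->
  (forall z, `|m^`(3)%classic z| <= R * m^`(2)%classic z) ->
  self_concordant R m m^`()%classic m^`(2)%classic m^`(3)%classic.
Proof.
move=> [dm _] sc.
have h k (z : K) : (k < 3)%N -> is_derive z 1 m^`(k)%classic (m^`(k.+1)%classic z).
  move=> k3; apply: DeriveDef; first exact: dm.
  by rewrite derive1nS derive1E.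
split.
- by move=> z; have := h 0%N z isT; rewrite derive1n0 derive1n1.
- by move=> z; have := h 1%N z isT; rewrite derive1n1.
- by move=> z; have := h 2%N z isT.
- exact: sc.
Qed.

End Model.

Section DiscountedSum.
Context {K : realType}.

Definition dsum (c : K) (b : nat -> K) (t : nat) : K :=
  \sum_(1 <= s < t) c ^+ (t.-1 - s) * b s.

Lemma dsum1 c b : dsum c b 1 = 0.
Proof. by rewrite /dsum big_geq. Qed.

Lemma dsumS c b t : (1 <= t)%N -> dsum c b t.+1 = c * dsum c b t + b t.
Proof.
move=> t1; rewrite /dsum big_nat_recr //= subnn expr0 mul1r; congr (_ + _).
rewrite mulr_sumr; apply: eq_big_nat => s /andP[s1 st].
by rewrite mulrA -exprS -subSn ?prednK // -ltnS prednK.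
Qed.

Lemma dsumD c b1 b2 t : dsum c (fun s => b1 s + b2 s) t = dsum c b1 t + dsum c b2 t.
Proof. by rewrite /dsum -big_split /=; apply: eq_bigr => s _; rewrite mulrDr. Qed.

Lemma dsumZ c a b t : dsum c (fun s => a * b s) t = a * dsum c b t.
Proof. by rewrite /dsum mulr_sumr; apply: eq_bigr => s _; rewrite mulrCA. Qed.

Lemma dsum_le_tail c b C D t : 0 < c < 1 -> 0 <= C ->
  (forall s, (1 <= s < t)%N -> b s <= C) ->
  (forall s, (1 <= s < t)%N -> (t.-1 - s < D)%N -> b s <= 0) ->
  dsum c b t <= C * (c ^+ D / (1 - c)).
Proof.
move=> /andP[c0 c1] C0 bC b0; have c1' : 0 < 1 - c by rewrite subr_gt0.
pose F j := c ^+ j * (if (j < D)%N then 0 else C).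
apply: (@le_trans _ _ (\sum_(1 <= s < t) F (t.-1 - s)%N)).
  rewrite /dsum big_nat_cond [leRHS]big_nat_cond; apply: ler_sum => s /andP[hs _].
  rewrite /F ler_wpM2l ?exprn_ge0 ?(ltW c0) //; case: ifP => [h|_]; last exact: bC.
  exact: b0.
have -> : \sum_(1 <= s < t) F (t.-1 - s)%N = \sum_(0 <= j < t.-1) F j.
  case: t {bC b0} => [|t]; first by rewrite !big_geq.
  rewrite big_add1 /= big_nat_rev /= add0n; apply: eq_big_nat => j /andP[_ jt].
  by rewrite -subSn // subSS subKn // ltnW.
move: t.-1 => n {bC b0}.
suff : \sum_(0 <= j < n) F j <= C * ((c ^+ D - c ^+ maxn n D) / (1 - c)).
  move/le_trans; apply; rewrite ler_wpM2l // ler_pM2r ?invr_gt0 //.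
  by rewrite gerBl exprn_ge0 // ltW.
elim: n => [|n IH]; first by rewrite big_geq // max0n subrr mul0r mulr0.
rewrite big_nat_recr //= /F; case: ltnP => nD.
  by move: IH; rewrite mulr0 addr0 (maxn_idPr nD) (maxn_idPr (ltnW nD)).
apply: (le_trans (lerD IH (lexx _))).
rewrite (maxn_idPl nD) (maxn_idPl (leqW nD)) exprS.
rewrite le_eqVlt; apply/orP; left; apply/eqP; field.
by rewrite gt_eqF.
Qed.

End DiscountedSum.

Section Trajectory.
Context {K : realType} (d : nat).
Variables (R S g kmu : K) (m f1 f2 f3 : K -> K) (eta gam lam delta : K) (T : nat).
Variables (theta1 : 'cV[K]_d) (arms : nat -> set 'cV[K]_d).
Variables (x : nat -> 'cV[K]_d) (r : nat -> K).
Variables (theta : nat -> 'cV[K]_d) (H : nat -> 'M[K]_d).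
Hypotheses (R0 : 0 < R) (S0 : 0 < S) (g0 : 0 < g).
Hypothesis sc : self_concordant R m f1 f2 f3.
Hypothesis f2k : forall z, - S <= z <= S -> f2 z <= kmu.
Hypothesis etaE : eta = 1 + R * S.
Hypotheses (gam0 : 0 < gam < 1) (lam0 : 0 < lam).
Hypothesis lam_ge : 6 * eta * R * kmu * S / g <= lam.
Hypothesis run : domd_glb_run R S g kmu m gam lam eta delta T theta1 arms x r theta H.
Hypothesis theta1S : ball2 S theta1.
Hypothesis x1 : forall t, (1 <= t)%N -> ball2 1 (x t).

Let eta1 : 1 <= eta. Proof. by rewrite etaE lerDl mulr_ge0 // ltW. Qed.

Definition curv t := f2 (dot (x t) (theta t.+1)) / g.
Definition prior t := discounted_reg gam lam (H t).
Definition leverage t := bform (invmx (prior t)) (x t) (x t).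
Definition move_sqr t :=
  bform (prior t) (theta t.+1 - theta t) (theta t.+1 - theta t).

Lemma curv_ge0 t : 0 <= curv t.
Proof. by rewrite divr_ge0 ?(ltW g0) // (sc_ge0 R0 _ sc). Qed.

Lemma run_theta_ball t : (1 <= t <= T.+1)%N -> ball2 S (theta t).
Proof.
case: t => [|[|t]] // h; first by rewrite (domd_init_theta run).
by have [] := domd_update_theta run (t := t.+1) h.
Qed.

Lemma run_H_step t : (1 <= t <= T)%N ->
  H t.+1 = prior t + curv t *: (x t *m (x t)^T).
Proof.
by move=> h; have [d1 d2 _ _] := sc; rewrite (domd_update_H run h) (hess_glb_loss g d1 d2).
Qed.

Lemma prior_form t u : bform (prior t) u u
  = gam * bform (H t) u u + (1 - gam) * lam * dot u u.
Proof. by rewrite bform_addmx bform_scalemx bform_scalar. Qed.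

Let prior_of_H t : (H t)^T = H t /\ (forall u, lam * dot u u <= bform (H t) u u) ->
  (prior t)^T = prior t /\ forall u, lam * dot u u <= bform (prior t) u u.
Proof.
move=> [sH lH]; have /andP[c0 c1] := gam0; split.
  by rewrite /prior /discounted_reg linearD /= linearZ /= sH tr_scalar_mx.
move=> u; rewrite prior_form; have := ler_wpM2l (ltW c0) (lH u); lra.
Qed.

Lemma run_H t : (1 <= t <= T.+1)%N ->
  (H t)^T = H t /\ forall u, lam * dot u u <= bform (H t) u u.
Proof.
case: t => // t; elim: t => [|t IH] h.
  rewrite (domd_init_H run); split; first exact: tr_scalar_mx.
  by move=> u; rewrite bform_scalar.
have [sA lA] := prior_of_H (IH (ltnW h)).
rewrite run_H_step //; split.
  rewrite linearD /= sA; congr (_ + _).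
  by apply/matrixP => i j; rewrite !mxE !big_ord1 !mxE [x _ _ _ * _]mulrC.
move=> u; rewrite bform_addmx bform_scalemx bform_outer; apply: le_trans (lA u) _.
by rewrite lerDl mulr_ge0 ?curv_ge0 // -expr2 sqr_ge0.
Qed.

Lemma run_prior t : (1 <= t <= T.+1)%N ->
  (prior t)^T = prior t /\ forall u, lam * dot u u <= bform (prior t) u u.
Proof. by move=> h; exact/prior_of_H/run_H. Qed.

Lemma run_H_spd t : (1 <= t <= T.+1)%N -> spd (H t).
Proof. by move=> /run_H[sH lH]; exact: spd_ler lH. Qed.

Lemma run_prior_spd t : (1 <= t <= T.+1)%N -> spd (prior t).
Proof. by move=> /run_prior[sH lH]; exact: spd_ler lH. Qed.

Lemma leverage_ge0 t : (1 <= t <= T.+1)%N -> 0 <= leverage t.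
Proof. by move=> h; exact/invmx_psd/run_prior_spd. Qed.

Lemma leverage_le t : (1 <= t <= T.+1)%N -> leverage t <= lam^-1.
Proof.
move=> h; have [sA lA] := run_prior h; apply: le_trans (bform_inv_le _ sA lam0 lA) _.
rewrite ler_pdivrMr // mulVf ?gt_eqF // -sqr_norm2.
have t1 : (1 <= t)%N by case/andP: h.
by rewrite expr_le1 ?norm2_ge0 //; exact: x1.
Qed.

Lemma H_leverage_le t : (1 <= t <= T.+1)%N ->
  bform (invmx (H t)) (x t) (x t) <= leverage t.
Proof.
move=> h; apply: bform_inv_mono; [exact: run_prior_spd | exact: run_H_spd | ].
move=> u; rewrite prior_form; have [_ lH] := run_H h; have /andP[c0 c1] := gam0.
have c1' : 0 <= 1 - gam by lra.
by have := ler_wpM2l c1' (lH u); lra.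
Qed.

Lemma move_sqr_ge0 t : (1 <= t <= T.+1)%N -> 0 <= move_sqr t.
Proof. by move=> h; apply: spd_psd; exact: run_prior_spd. Qed.

Lemma ln_leverage_step t : (1 <= t <= T)%N ->
  gam * (ln (\det (H t)) - d%:R * ln lam) + ln (1 + curv t * leverage t)
  <= ln (\det (H t.+1)) - d%:R * ln lam.
Proof.
move=> h; have h' : (1 <= t <= T.+1)%N by case/andP: h => -> /leqW.
have sA := run_prior_spd h'; have dA := spd_det_gt0 sA.
have q0 : 0 <= curv t * leverage t by rewrite mulr_ge0 ?curv_ge0 ?leverage_ge0.
rewrite run_H_step // det_rank1 ?spd_unit // lnM ?posrE ?ltr_pwDl //.
have /andP[c0 c1] := gam0; have c01 : 0 < gam <= 1 by rewrite c0 ltW.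
have := ln_det_concave (run_H_spd h') c01 lam0.
by rewrite -/(discounted_reg _ _ _) -/(prior t) /leverage; lra.
Qed.

Lemma dsum_ln_leverage t : (1 <= t <= T.+1)%N ->
  dsum gam (fun s => ln (1 + curv s * leverage s)) t
  <= ln (\det (H t)) - d%:R * ln lam.
Proof.
case: t => // t; elim: t => [|t IH] h.
  by rewrite dsum1 (domd_init_H run) det_scalar lnXn // mulr_natl subrr.
rewrite dsumS //; have /andP[c0 c1] := gam0.
have := ler_wpM2l (ltW c0) (IH (ltnW h)).
by have := @ln_leverage_step t.+1 h; lra.
Qed.

Lemma run_trace t : (1 <= t <= T.+1)%N ->
  \tr (H t) <= d%:R * lam + kmu / g * ((1 - gam ^+ t.-1) / (1 - gam)).
Proof.
have /andP[c0 c1] := gam0; have c1' : 0 < 1 - gam by rewrite subr_gt0.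
case: t => // t; elim: t => [|t IH] h.
  rewrite (domd_init_H run) mxtrace_scalar expr0 subrr mul0r mulr0 addr0.
  by rewrite mulr_natl.
rewrite run_H_step // mxtraceD mxtraceD !mxtraceZ mxtrace_scalar.
have trx : \tr (x t.+1 *m (x t.+1)^T) <= 1.
  rewrite mxtrace_mulC [(_ ^T *m _)]mx11_scalar mxtrace_scalar mulr1n -/(dot _ _).
  by rewrite -sqr_norm2 expr_le1 ?norm2_ge0 //; exact: x1.
have ck : curv t.+1 <= kmu / g.
  rewrite ler_pM2r ?invr_gt0 //; apply: f2k; apply: ball2_dot; first exact: x1.
  by apply: run_theta_ball; rewrite ltnS h.
have h1 : curv t.+1 * \tr (x t.+1 *m (x t.+1)^T) <= kmu / g.
  by apply: le_trans ck; rewrite ler_piMr ?curv_ge0.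
have h2 := ler_wpM2l (ltW c0) (IH (ltnW h)).
apply: le_trans (lerD (lerD h2 (lexx _)) h1) _.
rewrite /= exprS -mulr_natl le_eqVlt; apply/orP; left; apply/eqP; field.
by rewrite !gt_eqF.
Qed.

Lemma ln_det_run t : (1 <= d)%N -> 0 <= kmu -> (1 <= t <= T.+1)%N ->
  ln (\det (H t)) - d%:R * ln lam
  <= d%:R * ln (1 + kmu * (1 - gam ^+ t.-1) / (lam * d%:R * g * (1 - gam))).
Proof.
move=> d1 k0 h; have /andP[c0 c1] := gam0.
have c1' : 0 < 1 - gam by rewrite subr_gt0.
have d0 : 0 < d%:R :> K by rewrite ltr0n.
set q := kmu * _ / _.
have q0 : 0 <= q.
  rewrite /q divr_ge0 ?mulr_ge0 ?(ltW lam0) ?(ltW g0) ?(ltW d0) ?(ltW c1') //.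
  by rewrite subr_ge0 exprn_ile1 // ltW.
have trE : \tr (H t) <= d%:R * (lam * (1 + q)).
  apply: le_trans (run_trace h) _; rewrite le_eqVlt; apply/orP; left; apply/eqP.
  by rewrite /q; field; rewrite !gt_eqF.
have := ln_det_le_ln_tr (run_H_spd h) d1 trE.
by rewrite lnM ?posrE ?ltr_pwDl //; lra.
Qed.

Lemma run_dist_step t u : (1 <= t <= T)%N -> ball2 S u ->
  bform (H t.+1) (theta t.+1 - u) (theta t.+1 - u)
  <= gam * bform (H t) (theta t - u) (theta t - u) + (1 - gam) * (4 * lam * S ^+ 2)
     + 2 * eta * (glb_loss g m (x t) (r t) u - glb_loss g m (x t) (r t) (theta t.+1)
                  - move_sqr t / (3 * eta)).
Proof.
move=> h uS; have h' : (1 <= t <= T.+1)%N by case/andP: h => -> /leqW.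
have t1 : (1 <= t)%N by case/andP: h.
have [sA lA] := run_prior h'.
have := mirror_step_bound R0 S0 g0 sc f2k etaE sA lam0 lA (x1 t1)
  (run_theta_ball h') (domd_update_theta run h) uS lam_ge.
rewrite run_H_step // bform_addmx bform_scalemx bform_outer -expr2.
move/le_trans; apply; rewrite prior_form -/(move_sqr t).
have /andP[c0 c1] := gam0; have c1' : 0 <= (1 - gam) * lam by rewrite mulr_ge0 ?(ltW lam0) //; lra.
have := ler_wpM2l c1' (ball2_dist (run_theta_ball h') uS).
have -> : 2 * eta * (glb_loss g m (x t) (r t) u - glb_loss g m (x t) (r t) (theta t.+1)
                  - move_sqr t / (3 * eta))
  = 2 * eta * (glb_loss g m (x t) (r t) u - glb_loss g m (x t) (r t) (theta t.+1))
    - 2 / 3 * move_sqr t by field; rewrite gt_eqF // (lt_le_trans ltr01).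
by lra.
Qed.

Lemma run_dist t u : (1 <= t <= T.+1)%N -> ball2 S u ->
  bform (H t) (theta t - u) (theta t - u)
  <= 4 * lam * S ^+ 2 + 2 * eta * dsum gam (fun s =>
       glb_loss g m (x s) (r s) u - glb_loss g m (x s) (r s) (theta s.+1)
       - move_sqr s / (3 * eta)) t.
Proof.
case: t => // t; elim: t => [|t IH] h uS.
  rewrite dsum1 mulr0 addr0 (domd_init_H run) bform_scalar -mulrA mulrCA.
  rewrite ler_pM2l //; apply: ball2_dist => //; exact: run_theta_ball.
apply: le_trans (run_dist_step _ uS) _ => //; rewrite dsumS //.
have /andP[c0 c1] := gam0; have := ler_wpM2l (ltW c0) (IH (ltnW h) uS).
by set B := dsum _ _ _; lra.
Qed.

End Trajectory.

(** * Measurability of the run *)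

Section MeasurableMatrices.
Context {K : realType} {disp : measure_display} {Om : measurableType disp}.

Definition mx_measurable (n p : nat) (M : Om -> 'M[K]_(n, p)) : Prop :=
  forall i j, measurable_fun setT (fun w => M w i j).

Lemma measurable_dot n (u v : Om -> 'cV[K]_n) : vec_measurable u ->
  vec_measurable v -> measurable_fun setT (fun w => dot (u w) (v w)).
Proof.
move=> mu mv; under eq_fun do rewrite dotE.
by apply: measurable_sum => i; apply: measurable_funM; [exact: mu | exact: mv].
Qed.

Lemma measurable_bform n (M : Om -> 'M[K]_n) u v : mx_measurable M ->
  vec_measurable u -> vec_measurable v ->
  measurable_fun setT (fun w => bform (M w) (u w) (v w)).
Proof.
move=> mM mu mv; rewrite /bform; under eq_fun do rewrite mxE.
apply: measurable_sum => j; apply: measurable_funM; last exact: mv.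
under eq_fun do rewrite mxE.
apply: measurable_sum => i; apply: measurable_funM; last exact: mM.
by under eq_fun do rewrite mxE; exact: mu.
Qed.

Lemma measurable_det n (M : Om -> 'M[K]_n) : mx_measurable M ->
  measurable_fun setT (fun w => \det (M w)).
Proof.
move=> mM; rewrite /determinant; apply: measurable_sum => s.
by apply: measurable_funM => //; apply: measurable_prod => i _; exact: mM.
Qed.

Lemma measurable_inv_pos (f : Om -> K) : (forall w, 0 < f w) ->
  measurable_fun setT f -> measurable_fun setT (fun w => (f w)^-1).
Proof.
move=> f0 mf.
rewrite (_ : (fun w => _) = (fun w => f w `^ (-1))).
  exact: (measurableT_comp (measurable_powR (-1))).
by apply/funext => w; rewrite powR_inv1 // ltW.
Qed.

End MeasurableMatrices.

Section History.
Context {K : realType} {disp : measure_display} {Omega : measurableType disp}.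
Variables (d : nat) (thstar x : nat -> Omega -> 'cV[K]_d) (r : nat -> Omega -> K).

Definition history_gens (t : nat) : set (set Omega) :=
  \bigcup_(s in [set s | (1 <= s <= t)%N]) vec_preimages (x s)
  `|` \bigcup_(s in [set s | (1 <= s < t)%N]) preimages (r s)
  `|` \bigcup_(s in [set s | (1 <= s)%N]) vec_preimages (thstar s).

Local Notation X t := (g_sigma_algebraType (history_gens t)).

Lemma history_gens_mono t : history_gens t `<=` <<s history_gens t.+1 >>.
Proof.
move=> A hA; apply: sub_sigma_algebra.
move: hA => [[[s /= /andP[s1 st] h]|[s /= /andP[s1 st] h]]|h].
- by left; left; exists s => //=; rewrite s1 leqW.
- by left; right; exists s => //=; rewrite s1 ltnW.
- by right.
Qed.

Lemma history_measurable_x s t : (1 <= s <= t)%N ->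
  @vec_measurable K _ (X t) d (x s).
Proof.
move=> st i _ B mB; apply: sub_sigma_algebra; left; left; exists s => //.
by exists i => //; exists B.
Qed.

Lemma history_measurable_r s t : (1 <= s < t)%N ->
  measurable_fun (setT : set (X t)) (r s).
Proof.
by move=> st _ B mB; apply: sub_sigma_algebra; left; right; exists s => //; exists B.
Qed.

Lemma history_measurable_thstar s t : (1 <= s)%N ->
  @vec_measurable K _ (X t) d (thstar s).
Proof.
move=> s1 i _ B mB; apply: sub_sigma_algebra; right; exists s => //.
by exists i => //; exists B.
Qed.

Lemma history_gens_measurable t :
  (forall s, (1 <= s)%N -> vec_measurable (thstar s)) ->
  (forall s, (1 <= s)%N -> vec_measurable (x s)) ->
  (forall s, (1 <= s)%N -> measurable_fun setT (r s)) ->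
  history_gens t `<=` measurable.
Proof.
move=> mt mx mr A.
move=> [[[s /= /andP[s1 st] [i _ [B mB <-]]]|[s /= /andP[s1 st] [B mB <-]]]|[s /= s1 [i _ [B mB <-]]]].
- exact: mx.
- exact: mr.
- exact: mt.
Qed.

Variables (R S g kmu : K) (m f1 f2 f3 : K -> K) (eta lam delta : K) (T : nat).
Variables (gam : Omega -> K) (theta1 : 'cV[K]_d) (arms : nat -> Omega -> set 'cV[K]_d).
Variables (theta : nat -> Omega -> 'cV[K]_d) (H : nat -> Omega -> 'M[K]_d).
Hypotheses (R0 : 0 < R) (S0 : 0 < S) (g0 : 0 < g).
Hypothesis sc : self_concordant R m f1 f2 f3.
Hypothesis etaE : eta = 1 + R * S.
Hypotheses (gam0 : forall w, 0 < gam w < 1) (lam0 : 0 < lam).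
Hypothesis mgam : forall t, measurable_fun (setT : set (X t)) gam.
Hypothesis run : forall w, domd_glb_run R S g kmu m (gam w) lam eta delta T theta1
  (arms ^~ w) (x ^~ w) (r ^~ w) (theta ^~ w) (H ^~ w).
Hypothesis theta1S : ball2 S theta1.
Hypothesis x1 : forall t w, (1 <= t)%N -> ball2 1 (x t w).

Let mderiv (f df : K -> K) : (forall z : K, is_derive z 1 f (df z)) ->
  measurable_fun setT f.
Proof.
move=> h; apply: continuous_measurable_fun => z; apply: differentiable_continuous.
by apply/derivable1_diffP; case: (h z).
Qed.

Let mm : measurable_fun setT m. Proof. by case: sc => h _ _ _; exact: mderiv h. Qed.
Let mf1 : measurable_fun setT f1. Proof. by case: sc => _ h _ _; exact: mderiv h. Qed.
Let mf2 : measurable_fun setT f2. Proof. by case: sc => _ _ h _; exact: mderiv h. Qed.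

Let lift s (f : Omega -> K) : measurable_fun (setT : set (X s)) f ->
  measurable_fun (setT : set (X s.+1)) f.
Proof. by apply: measurable_sigma_mono; exact: history_gens_mono. Qed.

Lemma measurable_prior t : @mx_measurable K _ (X t) d d (H t) ->
  @mx_measurable K _ (X t) d d (fun w => prior (gam w) lam (H ^~ w) t).
Proof.
move=> mH i j; rewrite /prior /discounted_reg; under eq_fun do rewrite !mxE.
apply: measurable_funD; first by apply: measurable_funM; [exact: mgam | exact: mH].
have m1 : measurable_fun (setT : set (X t)) (fun w => (1 - gam w) * lam).
  by apply: measurable_funM => //; apply: measurable_funB => //; exact: mgam.
by case: (i == j) => /=; [exact: m1 | exact: measurable_cst].
Qed.

Lemma measurable_run t : (1 <= t <= T.+1)%N ->
  @vec_measurable K _ (X t) d (theta t) /\ @mx_measurable K _ (X t) d d (H t).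
Proof.
case: t => // t; elim: t => [|t IH] h.
  split=> [i|i j].
    rewrite (_ : (fun w => _) = cst (theta1 i 0)); first exact: measurable_cst.
    by apply/funext => w; have := domd_init_theta (run w) => /= ->.
  rewrite (_ : (fun w => _) = cst ((lam%:M : 'M[K]_d) i j)); first exact: measurable_cst.
  by apply/funext => w; have := domd_init_H (run w) => /= ->.
have [mth mH] := IH (ltnW h).
have hT : (1 <= t.+1 <= T)%N by [].
have hT' : (1 <= t.+1 <= T.+1)%N by exact: ltnW.
have mx : @vec_measurable K _ (X t.+2) d (x t.+1).
  by apply: history_measurable_x; rewrite /= leqnSn.
have mr : measurable_fun (setT : set (X t.+2)) (r t.+1).
  by apply: history_measurable_r; rewrite /= leqnn.
have mA : @mx_measurable K _ (X t.+2) d d (fun w => prior (gam w) lam (H ^~ w) t.+1).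
  by move=> i j; apply: lift; exact: measurable_prior.
have mth2 : @vec_measurable K _ (X t.+2) d (theta t.+1).
  by move=> i; apply: lift; exact: mth.
pose obj w u := quad_loss (glb_loss g m (x t.+1 w) (r t.+1 w)) (theta t.+1 w) u
  + (2 * eta)^-1 * wnorm (prior (gam w) lam (H ^~ w) t.+1) (u - theta t.+1 w) ^+ 2.
have pri w := run_prior R0 g0 sc (gam0 w) (run w) hT'.
have eta0 : 0 < eta by rewrite etaE ltr_pwDl // mulr_ge0 // ltW.
have mth3 : @vec_measurable K _ (X t.+2) d (theta t.+2).
  apply: (@measurable_argmin K _ (X t.+2) d S (lam / (2 * eta)) obj (theta t.+2) S0).
  - by rewrite divr_gt0 ?mulr_gt0.
  - move=> u.
    have -> : obj ^~ u = fun w => glb_loss g m (x t.+1 w) (r t.+1 w) (theta t.+1 w)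
      + (f1 (dot (x t.+1 w) (theta t.+1 w)) - r t.+1 w) / g
        * dot (x t.+1 w) (u - theta t.+1 w)
      + 2^-1 * (f2 (dot (x t.+1 w) (theta t.+1 w)) / g
        * dot (x t.+1 w) (u - theta t.+1 w) ^+ 2)
      + (2 * eta)^-1 * bform (prior (gam w) lam (H ^~ w) t.+1)
          (u - theta t.+1 w) (u - theta t.+1 w).
      apply/funext => w; have [_ lA] := pri w.
      exact: (mirror_objE eta R0 g0 sc lam0 lA).
    have mz : measurable_fun (setT : set (X t.+2))
        (fun w => dot (x t.+1 w) (theta t.+1 w)).
      exact: (@measurable_dot K _ (X t.+2)).
    have mu : @vec_measurable K _ (X t.+2) d (fun w => u - theta t.+1 w).
      move=> i; under eq_fun do rewrite !mxE.
      by apply: measurable_funB => //; exact: mth2.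
    have mzu : measurable_fun (setT : set (X t.+2))
        (fun w => dot (x t.+1 w) (u - theta t.+1 w)).
      exact: (@measurable_dot K _ (X t.+2)).
    apply: measurable_funD; first apply: measurable_funD; first apply: measurable_funD.
    + rewrite /glb_loss; apply: measurable_funM => //; apply: measurable_funB.
        exact: measurableT_comp mm _.
      exact: measurable_funM.
    + apply: measurable_funM => //; apply: measurable_funM => //.
      by apply: measurable_funB => //; exact: measurableT_comp mf1 _.
    + apply: measurable_funM => //; apply: measurable_funM.
        by apply: measurable_funM => //; exact: measurableT_comp mf2 _.
      exact: measurable_funX.
    + by apply: measurable_funM => //; exact: (@measurable_bform K _ (X t.+2)).
  - by move=> w; apply: (run_theta_ball (run w)).
  - move=> w u uS; have [sA lA] := pri w.
    exact: (mirror_argmin_gap R0 S0 g0 sc etaE sA lam0 lA (domd_update_theta (run w) hT) uS).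
  - move=> w; have [sA lA] := pri w.
    exact: (mirror_obj_upper R0 S0 g0 sc etaE sA lam0 lA (theta t.+1 w) (theta t.+2 w)
      (r t.+1 w) (x1 w (ltn0Sn t))).
split=> // i j.
rewrite (_ : (fun w => _) = (fun w => prior (gam w) lam (H ^~ w) t.+1 i j
  + f2 (dot (x t.+1 w) (theta t.+2 w)) / g * (x t.+1 w i 0 * x t.+1 w j 0))); last first.
  apply/funext => w; have := run_H_step sc (run w) hT => /= ->.
  by rewrite !mxE big_ord1 mxE.
apply: measurable_funD; first exact: mA.
apply: measurable_funM.
  apply: measurable_funM => //; apply: measurableT_comp mf2 _.
  exact: (@measurable_dot K _ (X t.+2)).
by apply: measurable_funM; exact: mx.
Qed.

Lemma measurable_leverage t : (1 <= t <= T.+1)%N ->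
  measurable_fun (setT : set (X t)) (fun w => leverage (gam w) lam (x ^~ w) (H ^~ w) t).
Proof.
move=> h; have [_ mH] := measurable_run h.
have mA := measurable_prior mH.
have mx : @vec_measurable K _ (X t) d (x t).
  by apply: history_measurable_x; case/andP: h => ->; rewrite leqnn.
have pri w := run_prior_spd R0 g0 sc (gam0 w) lam0 (run w) h.
rewrite (_ : (fun w => _) = (fun w =>
  \det (prior (gam w) lam (H ^~ w) t + x t w *m (x t w)^T)
  * (\det (prior (gam w) lam (H ^~ w) t))^-1 - 1)); last first.
  apply/funext => w; have := det_rank1 1 (x t w) (spd_unit (pri w)).
  rewrite scale1r mul1r => ->; have d0 := spd_det_gt0 (pri w).
  by rewrite mulrAC mulfV ?gt_eqF // mul1r addrC addKr.
apply: measurable_funB => //; apply: measurable_funM.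
  apply: (@measurable_det K _ (X t)) => i j; under eq_fun do rewrite !mxE big_ord1 mxE.
  apply: measurable_funD; last by apply: measurable_funM; exact: mx.
  by have := mA i j; under eq_fun do rewrite !mxE.
apply: (@measurable_inv_pos K _ (X t)); first by move=> w; exact/spd_det_gt0/pri.
exact: (@measurable_det K _ (X t)).
Qed.

End History.

(** * The good event *)

Section Numerics.
Context {K : realType}.

Lemma pi_sqr_ge8 : 8 <= pi ^+ 2 :> K.
Proof.
have s1 (y : K) : 0 <= y -> sin y <= y.
  move=> y0; pose f t : K := t - sin t; pose df t : K := 1 - cos t.
  suff : f 0 <= f y by rewrite /f sin0 subrr subr_ge0.
  by apply: (@derive_ge0_le K f df) => // t _; rewrite /df subr_ge0 cos_le1.
have c1 (y : K) : 0 <= y -> 1 - y ^+ 2 / 2 <= cos y.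
  move=> y0; pose f t : K := cos t + t ^+ 2 / 2; pose df t : K := t - sin t.
  suff : f 0 <= f y by rewrite /f cos0 expr0n /= mul0r addr0; lra.
  apply: (@derive_ge0_le K f df) => // t; last by move=> t0; rewrite /df subr_ge0 s1.
  by apply: is_derive_eq; rewrite /df /GRing.scale /=; field.
have /andP[h0 _] := @pihalf_02 K.
have := c1 _ (ltW h0); rewrite cos_pihalf => h.
by have -> : pi ^+ 2 = 4 * (pi / 2) ^+ 2 :> K; [field | lra].
Qed.

Lemma sum_inv_sqr_le2 n : \sum_(1 <= t < n.+1) (t%:R ^+ 2)^-1 <= 2 :> K.
Proof.
case: n => [|n]; first by rewrite big_nil.
suff : \sum_(1 <= t < n.+2) (t%:R ^+ 2)^-1 <= 2 - n.+1%:R^-1 :> K.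
  by move/le_trans; apply; rewrite gerBl invr_ge0.
elim: n => [|n IH]; first by rewrite big_nat1 expr1n invr1; lra.
rewrite big_nat_recr //=; apply: le_trans (lerD IH (lexx _)) _.
have n1 : 0 < n.+1%:R :> K by rewrite ltr0n.
rewrite -(natr1 n.+1); set y := n.+1%:R in n1 *.
have y1 : 0 < y + 1 by lra.
rewrite -addrA lerD2l -subr_ge0.
have -> : - (y + 1)^-1 - (- y^-1 + ((y + 1) ^+ 2)^-1) = (y * (y + 1) ^+ 2)^-1.
  by field; rewrite !gt_eqF.
by rewrite invr_ge0 mulr_ge0 ?sqr_ge0 // ltW.
Qed.

End Numerics.

Section MixtureRatio.
Context {K : realType}.
Local Notation leb := (@lebesgue_measure K).

Lemma mixture_ratio_ge (R g : K) (m f1 f2 f3 : K -> K)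
    (r z z0 zh sg q eta E : K) :
  0 < R -> 0 < g -> self_concordant R m f1 f2 f3 -> 0 < f2 zh ->
  0 <= sg -> sg ^+ 2 = 3 * eta / 2 * q -> 0 <= q -> 1 <= eta ->
  (R * sg) ^+ 2 <= 2^-1 ->
  (zh - z0) ^+ 2 <= 2 * sg ^+ 2 * E -> 0 <= E ->
  ((expR ((m z - r * z) / g - (m zh - r * zh) / g - E
          - (3 * eta + 2^-1) * ln (1 + f2 zh / g * q)))%:E
   <= mixture_ratio g m z0 sg z r)%E.
Proof.
move=> R0 g0 sc c0 sg0 sgE q0 eta1 Rsg hE E0.
have := gaussian_mixture_ge r R0 g0 sc c0 sg0 sgE q0 eta1 Rsg hE E0.
set a := (_ - _ * ln _) => h.
have -> : (m z - r * z) / g - (m zh - r * zh) / g - E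
    - (3 * eta + 2^-1) * ln (1 + f2 zh / g * q) = (m z - r * z) / g + a.
  by rewrite /a; ring.
rewrite expRD EFinM.
have mm : measurable_fun setT m.
  apply: continuous_measurable_fun => x; apply: differentiable_continuous.
  by apply/derivable1_diffP; case: sc => d1 _ _ _; case: (d1 x).
have mz : measurable_fun setT (fun u : K => z0 + sg * u).
  by apply: measurable_funD => //; apply: measurable_funM.
have -> : mixture_ratio g m z0 sg z r = ((expR ((m z - r * z) / g))%:E *
    \int[leb]_u (normal_pdf 0 1 u
        * expR ((r * (z0 + sg * u) - m (z0 + sg * u)) / g))%:E)%E.
  rewrite -ge0_integralZl //=; last 2 first.
  - apply/measurable_EFinP; apply: measurable_funM; first exact: measurable_normal_pdf.
    apply: measurableT_comp => //; apply: measurable_funM => //; apply: measurable_funB.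
      by apply: measurable_funM.
    exact: measurableT_comp.
  - by move=> u _; rewrite lee_fin mulr_ge0 ?normal_pdf_ge0 ?expR_ge0.
  apply: eq_integral => u _; rewrite -EFinM; congr (_%:E).
  rewrite mulrCA -expRD; congr (_ * expR _); ring.
by rewrite lee_pmul2l // ?lte_fin ?expR_gt0.
Qed.

End MixtureRatio.

Section GoodEvent.
Context {K : realType} {disp : measure_display} {Omega : measurableType disp}.
Variables (P : probability Omega K) (d : nat).

Lemma good_event_union (good : nat -> Omega -> Prop) (dl : nat -> K) (n : nat) :
  (forall t, (1 <= t <= n)%N -> exists E : set Omega,
     [/\ measurable E, (P E <= (dl t)%:E)%E & forall w, ~ E w -> good t w]) ->
  exists E : set Omega,
    [/\ measurable E, (P E <= (\sum_(1 <= t < n.+1) dl t)%:E)%E &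
      forall w, ~ E w -> forall t, (1 <= t <= n)%N -> good t w].
Proof.
elim: n => [|n IH] h.
  exists set0; split => //; first by rewrite measure0 big_nil.
  by move=> w _ [].
have [|E [mE PE gE]] := IH.
  by move=> t /andP[t1 tn]; apply: h; rewrite t1 leqW.
have [|E' [mE' PE' gE']] := h n.+1; first by rewrite leqnn.
exists (E `|` E'); split.
- exact: measurableU.
- rewrite big_nat_recr //= EFinD; apply: le_trans (measureU2 P mE mE') _.
  exact: leeD.
- move=> w /not_orP[Ew E'w] t /andP[t1]; rewrite leq_eqVlt => /predU1P[->|tn].
    exact: gE'.
  by apply: gE => //; rewrite t1.
Qed.

Variables (R S g kmu cmu : K) (m h : K -> K)
  (nu : {measure set (measurableTypeR K) -> \bar K})
  (arms : nat -> Omega -> set 'cV[K]_d)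
  (thstar x : nat -> Omega -> 'cV[K]_d) (r : nat -> Omega -> K)
  (theta1 : 'cV[K]_d) (theta : nat -> Omega -> 'cV[K]_d)
  (H : nat -> Omega -> 'M[K]_d) (eta lam delta : K) (T : nat) (gam : Omega -> K).
Local Notation f1 := m^`()%classic.
Local Notation f2 := m^`(2)%classic.
Hypotheses (d0 : (1 <= d)%N) (R0 : 0 < R) (S0 : 0 < S) (g0 : 0 < g) (cmu0 : 0 < cmu).
Hypothesis delta01 : 0 < delta < 1.
Hypothesis model : glm_model R S g kmu cmu m h nu.
Hypothesis env : glb_environment P R S g m h nu arms thstar x r.
Hypothesis etaE : eta = 1 + R * S.
Hypotheses (gam0 : forall w, 0 < gam w < 1) (lam0 : 0 < lam).
Hypothesis lam_ge : 3 * eta * R ^+ 2 <= lam.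
Hypothesis mgam : forall t,
  measurable_fun (setT : set (g_sigma_algebraType (history_gens thstar x r t))) gam.
Hypothesis run : forall w, domd_glb_run R S g kmu m (gam w) lam eta delta T theta1
  (arms ^~ w) (x ^~ w) (r ^~ w) (theta ^~ w) (H ^~ w).
Hypothesis theta1S : ball2 S theta1.

Definition gain (w : Omega) (s : nat) : K :=
  glb_loss g m (x s w) (r s w) (thstar s w)
  - glb_loss g m (x s w) (r s w) (theta s.+1 w)
  - move_sqr (gam w) lam (theta ^~ w) (H ^~ w) s / (3 * eta)
  - (3 * eta + 2^-1) * ln (1 + curv g f2 (x ^~ w) (theta ^~ w) s
                               * leverage (gam w) lam (x ^~ w) (H ^~ w) s).

Definition good_round (t : nat) (w : Omega) : Prop :=
  0 <= r t w <= R /\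
  dsum (gam w) (gain w) t <= ln (pi ^+ 2 * t%:R ^+ 2 / (3 * delta)).

Lemma good_round_whp t : (1 <= t <= T)%N -> exists E : set Omega,
  [/\ measurable E, (P E <= (3 * delta / (pi ^+ 2 * t%:R ^+ 2))%:E)%E
    & forall w, ~ E w -> good_round t w].
Proof.
move=> tT; have t1 : (1 <= t)%N by case/andP: tT.
have sc := class_C3_self_concordant (glm_C3 model) (glm_self_concordant model).
have /andP[de0 de1] := delta01.
have x1 s w : (1 <= s)%N -> ball2 1 (x s w).
  by move=> s1; exact: (glb_arms_bound env s1 (glb_action env w s1)).
have mm : measurable_fun setT m.
  apply: continuous_measurable_fun => z; apply: differentiable_continuous.
  by apply/derivable1_diffP; case: sc => d1 _ _ _; case: (d1 z).
have eta1 : 1 <= eta by rewrite etaE lerDl mulr_ge0 // ltW.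
have tn0 : 0 < t%:R :> K by rewrite ltr0n.
have sub s : (1 <= s <= t.-1)%N -> (1 <= s <= T.+1)%N.
  case/andP=> -> st; rewrite /= ltnW // ltnS (leq_trans st) //.
  by rewrite (leq_trans (leq_pred _)) //; case/andP: tT.
have subT s : (1 <= s <= t.-1)%N -> (1 <= s <= T)%N.
  case/andP=> -> st; rewrite /= (leq_trans st) //.
  by rewrite (leq_trans (leq_pred _)) //; case/andP: tT.
pose dl := 3 * delta / (pi ^+ 2 * t%:R ^+ 2).
have dl0 : 0 < dl by rewrite divr_gt0 ?mulr_gt0 ?exprn_gt0 ?pi_gt0.
pose lev s w := leverage (gam w) lam (x ^~ w) (H ^~ w) s.
have mth s : (1 <= s <= T.+1)%N ->
    @vec_measurable K _ (g_sigma_algebraType (history_gens thstar x r s)) d (theta s).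
  move=> hs.
  by have [] := measurable_run R0 S0 g0 sc etaE gam0 lam0 mgam run theta1S x1 hs.
have [||s hs|s hs|s w hs|s hs||E [mE PE hE]] := @mixture_tail K disp Omega P g m h nu mm (glm_base_measurable model)
  (glm_normalized model) (history_gens thstar x r) r
  (fun s w => dot (x s w) (thstar s w)) (fun s w => dot (x s w) (theta s w))
  (fun s w => Num.sqrt (3 * eta / 2 * lev s w))
  (fun s w => gam w ^+ (t.-1 - s)) t.-1 dl.
- move=> s; apply: history_gens_measurable.
  + exact: (glb_param_measurable env).
  + exact: (glb_action_measurable env).
  + exact: (glb_reward_measurable env).
- by move=> s; exact: history_gens_mono.
- by apply: history_measurable_r; case/andP: hs => -> _ /=.
- have s1 : (1 <= s)%N by case/andP: hs.
  have mx := @history_measurable_x K disp Omega d thstar x r s s.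
  rewrite s1 leqnn in mx; have {}mx := mx isT.
  split.
  + apply: (@measurable_dot K _ (g_sigma_algebraType (history_gens thstar x r s)) d).
      exact: mx.
    exact: history_measurable_thstar.
  + apply: (@measurable_dot K _ (g_sigma_algebraType (history_gens thstar x r s)) d).
      exact: mx.
    exact: mth (sub _ hs).
  + apply: measurableT_comp.
      by apply: continuous_measurable_fun; exact: sqrt_continuous.
    apply: measurable_funM => //.
    exact: (measurable_leverage R0 S0 g0 sc etaE gam0 lam0 mgam run theta1S x1 (sub _ hs)).
  + by apply: measurable_funX; exact: mgam.
- have /andP[c0 c1] := gam0 w.
  by rewrite exprn_ge0 ?(ltW c0) //= exprn_ile1 // ltW.
- by have s1 : (1 <= s)%N by [case/andP: hs]; exact: (glb_reward_law env s1).
- exact: dl0.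
have [N [mN PN hN]] := glb_reward_bound env t1.
exists (E `|` N); split.
- exact: measurableU.
- have PEN : (P E + P N <= dl%:E)%E.
    by have -> : P N = 0%E by [exact: PN]; rewrite adde0.
  exact: le_trans (measureU2 P mE mN) PEN.
move=> w /not_orP[Ew Nw]; split.
  by apply: contrapT => h1; apply: Nw; exact: hN.
have -> : ln (pi ^+ 2 * t%:R ^+ 2 / (3 * delta)) = - ln dl.
  by rewrite -lnV ?posrE // /dl invf_div.
have := hE w Ew (gain w); rewrite prednK //; apply => s hs.
have hs' := sub _ hs; have s1 : (1 <= s)%N by case/andP: hs.
have l0 : 0 <= lev s w by exact: (leverage_ge0 R0 g0 sc (gam0 w) lam0 (run w) hs').
have ll := leverage_le R0 g0 sc (gam0 w) lam0 (run w) (fun s => x1 s w) hs'.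
rewrite -/(lev s w) in ll.
have e3 : 0 < 3 * eta by rewrite mulr_gt0 // (lt_le_trans ltr01).
have tb : ball2 S (theta s.+1 w).
  by apply: (run_theta_ball (run w)) => //; have := subT _ hs; case/andP.
have fpos : 0 < f2 (dot (x s w) (theta s.+1 w)).
  have hz := ball2_dot (x1 _ w s1) tb.
  by case/andP: (glm_link_bounds model hz) => h1 _; exact: lt_le_trans h1.
have sgE : Num.sqrt (3 * eta / 2 * lev s w) ^+ 2 = 3 * eta / 2 * lev s w.
  by rewrite sqr_sqrtr // mulr_ge0 // divr_ge0 // ltW.
have mv0 := move_sqr_ge0 R0 g0 sc (gam0 w) lam0 (run w) hs'.
apply: (mixture_ratio_ge _ _ R0 g0 sc fpos (sqrtr_ge0 _) sgE l0 eta1).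
- rewrite exprMn sgE.
  have h1 : lev s w * lam <= 1.
    by have := ler_wpM2r (ltW lam0) ll; rewrite mulVf // gt_eqF.
  have h2 := ler_wpM2l l0 lam_ge.
  by set l := lev s w in h1 h2 *; lra.
- rewrite sgE -dotBr.
  apply: le_trans (dot_cs_inv _ _ (run_prior_spd R0 g0 sc (gam0 w) lam0 (run w) hs')) _.
  set mv := move_sqr _ _ _ _ _.
  have -> : 2 * (3 * eta / 2 * lev s w) * (mv / (3 * eta)) = lev s w * mv.
    by field; rewrite gt_eqF // (lt_le_trans ltr01).
  exact: lexx.
- by rewrite divr_ge0 // ltW.
Qed.

Lemma good_event : with_prob_ge P (1 - delta)
  (fun w => forall t, (1 <= t <= T)%N -> good_round t w).
Proof.
have [E [mE PE hE]] := good_event_union good_round_whp.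
exists (~` E); split.
- exact: measurableC.
- rewrite probability_setC // EFinB leeB //; apply: le_trans PE _; rewrite lee_fin.
  have /andP[de0 de1] := delta01.
  have p8 := pi_sqr_ge8 (K := K).
  have p0 : 0 < pi ^+ 2 :> K by lra.
  apply: (@le_trans _ _ (3 * delta / pi ^+ 2 * \sum_(1 <= t < T.+1) (t%:R ^+ 2)^-1)).
    rewrite mulr_sumr; apply: ler_sum => t _.
    by rewrite invfM mulrA.
  have q0 : 0 <= 3 * delta / pi ^+ 2.
    by apply: divr_ge0; [apply: mulr_ge0 => //; exact: ltW | exact: ltW].
  apply: le_trans (ler_wpM2l q0 (sum_inv_sqr_le2 T)) _.
  rewrite mulrAC ler_pdivrMr //.
  by have := ler_wpM2l (ltW de0) p8; lra.
- by move=> w Ew t tT; apply: hE.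
Qed.

End GoodEvent.

Section MeanBounded.
Context {K : realType} {disp : measure_display} {Omega : measurableType disp}.
Variables (P : probability Omega K) (d : nat).
Variables (R S g kmu cmu : K) (m h : K -> K)
  (nu : {measure set (measurableTypeR K) -> \bar K})
  (arms : nat -> Omega -> set 'cV[K]_d)
  (thstar x : nat -> Omega -> 'cV[K]_d) (r : nat -> Omega -> K).
Local Notation f1 := m^`()%classic.
Hypotheses (R0 : 0 < R) (S0 : 0 < S) (g0 : 0 < g).
Hypothesis model : glm_model R S g kmu cmu m h nu.
Hypothesis env : glb_environment P R S g m h nu arms thstar x r.

Let z w := dot (x 1%N w) (thstar 1%N w).

Let t1 : (1 <= 1)%N. Proof. by []. Qed.

Let sc : self_concordant R m f1 m^`(2)%classic m^`(3)%classic.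
Proof. exact: class_C3_self_concordant (glm_C3 model) (glm_self_concordant model). Qed.

Let mm : measurable_fun setT m.
Proof.
apply: continuous_measurable_fun => y; apply: differentiable_continuous.
by apply/derivable1_diffP; case: sc => d1 _ _ _; case: (d1 y).
Qed.

(* The density at [z + c] integrates to one: tilting the law of the reward by
   [c = 1, -1] bounds the slopes of [m] in terms of the range of the rewards. *)
Let shift_mean (c : K) :
  (\int[P]_w (expR ((r 1%N w * c - (m (z w + c) - m (z w))) / g))%:E = 1)%E.
Proof.
pose G := history_gens thstar x r 1.
pose X := g_sigma_algebraType G; pose Y := measurableTypeR K.
have hG : G `<=` measurable.
  apply: history_gens_measurable.
  - exact: (glb_param_measurable env).
  - exact: (glb_action_measurable env).
  - exact: (glb_reward_measurable env).
have mz : measurable_fun (setT : set X) z.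
  apply: (@measurable_dot K _ X d).
    by apply: history_measurable_x.
  exact: history_measurable_thstar.
pose f (p : X * Y) : \bar K :=
  (expR ((p.2 * c - (m (z p.1 + c) - m (z p.1))) / g))%:E.
have mz1 : measurable_fun setT (fun p : X * Y => z p.1) by exact: measurableT_comp.
have m2 : measurable_fun setT (fun p : X * Y => p.2) by exact: measurable_snd.
have mf : measurable_fun setT f.
  apply/measurable_EFinP; apply: measurableT_comp => //; apply: measurable_funM => //.
  apply: measurable_funB; first by apply: measurable_funM.
  apply: measurable_funB; last exact: measurableT_comp mm _.
  by apply: measurableT_comp mm _; apply: measurable_funD.
have f0 p : (0 <= f p)%E by rewrite lee_fin expR_ge0.
have := cond_density_integral hG mm (glm_base_measurable model) (glm_normalized model)
  (glb_reward_measurable env t1) mz (glb_reward_law env t1) mf f0.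
rewrite /f /= => ->.
rewrite (eq_integral (cst 1%E)); last first.
  move=> w _; rewrite -[RHS](glm_normalized model (z w + c)).
  apply: eq_integral => y _; rewrite -EFinM /glm_density -expRD.
  by congr ((expR _)%:E); ring.
by rewrite integral_cst // mul1e; exact: probability_setT.
Qed.

Let exists_of_shift (c : K) :
  exists w, - g < r 1%N w * c - (m (z w + c) - m (z w)) /\ 0 <= r 1%N w <= R.
Proof.
apply: contrapT => /forallNP h1.
have := shift_mean c.
suff : (\int[P]_w (expR ((r 1%N w * c - (m (z w + c) - m (z w))) / g))%:E
        <= (expR (-1))%:E)%E.
  by move=> le1 e; move: le1; rewrite e lee_fin leNgt expR_lt1 oppr_lt0 ltr01.
have mzO : measurable_fun setT z.
  apply: (@measurable_dot K _ Omega d).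
    exact: (glb_action_measurable env).
  exact: (glb_param_measurable env).
have me : (\int[P]_w (expR (-1))%:E = (expR (-1))%:E)%E.
  by rewrite integral_cst // -[RHS]mule1; congr (_ * _)%E; exact: probability_setT.
rewrite -me; apply: ae_ge0_le_integral => //.
- apply/measurable_EFinP; apply: measurableT_comp => //; apply: measurable_funM => //.
  apply: measurable_funB.
    by apply: measurable_funM => //; exact: (glb_reward_measurable env).
  apply: measurable_funB; last exact: measurableT_comp mm _.
  by apply: measurableT_comp mm _; apply: measurable_funD.
apply: filterS (glb_reward_bound env t1) => w hr _.
rewrite lee_fin ler_expR ler_pdivrMr // mulN1r leNgt; apply/negP => h2.
by apply: (h1 w).
Qed.

Let zS w : - S <= z w <= S.
Proof.
apply: ball2_dot; last exact: (glb_param_bound env).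
exact: (glb_arms_bound env t1 (glb_action env w t1)).
Qed.

Let f1_le a b : - S <= a <= S -> - S <= b <= S -> f1 a <= f1 b + 2 * S * kmu.
Proof.
move=> aS bS; have k0 : 0 <= kmu.
  case/andP: (glm_link_bounds model aS) => _; apply: le_trans.
  by have := sc_ge0 R0 a sc.
have Sk : 0 <= 2 * S * kmu by rewrite !mulr_ge0 // ltW.
have [ab|ba] := leP a b.
  by apply: le_trans (sc_mean_increasing R0 sc ab) _; rewrite lerDl.
have /andP[a1 a2] := aS; have /andP[b1 b2] := bS.
have hk y : - S <= y <= S -> m^`(2)%classic y <= kmu.
  by move=> yS; case/andP: (glm_link_bounds model yS).
have h1 := sc_mean_lip sc hk (ltW ba) b1 a2.
have h2 : kmu * (a - b) <= kmu * (2 * S) by rewrite ler_wpM2l //; lra.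
by lra.
Qed.

Lemma mean_bounded y : - S <= y <= S -> `|f1 y| <= R + g + 2 * S * kmu.
Proof.
move=> yS; rewrite ler_norml; apply/andP; split.
- have [w [h1 /andP[h2 h3]]] := exists_of_shift (-1).
  have := sc_bregman_lower R0 (z w) (-1) sc.
  set q := _ * (_ / _) => hq.
  have q0 : 0 <= q.
    rewrite mulr_ge0 ?(sc_ge0 R0 _ sc) // divr_ge0 ?sqr_ge0 // addr_ge0 // mulr_ge0 //.
    exact: ltW.
  have := f1_le (zS w) yS; lra.
- have [w [h1 /andP[h2 h3]]] := exists_of_shift 1.
  have := sc_bregman_lower R0 (z w) 1 sc.
  set q := _ * (_ / _) => hq.
  have q0 : 0 <= q.
    rewrite mulr_ge0 ?(sc_ge0 R0 _ sc) // divr_ge0 ?sqr_ge0 // addr_ge0 // mulr_ge0 //.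
    exact: ltW.
  have := f1_le yS (zS w); lra.
Qed.

End MeanBounded.

(** * Regret on the good event *)

Section ChangeCounting.

Lemma window_count (T s D : nat) :
  (\sum_(1 <= t < T.+1) ((s < t) && (t.-1 - s < D)) <= D)%N.
Proof.
rewrite -[leqRHS](size_iota s.+1 D).
have -> : (\sum_(1 <= t < T.+1) ((s < t) && (t.-1 - s < D)) =
    \sum_(1 <= t < T.+1) if (s < t) && (t.-1 - s < D) then 1 else 0)%N.
  by apply: eq_bigr => t _; case: (_ && _).
rewrite -big_mkcond /= sum1_count -size_filter; apply: uniq_leq_size.
  by rewrite filter_uniq // /index_iota iota_uniq.
move=> t; rewrite mem_filter mem_iota => /andP[/andP[st tD] _].
case: t st tD => // t; rewrite ltnS /= => st; rewrite ltn_subLR // => tD.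
by rewrite ltnS st; exact: tD.
Qed.

End ChangeCounting.

Section TrajectoryRegret.
Context {K : realType} (d : nat).
Variables (R S g kmu cmu M : K) (m f1 f2 f3 : K -> K) (eta gam lam delta : K) (T : nat).
Variables (theta1 : 'cV[K]_d) (arms : nat -> set 'cV[K]_d).
Variables (x : nat -> 'cV[K]_d) (r : nat -> K).
Variables (theta : nat -> 'cV[K]_d) (H : nat -> 'M[K]_d).
Variables (thstar xstar : nat -> 'cV[K]_d).
Hypotheses (R0 : 0 < R) (S0 : 0 < S) (g0 : 0 < g) (cmu0 : 0 < cmu) (M0 : 0 <= M).
Hypotheses (d0 : (1 <= d)%N) (delta01 : 0 < delta < 1).
Hypothesis sc : self_concordant R m f1 f2 f3.
Hypothesis f2b : forall z, - S <= z <= S -> cmu <= f2 z <= kmu.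
Hypothesis f1M : forall z, - S <= z <= S -> `|f1 z| <= M.
Hypothesis etaE : eta = 1 + R * S.
Hypotheses (gam0 : 0 < gam < 1) (lam0 : 0 < lam).
Hypothesis lam_ge : 6 * eta * R * kmu * S / g <= lam.
Hypothesis lam_cmu : cmu / g <= lam.
Hypothesis run : domd_glb_run R S g kmu m gam lam eta delta T theta1 arms x r theta H.
Hypothesis theta1S : ball2 S theta1.
Hypothesis armsB : forall t, (1 <= t)%N -> arms t `<=` ball2 1.
Hypothesis xarm : forall t, (1 <= t)%N -> arms t (x t).
Hypothesis thS : forall t, (1 <= t)%N -> ball2 S (thstar t).
Hypothesis xstarP : forall t, (1 <= t)%N ->
  is_argmax (arms t) (fun y => f1 (dot y (thstar t))) (xstar t).
Hypothesis rB : forall t, (1 <= t <= T)%N -> 0 <= r t <= R.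

Local Notation beta := (conf_radius d R S g kmu gam lam eta delta).
Local Notation Ln t := (ln (pi ^+ 2 * t%:R ^+ 2 / (3 * delta))).
Local Notation lev := (leverage gam lam x H).
Local Notation cv := (curv g f2 x theta).

Hypothesis good : forall t, (1 <= t <= T)%N ->
  dsum gam (fun s => glb_loss g m (x s) (r s) (thstar s)
    - glb_loss g m (x s) (r s) (theta s.+1)
    - move_sqr gam lam theta H s / (3 * eta)
    - (3 * eta + 2^-1) * ln (1 + cv s * lev s)) t <= Ln t.
Hypothesis Ln0 : forall t, (1 <= t <= T)%N -> 0 <= Ln t.

Let f2k z : - S <= z <= S -> f2 z <= kmu. Proof. by move=> /f2b /andP[]. Qed.
Let f2c z : - S <= z <= S -> cmu <= f2 z. Proof. by move=> /f2b /andP[]. Qed.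
Let x1 t : (1 <= t)%N -> ball2 1 (x t).
Proof. by move=> t1; exact: (armsB t1 (xarm t1)). Qed.
Let eta1 : 1 <= eta. Proof. by rewrite etaE lerDl mulr_ge0 // ltW. Qed.
Let eta0 : 0 < eta. Proof. exact: lt_le_trans ltr01 eta1. Qed.
Let z0S : - S <= 0 <= S. Proof. by rewrite oppr_le0 ltW. Qed.
Let kmu0 : 0 < kmu. Proof. by apply: lt_le_trans cmu0 _; case/andP: (f2b z0S) => /le_trans; apply. Qed.
Let gam0' : 0 < 1 - gam. Proof. by case/andP: gam0 => *; lra. Qed.

Let radicand t := 4 * lam * S ^+ 2
    + 2 * eta * (1 + R ^+ 2 / (g * kmu)) * Ln t
    + 2 * eta * (3 * eta + 2^-1) * d%:R
        * ln (1 + kmu * (1 - gam ^+ t.-1) / (lam * d%:R * g * (1 - gam))).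

Let lnq0 t : 0 <= ln (1 + kmu * (1 - gam ^+ t.-1) / (lam * d%:R * g * (1 - gam))).
Proof.
rewrite ln_ge0 // lerDl divr_ge0 //.
  rewrite mulr_ge0 ?(ltW kmu0) // subr_ge0 exprn_ile1 //; case/andP: gam0 => *; exact: ltW.
by rewrite !mulr_ge0 // ltW.
Qed.

Let radicand_ge0 t : (1 <= t <= T)%N -> 0 <= radicand t.
Proof.
move=> h; rewrite /radicand !addr_ge0 //.
- by rewrite !mulr_ge0 ?sqr_ge0 // ltW.
- rewrite mulr_ge0 ?Ln0 // mulr_ge0 //; first by rewrite mulr_ge0 // ltW.
  by rewrite addr_ge0 // divr_ge0 ?sqr_ge0 // mulr_ge0 // ltW.
- rewrite mulr_ge0 // mulr_ge0 // mulr_ge0 //; first by rewrite mulr_ge0 // ltW.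
  by rewrite addr_ge0 // mulr_ge0 // ltW.
Qed.

Lemma conf_radius_sqr t : (1 <= t <= T)%N -> beta t ^+ 2 = radicand t.
Proof. by move=> h; rewrite sqr_sqrtr // radicand_ge0. Qed.

Lemma loss_lip (u v y : 'cV[K]_d) rr : ball2 S u -> ball2 S v -> ball2 1 y -> 0 <= rr <= R ->
  glb_loss g m y rr u - glb_loss g m y rr v <= 2 * S * (M + R) / g.
Proof.
move=> uS vS y1 /andP[r0 rR]; rewrite /glb_loss -mulrBl ler_pM2r ?invr_gt0 //.
have aS := ball2_dot y1 uS; have bS := ball2_dot y1 vS.
set a := dot y u in aS *; set b := dot y v in bS *.
have key p q : p <= q -> - S <= p <= S -> - S <= q <= S -> `|m q - m p| <= M * (q - p).
  move=> pq /andP[p1 p2] /andP[q1 q2]; have [e1 _ _ _] := sc.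
  have [|c hc ->] := @MVT_segment K m f1 p q pq.
    apply: continuous_subspaceT => z; apply: differentiable_continuous.
    by apply/derivable1_diffP; case: (e1 z).
  rewrite normrM (ger0_norm (_ : 0 <= q - p)) ?subr_ge0 // ler_wpM2r ?subr_ge0 //.
  move: hc; rewrite in_itv /= => /andP[c1 c2]; apply: f1M.
  by rewrite (le_trans p1 c1) (le_trans c2 q2).
have ab : `|a - b| <= 2 * S.
  by case/andP: aS => *; case/andP: bS => *; rewrite ler_norml; apply/andP; split; lra.
have h1 : `|m a - m b| <= M * `|a - b|.
  have [ba|ab'] := leP b a.
    by rewrite [`|a - b|]ger0_norm ?subr_ge0 //; exact: key.
  rewrite distrC [`|a - b|]distrC (ger0_norm (_ : 0 <= b - a)) ?subr_ge0 ?(ltW ab') //.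
  by apply: key => //; exact: ltW.
have h2 : m a - m b <= M * (2 * S).
  by apply: le_trans (ler_norm _) _; apply: le_trans h1 _; rewrite ler_wpM2l.
have h3 : rr * (b - a) <= R * (2 * S).
  apply: le_trans (ler_norm _) _; rewrite normrM (ger0_norm r0) distrC.
  by rewrite ler_pM.
by lra.
Qed.

Lemma conf_dist t u : (1 <= t <= T)%N -> ball2 S u ->
  bform (H t) (theta t - u) (theta t - u) <= beta t ^+ 2
  + 2 * eta * dsum gam (fun s => glb_loss g m (x s) (r s) u
                               - glb_loss g m (x s) (r s) (thstar s)) t.
Proof.
move=> h uS; have h' : (1 <= t <= T.+1)%N by case/andP: h => -> /leqW.
apply: le_trans (run_dist R0 S0 g0 sc f2k etaE gam0 lam0 lam_ge run theta1S x1 h' uS) _.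
rewrite conf_radius_sqr // /radicand.
set F := (F in dsum gam F t).
pose dr s := glb_loss g m (x s) (r s) u - glb_loss g m (x s) (r s) (thstar s).
pose lg s := ln (1 + cv s * lev s).
pose gn s := glb_loss g m (x s) (r s) (thstar s)
    - glb_loss g m (x s) (r s) (theta s.+1)
    - move_sqr gam lam theta H s / (3 * eta) - (3 * eta + 2^-1) * lg s.
have -> : dsum gam F t = dsum gam dr t + (dsum gam gn t + (3 * eta + 2^-1) * dsum gam lg t).
  rewrite -dsumZ -!dsumD; congr dsum; apply/funext => s.
  by rewrite /F /dr /gn; ring.
have h1 : dsum gam gn t <= Ln t by exact: good.
have h2 : dsum gam lg t <= d%:R * ln (1 + kmu * (1 - gam ^+ t.-1) / (lam * d%:R * g * (1 - gam))).
  apply: le_trans (dsum_ln_leverage R0 g0 sc gam0 lam0 run h') _.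
  exact: (ln_det_run R0 g0 sc f2k gam0 lam0 run theta1S x1 d0 (ltW kmu0) h').
have h3 : 0 <= R ^+ 2 / (g * kmu) * Ln t.
  by rewrite mulr_ge0 ?Ln0 // divr_ge0 ?sqr_ge0 // mulr_ge0 // ltW.
set q := ln (1 + _) in h2 *; set w := R ^+ 2 / _ in h3 *.
have e2 : 0 <= 2 * eta by rewrite mulr_ge0 // ltW.
have k0 : 0 <= 3 * eta + 2^-1 by rewrite addr_ge0 // mulr_ge0 // ltW.
have := ler_wpM2l e2 h1; have := ler_wpM2l (mulr_ge0 e2 k0) h2.
have := mulr_ge0 e2 h3.
by rewrite -/dr; lra.
Qed.

Variable D : nat.
Definition stable_round (t : nat) : bool :=
  all (fun s => (t.-1 - s < D)%N ==> (thstar s == thstar t)) (iota 1 t.-1).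

Let C0 : K := 2 * S * (M + R) / g.
Let eps : K := Num.sqrt (2 * eta * (C0 * (gam ^+ D / (1 - gam)))).

Let C0_ge0 : 0 <= C0.
Proof. by rewrite divr_ge0 ?(ltW g0) // !mulr_ge0 ?addr_ge0 // ltW. Qed.

Let eps_arg : 0 <= 2 * eta * (C0 * (gam ^+ D / (1 - gam))).
Proof.
rewrite mulr_ge0 //; first by rewrite mulr_ge0 // ltW.
by rewrite mulr_ge0 // divr_ge0 ?(ltW gam0') // exprn_ge0 //; case/andP: gam0 => *; exact: ltW.
Qed.

Lemma stable_conf t : (1 <= t <= T)%N -> stable_round t ->
  Num.sqrt (bform (H t) (theta t - thstar t) (theta t - thstar t)) <= beta t + eps.
Proof.
move=> h st; have t1 : (1 <= t)%N by case/andP: h.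
have hb : 0 <= beta t by exact: sqrtr_ge0.
have he : 0 <= eps by exact: sqrtr_ge0.
have Hp : 0 <= bform (H t) (theta t - thstar t) (theta t - thstar t).
  apply: spd_psd; apply: (run_H_spd R0 g0 sc gam0 lam0 run).
  by case/andP: h => -> /leqW.
rewrite -(@ler_pXn2r _ 2) ?nnegrE ?sqrtr_ge0 ?addr_ge0 // sqr_sqrtr //.
apply: le_trans (conf_dist h (thS t1)) _.
have dle : dsum gam (fun s => glb_loss g m (x s) (r s) (thstar t)
    - glb_loss g m (x s) (r s) (thstar s)) t <= C0 * (gam ^+ D / (1 - gam)).
  apply: dsum_le_tail => // s hs.
    have s1 : (1 <= s)%N by case/andP: hs.
    apply: loss_lip; [exact: thS | exact: thS | exact: x1 |].
    apply: rB; rewrite s1 /=; case/andP: hs => _ st'.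
    by rewrite ltnW // (leq_trans st') //; case/andP: h.
  move=> hD; have /allP /(_ s) := st.
  rewrite mem_iota add1n prednK // hs => /(_ isT); rewrite hD /= => /eqP ->.
  by rewrite subrr.
have e2 : 0 <= 2 * eta by rewrite mulr_ge0 // ltW.
apply: (@le_trans _ _ (beta t ^+ 2 + eps ^+ 2)).
  by rewrite lerD2l [eps ^+ 2]sqr_sqrtr // ler_wpM2l.
by rewrite sqrrD; have : 0 <= beta t * eps by [exact: mulr_ge0]; lra.
Qed.

Let nrm t y := wnorm (invmx (H t)) y.

Let nrm_sqr t y : (1 <= t <= T)%N -> nrm t y ^+ 2 = bform (invmx (H t)) y y.
Proof.
move=> h; rewrite /nrm wnorm_sqr //; apply/invmx_psd/(run_H_spd R0 g0 sc gam0 lam0 run).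
by case/andP: h => -> /leqW.
Qed.

Let nrm_le t y : (1 <= t <= T)%N -> ball2 1 y -> nrm t y <= (Num.sqrt lam)^-1.
Proof.
move=> h y1; have h' : (1 <= t <= T.+1)%N by case/andP: h => -> /leqW.
rewrite -(@ler_pXn2r _ 2) ?nnegrE ?sqrtr_ge0 ?invr_ge0 ?sqrtr_ge0 // nrm_sqr //.
have [sH lH] := run_H R0 g0 sc gam0 run h'.
apply: le_trans (bform_inv_le y sH lam0 lH) _.
rewrite exprVn sqr_sqrtr ?(ltW lam0) // ler_pdivrMr // mulVf ?gt_eqF // -sqr_norm2.
by rewrite expr_le1 ?norm2_ge0.
Qed.

Let nrm_dot t y : (1 <= t <= T)%N -> stable_round t ->
  `|dot y (theta t - thstar t)| <= nrm t y * (beta t + eps).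
Proof.
move=> h st; have h' : (1 <= t <= T.+1)%N by case/andP: h => -> /leqW.
have sH := run_H_spd R0 g0 sc gam0 lam0 run h'.
apply: (@le_trans _ _ (nrm t y * Num.sqrt (bform (H t) (theta t - thstar t) (theta t - thstar t)))).
  rewrite -(@ler_pXn2r _ 2) ?nnegrE ?mulr_ge0 ?sqrtr_ge0 // real_normK ?num_real //.
  rewrite exprMn nrm_sqr // sqr_sqrtr; last exact: spd_psd.
  exact: dot_cs_inv.
by rewrite ler_wpM2l ?sqrtr_ge0 // stable_conf.
Qed.

Let inst t := f1 (dot (xstar t) (thstar t)) - f1 (dot (x t) (thstar t)).

Lemma inst_regret_le t : (1 <= t)%N -> inst t <= 2 * S * kmu.
Proof.
move=> t1; have [xa _] := xstarP t1.
have aS := ball2_dot (armsB t1 xa) (thS t1); have bS := ball2_dot (x1 t1) (thS t1).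
rewrite /inst; set a := dot _ _ in aS *; set b := dot (x t) _ in bS *.
have [ab|/ltW ba] := leP a b.
  apply: (@le_trans _ _ 0); first by rewrite subr_le0 (sc_mean_increasing R0 sc ab).
  by rewrite !mulr_ge0 // ltW.
have /andP[a1 a2] := aS; have /andP[b1 b2] := bS.
apply: le_trans (sc_mean_lip sc f2k ba b1 a2) _.
by rewrite mulrC ler_pM2r //; lra.
Qed.

Lemma stable_regret_le t : (1 <= t <= T)%N -> stable_round t ->
  inst t <= kmu * (2 * beta t * nrm t (x t) + 2 * eps / Num.sqrt lam).
Proof.
move=> h st; have t1 : (1 <= t)%N by case/andP: h.
have [xa _] := xstarP t1.
have aS := ball2_dot (armsB t1 xa) (thS t1); have bS := ball2_dot (x1 t1) (thS t1).
have hb : 0 <= beta t by exact: sqrtr_ge0.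
have he : 0 <= eps by exact: sqrtr_ge0.
have hn y : 0 <= nrm t y by exact: sqrtr_ge0.
have n1 := nrm_le h (x1 t1); have n2 := nrm_le h (armsB t1 xa).
have il : 0 <= (Num.sqrt lam)^-1 by rewrite invr_ge0 sqrtr_ge0.
rewrite /inst; set a := dot _ _ in aS *; set b := dot (x t) _ in bS *.
have [ab|/ltW ba] := leP a b.
  apply: (@le_trans _ _ 0); first by rewrite subr_le0 (sc_mean_increasing R0 sc ab).
  by rewrite mulr_ge0 ?(ltW kmu0) // addr_ge0 // !mulr_ge0.
have /andP[a1 a2] := aS; have /andP[b1 b2] := bS.
apply: le_trans (sc_mean_lip sc f2k ba b1 a2) _.
rewrite ler_pM2l //.
have [_ /(_ _ xa)] := domd_play run h; rewrite -/(nrm _ _) -/(nrm _ _) => am.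
have := nrm_dot (xstar t) h st; rewrite dotBr -/a ler_norml => /andP[g1 _].
have := nrm_dot (x t) h st; rewrite dotBr -/b ler_norml => /andP[_ g2].
have k1 := ler_wpM2l he n1; have k2 := ler_wpM2l he n2.
by lra.
Qed.

Let chi s : nat := (thstar s.+1 != thstar s).

Lemma unstable_le t : (1 <= t <= T)%N ->
  (~~ stable_round t <= \sum_(1 <= s < T) chi s * ((s < t) && (t.-1 - s < D)))%N.
Proof.
move=> h; have [//|] := boolP (stable_round t) => /allPn[s].
rewrite mem_iota add1n prednK; last by case/andP: h.
move=> /andP[s1 st]; rewrite negb_imply => /andP[sD ne].
have [s' /andP[ss' s't] ne'] : exists2 s', (s <= s' < t)%N & thstar s'.+1 != thstar s'.
  apply/exists2P; apply: contrapT => /forallNP hn; case/negP: ne; apply/eqP.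
  have key k : (s + k <= t)%N -> thstar s = thstar (s + k)%N.
    elim: k => [|k IH] hk; first by rewrite addn0.
    rewrite addnS in hk *; rewrite IH ?(ltnW hk) //.
    have := hn (s + k)%N; rewrite leq_addr hk /= => /not_andP[//|/negP].
    by rewrite negbK => /eqP ->.
  by have := key (t - s)%N; rewrite subnKC ?(ltnW st) //; apply.
have s'T : (s' < T)%N by apply: leq_trans s't _; case/andP: h.
rewrite (bigD1_seq s') /=; last 2 first.
- by rewrite mem_index_iota s'T (leq_trans s1 ss').
- exact: iota_uniq.
rewrite /chi ne' s't mul1n; have -> : (t.-1 - s' < D)%N.
  by apply: leq_ltn_trans sD; exact: leq_sub2l.
by rewrite leq_addr.
Qed.

Lemma unstable_count :
  (\sum_(1 <= t < T.+1) ~~ stable_round t <= D * num_changes thstar T)%N.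
Proof.
apply: (@leq_trans (\sum_(1 <= t < T.+1) \sum_(1 <= s < T)
    chi s * ((s < t) && (t.-1 - s < D)))%N).
  rewrite big_nat_cond [leqRHS]big_nat_cond; apply: leq_sum => t /andP[h _].
  exact: unstable_le.
rewrite exchange_big_nat /= /num_changes big_distrr /=.
apply: leq_sum => s _; rewrite -big_distrr /= mulnC leq_mul2r; apply/orP; right.
exact: window_count.
Qed.

Variables (Lam bbar : K).
Hypothesis LamP : forall t, (1 <= t <= T.+1)%N ->
  ln (1 + kmu * (1 - gam ^+ t.-1) / (lam * d%:R * g * (1 - gam))) <= Lam.
Hypothesis Lam0 : 0 < Lam.
Hypothesis bbarP : forall t, (1 <= t <= T)%N -> beta t <= bbar.

Let V : K := 2 * g / cmu * (d%:R * Lam * (1 + (1 - gam) * T%:R)).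

Lemma sum_nrm_sqr : \sum_(1 <= t < T.+1) nrm t (x t) ^+ 2 <= V.
Proof.
pose Dt t := ln (\det (H t)) - d%:R * ln lam.
have DL t : (1 <= t <= T.+1)%N -> Dt t <= d%:R * Lam.
  move=> h; apply: le_trans (ln_det_run R0 g0 sc f2k gam0 lam0 run theta1S x1 d0 (ltW kmu0) h) _.
  by rewrite ler_wpM2l // LamP.
have D1 : Dt 1%N = 0.
  by rewrite /Dt (domd_init_H run) det_scalar lnXn // mulr_natl subrr.
have sumln n : (n <= T)%N -> \sum_(1 <= t < n.+1) ln (1 + cv t * lev t)
    <= Dt n.+1 + (1 - gam) * (d%:R * Lam) * n%:R.
  elim: n => [|n IH] hn; first by rewrite big_nil D1 mulr0 addr0.
  rewrite big_nat_recr //=; apply: le_trans (lerD (IH (ltnW hn)) (lexx _)) _.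
  have hn' : (1 <= n.+1 <= T)%N by [].
  have hs : gam * Dt n.+1 + ln (1 + cv n.+1 * lev n.+1) <= Dt n.+2.
    exact: (ln_leverage_step R0 g0 sc gam0 lam0 run hn').
  have hd : Dt n.+1 <= d%:R * Lam by apply: DL; rewrite /= ltnW.
  have := ler_wpM2l (ltW gam0') hd; rewrite -[n.+1%:R]natr1.
  by set q := d%:R * Lam; lra.
have c0 : 0 < cmu / g by rewrite divr_gt0.
apply: (@le_trans _ _ (2 * g / cmu * \sum_(1 <= t < T.+1) ln (1 + cv t * lev t))).
  rewrite mulr_sumr big_nat_cond [leRHS]big_nat_cond; apply: ler_sum => t /andP[h _].
  rewrite ltnS in h; have h' : (1 <= t <= T.+1)%N by case/andP: h => -> /leqW.
  have t1 : (1 <= t)%N by case/andP: h.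
  rewrite nrm_sqr //; set b := bform _ _ _.
  have b0 : 0 <= b by rewrite /b -nrm_sqr // sqr_ge0.
  have bl : b <= lev t := H_leverage_le R0 g0 sc gam0 lam0 run h'.
  have ll := leverage_le R0 g0 sc gam0 lam0 run x1 h'.
  have th' : ball2 S (theta t.+1) by apply: (run_theta_ball run) => //; case/andP: h.
  have cc : cmu / g <= cv t by rewrite ler_pM2r ?invr_gt0 //; apply: f2c; exact: (ball2_dot (x1 t1) th').
  pose v := cmu / g * b.
  have v0 : 0 <= v by apply: mulr_ge0 => //; exact: ltW.
  have v1 : v <= 1.
    have e : cmu / g * lam^-1 <= 1 by rewrite ler_pdivrMr // mul1r.
    by apply: le_trans e; rewrite /v ler_pM2l // (le_trans bl).
  have lv : ln (1 + v) <= ln (1 + cv t * lev t).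
    have cl : 0 <= cv t * lev t.
      by apply: mulr_ge0; [exact: le_trans (ltW c0) cc | exact: le_trans b0 bl].
    rewrite ler_ln ?posrE ?ltr_pwDl //.
    by rewrite lerD2l /v ler_pM // ltW.
  have v2 : v / 2 <= ln (1 + v).
    apply: le_trans (ln1D_ge v0); rewrite ler_wpM2l // lef_pV2 ?posrE ?ltr_pwDl //; lra.
  have -> : b = 2 * g / cmu * (v / 2) by rewrite /v; field; rewrite !gt_eqF.
  by rewrite ler_pM2l ?divr_gt0 ?mulr_gt0 //; apply: le_trans lv.
rewrite /V ler_pM2l ?divr_gt0 ?mulr_gt0 //; apply: le_trans (sumln T (leqnn T)) _.
by have := DL T.+1 (leqnn _); lra.
Qed.

Hypothesis T0 : (1 <= T)%N.

Lemma sum_nrm : \sum_(1 <= t < T.+1) nrm t (x t) <= Num.sqrt (V * T%:R).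
Proof.
have T0' : 0 < T%:R :> K by rewrite ltr0n.
have d0' : 0 < d%:R :> K by rewrite ltr0n.
have V0 : 0 < V.
  rewrite /V; apply: mulr_gt0; first by rewrite divr_gt0 // mulr_gt0.
  apply: mulr_gt0; first exact: mulr_gt0.
  by rewrite ltr_pwDl // mulr_ge0 // ltW.
pose q := Num.sqrt (V * T%:R).
have q0 : 0 < q by rewrite sqrtr_gt0 mulr_gt0.
have qE : q ^+ 2 = V * T%:R by rewrite sqr_sqrtr // mulr_ge0 // ltW.
pose rho := q / T%:R; have rho0 : 0 < rho by rewrite divr_gt0.
apply: (@le_trans _ _ (\sum_(1 <= t < T.+1) (nrm t (x t) ^+ 2 / rho + rho) / 2)).
  apply: ler_sum => t _; set n := nrm _ _.
  have -> : (n ^+ 2 / rho + rho) / 2 = n + (n - rho) ^+ 2 / (2 * rho).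
    by field; rewrite gt_eqF.
  by rewrite lerDl divr_ge0 ?sqr_ge0 // mulr_ge0 // ltW.
rewrite -mulr_suml big_split /= -mulr_suml.
have -> : \sum_(1 <= t < T.+1) rho = T%:R * rho.
  by rewrite big_const_nat iter_addr_0 subn1 mulr_natl.
apply: (@le_trans _ _ ((V / rho + T%:R * rho) / 2)).
  by rewrite ler_pM2r // lerD2r ler_pM2r ?invr_gt0 // sum_nrm_sqr.
have -> : V / rho = q.
  by apply: (mulIf (lt0r_neq0 rho0)); rewrite divfK ?gt_eqF // /rho mulrA -expr2 qE mulfK // gt_eqF.
have -> : T%:R * rho = q by rewrite /rho mulrC divfK // gt_eqF.
by rewrite -/q; lra.
Qed.

Lemma trajectory_regret :
  dyn_regret f1 thstar xstar x T
  <= 2 * S * kmu * (D * num_changes thstar T)%N%:R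
     + kmu * (2 * bbar * Num.sqrt (V * T%:R) + T%:R * (2 * eps / Num.sqrt lam)).
Proof.
have he : 0 <= eps by exact: sqrtr_ge0.
have hl : 0 <= 2 * eps / Num.sqrt lam by rewrite divr_ge0 ?sqrtr_ge0 // mulr_ge0.
have bb0 : 0 <= bbar.
  by apply: le_trans (bbarP (t := 1) _); [exact: sqrtr_ge0 | rewrite T0].
have Sk : 0 <= 2 * S * kmu by rewrite !mulr_ge0 // ltW.
apply: (@le_trans _ _ (\sum_(1 <= t < T.+1) (2 * S * kmu * (~~ stable_round t)%:R
  + kmu * (2 * bbar * nrm t (x t) + 2 * eps / Num.sqrt lam)))).
  rewrite /dyn_regret big_nat_cond [leRHS]big_nat_cond; apply: ler_sum => t /andP[h _].
  rewrite ltnS in h; have t1 : (1 <= t)%N by case/andP: h.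
  have hn : 0 <= nrm t (x t) by exact: sqrtr_ge0.
  have [st|st] := boolP (stable_round t).
    rewrite mulr0 add0r; apply: le_trans (stable_regret_le h st) _.
    rewrite ler_pM2l // lerD2r ler_wpM2r // ler_pM2l // bbarP //.
  rewrite mulr1; apply: le_trans (inst_regret_le t1) _; rewrite lerDl.
  by apply: mulr_ge0; [exact: ltW | apply: addr_ge0 => //; apply: mulr_ge0 => //; exact: mulr_ge0].
rewrite big_split /= -mulr_sumr -mulr_sumr big_split /= -mulr_sumr.
apply: lerD.
  by rewrite ler_wpM2l // -natr_sum ler_nat unstable_count.
rewrite ler_pM2l //; apply: lerD.
  by apply: ler_wpM2l; [exact: mulr_ge0 | exact: sum_nrm].
by rewrite big_const_nat iter_addr_0 subn1 [T%:R * _]mulr_natl.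
Qed.

End TrajectoryRegret.

(** * Rates *)

Section Rates.
Context {K : realType}.
Implicit Types (R S g kmu cmu delta gam : K) (d T n : nat).

Definition lambda_cap R S g kmu : K :=
  6 * (1 + R * S) * R * kmu * S / g + 8 * (1 + R * S) * R ^+ 2 + kmu / g.

Lemma domd_lambda_bounds R S g kmu cmu d :
    0 < R -> 0 < S -> 0 < g -> 0 < kmu -> 0 < cmu -> cmu <= kmu -> (1 <= d)%N ->
  [/\ 6 * (1 + R * S) * R * kmu * S / g <= domd_lambda d R S g kmu cmu,
      3 * (1 + R * S) * R ^+ 2 <= domd_lambda d R S g kmu cmu,
      cmu / g <= domd_lambda d R S g kmu cmu &
      domd_lambda d R S g kmu cmu <= lambda_cap R S g kmu * d%:R].
Proof.
move=> R0 S0 g0 k0 c0 ck d0; rewrite /domd_lambda.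
have d1 : 1 <= d%:R :> K by rewrite ler1n.
have e0 : 0 < 1 + R * S by rewrite addr_gt0 // mulr_gt0.
have q0 : 0 <= (1 + R * S) * R ^+ 2 by rewrite mulr_ge0 ?sqr_ge0 // ltW.
have qd := ler_wpM2l q0 d1.
have h1 : 0 <= 6 * (1 + R * S) * R * kmu * S / g.
  by rewrite divr_ge0 ?(ltW g0) // !mulr_ge0 // ltW.
have h2 : 0 <= kmu / g by rewrite divr_ge0 // ltW.
have h3 : cmu / g <= kmu / g by rewrite ler_pM2r ?invr_gt0.
split.
- by rewrite le_max lexx.
- rewrite le_max; apply/orP; right; rewrite le_max; apply/orP; left.
  by lra.
- by rewrite !le_max lexx !orbT.
- rewrite !ge_max /lambda_cap; apply/and3P.
  have h1d := ler_wpM2l h1 d1; have h2d := ler_wpM2l h2 d1.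
  have qd0 : 0 <= (1 + R * S) * R ^+ 2 * d%:R by rewrite mulr_ge0 // ler0n.
  by split; lra.
Qed.

Lemma discount_window (u y : K) : 0 < u < 1 -> 0 <= y ->
  exists D : nat, D%:R <= (y + 1) / u /\ (1 - u) ^+ D <= expR (- y).
Proof.
move=> /andP[u0 u1] y0; exists (Num.truncn (y / u)).+1.
have yu0 : 0 <= y / u by rewrite divr_ge0 // ltW.
have /andP[t1 t2] := truncn_itv yu0; split.
  rewrite -natr1 mulrDl lerD // div1r invf_ge1 //; exact: ltW.
have -> : - y = - (u * (y / u)) by rewrite mulrC divfK // gt_eqF.
apply: (@le_trans _ _ (expR (- u) ^+ (Num.truncn (y / u)).+1)).
  rewrite ler_pXn2r ?nnegrE ?expR_ge0 ?subr_ge0 ?(ltW u1) //; exact: expR_ge1Dx.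
rewrite -expRM_natl ler_expR mulrN lerN2 mulrC ler_pM2r //; exact: ltW.
Qed.

Lemma sqrt_rate (u t : K) : 0 <= u -> 0 <= t ->
  Num.sqrt ((1 + u * t) * t) <= Num.sqrt t + t * Num.sqrt u.
Proof.
move=> u0 t0.
have h : 0 <= Num.sqrt t + t * Num.sqrt u by rewrite addr_ge0 ?mulr_ge0 ?sqrtr_ge0.
rewrite -[leRHS]ger0_norm // -sqrtr_sqr ler_wsqrtr // sqrrD exprMn !sqr_sqrtr //.
have : 0 <= Num.sqrt t * (t * Num.sqrt u) by rewrite !mulr_ge0 ?sqrtr_ge0.
by lra.
Qed.

Definition log_sum T delta gam : K :=
  ln (expR 1 * T%:R) + ln (expR 1 / delta) + ln (expR 1 / (1 - gam)).

Lemma log_sumE T delta gam : (0 < T)%N -> 0 < delta -> gam < 1 ->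
  log_sum T delta gam = 3 + ln T%:R - ln delta - ln (1 - gam).
Proof.
move=> T0 de0 g1; have T0' : 0 < T%:R :> K by rewrite ltr0n.
have u0 : 0 < 1 - gam by rewrite subr_gt0.
rewrite /log_sum !lnM ?posrE ?expR_gt0 ?invr_gt0 // !lnV ?posrE // expRK; ring.
Qed.

Definition logdet_cap R S : K := 1 + (6 * (1 + R * S) * R * S)^-1.
Definition conf_cap R S g kmu : K :=
  4 * lambda_cap R S g kmu * S ^+ 2
  + 2 * (1 + R * S) * (1 + R ^+ 2 / (g * kmu)) * (pi ^+ 2 + 2)
  + 2 * (1 + R * S) * (3 * (1 + R * S) + 2^-1) * logdet_cap R S.
Definition loss_cap R S g kmu : K :=
  2 * S * (R + g + 2 * S * kmu + R) / g.
Definition regret_cap R S g kmu : K :=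
  4 * S * kmu + 2 * Num.sqrt (2 * g * conf_cap R S g kmu * logdet_cap R S)
  + 2 * Num.sqrt (2 * (1 + R * S) * loss_cap R S g kmu
                  / (6 * (1 + R * S) * R * kmu * S / g)) * Num.sqrt kmu.

Lemma regret_cap_ge0 R S g kmu : 0 < R -> 0 < S -> 0 < g -> 0 < kmu ->
  0 <= regret_cap R S g kmu.
Proof.
move=> R0 S0 g0 k0; rewrite /regret_cap !addr_ge0 //.
by rewrite !mulr_ge0 // ltW.
Qed.

Section Bounds.
Variables (R S g kmu cmu delta gam : K) (d T : nat).
Hypotheses (R0 : 0 < R) (S0 : 0 < S) (g0 : 0 < g) (k0 : 0 < kmu) (c0 : 0 < cmu).
Hypotheses (ck : cmu <= kmu) (d0 : (1 <= d)%N) (T2 : (2 <= T)%N).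
Hypotheses (de01 : 0 < delta < 1) (gam01 : 0 < gam < 1).
Local Notation lam := (domd_lambda d R S g kmu cmu).
Local Notation eta := (1 + R * S).
Local Notation W := (log_sum T delta gam).

Let e0 : 0 < eta. Proof. by rewrite addr_gt0 // mulr_gt0. Qed.
Let u0 : 0 < 1 - gam. Proof. by case/andP: gam01 => *; lra. Qed.
Let T0 : 0 < T%:R :> K. Proof. by rewrite ltr0n ltnW. Qed.
Let d1 : 1 <= d%:R :> K. Proof. by rewrite ler1n. Qed.
Let dp : 0 < d%:R :> K. Proof. by rewrite ltr0n. Qed.
Let l0p : 0 < 6 * eta * R * kmu * S / g.
Proof. by rewrite divr_gt0 // !mulr_gt0. Qed.
Let lam0 : 0 < lam.
Proof. by have [h _ _ _] := domd_lambda_bounds R0 S0 g0 k0 c0 ck d0; apply: lt_le_trans h. Qed.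
Let lnT0 : 0 <= ln T%:R :> K. Proof. by rewrite ln_ge0 // ler1n ltnW. Qed.
Let lnde0 : ln delta <= 0. Proof. by case/andP: de01 => *; rewrite ln_le0 // ltW. Qed.
Let lnu0 : ln (1 - gam) <= 0. Proof. by case/andP: gam01 => *; rewrite ln_le0 //; lra. Qed.
Let WE : W = 3 + ln T%:R - ln delta - ln (1 - gam).
Proof. by case/andP: gam01 => _ ?; case/andP: de01 => ? _; rewrite log_sumE // ltnW. Qed.
Let W3 : 3 <= W. Proof. rewrite WE; move: lnT0 lnde0 lnu0; set a := ln _; set b := ln _; set c := ln _; lra. Qed.
Let p0 : 0 < (6 * eta * R * S)^-1. Proof. by rewrite invr_gt0 !mulr_gt0. Qed.

Lemma logdet_le (t : nat) :
  ln (1 + kmu * (1 - gam ^+ t) / (lam * d%:R * g * (1 - gam)))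
  <= logdet_cap R S * W.
Proof.
have /andP[ga0 ga1] := gam01; pose p := (6 * eta * R * S)^-1.
have p0' : 0 < p by exact: p0.
have gt0 : 0 <= gam ^+ t by rewrite exprn_ge0 // ltW.
have gt1 : gam ^+ t <= 1 by rewrite exprn_ile1 // ltW.
have [hl _ _ _] := domd_lambda_bounds R0 S0 g0 k0 c0 ck d0.
have den0 : 0 < lam * d%:R * g * (1 - gam).
  by apply: mulr_gt0 => //; apply: mulr_gt0 => //; exact: mulr_gt0.
have q0 : 0 <= kmu * (1 - gam ^+ t) / (lam * d%:R * g * (1 - gam)).
  by rewrite divr_ge0 ?(ltW den0) // mulr_ge0 ?(ltW k0) // subr_ge0.
have qle : kmu * (1 - gam ^+ t) / (lam * d%:R * g * (1 - gam)) <= p / (1 - gam).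
  rewrite ler_pdivrMr //.
  have -> : p / (1 - gam) * (lam * d%:R * g * (1 - gam)) = p * (lam * d%:R * g).
    by field; rewrite gt_eqF.
  apply: (@le_trans _ _ kmu); first by rewrite ler_piMr ?(ltW k0) // gerBl.
  have {1}-> : kmu = p * (6 * eta * R * kmu * S / g * 1 * g).
    rewrite /p; field; do ?[apply/andP; split]; by rewrite gt_eqF.
  rewrite ler_pM2l // ler_pM2r //; apply: ler_pM => //; exact: ltW.
have h1 : 1 + kmu * (1 - gam ^+ t) / (lam * d%:R * g * (1 - gam)) <= (1 + p) / (1 - gam).
  apply: le_trans (lerD (lexx 1) qle) _; rewrite mulrDl lerD2r div1r invf_ge1 //; lra.
have p1 : 0 < 1 + p by apply: addr_gt0.
apply: (@le_trans _ _ (ln ((1 + p) / (1 - gam)))).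
  by rewrite ler_ln ?posrE ?divr_gt0 // ltr_pwDl.
rewrite lnM ?posrE ?invr_gt0 // lnV ?posrE //.
have := le_ln1Dx (lt_trans (ltrN10 K) p0'); rewrite /logdet_cap -/p.
have : 0 <= p * (W - 1) by apply: mulr_ge0; [exact: ltW | have := W3; lra].
rewrite mulrDl mul1r; move: lnT0 lnde0; rewrite {2}WE.
set A := ln T%:R; set B := ln delta; set C := ln (1 - gam); set E := ln _; lra.
Qed.

Lemma logdet_cap_gt0 : 0 < logdet_cap R S.
Proof. by rewrite /logdet_cap addr_gt0. Qed.

Lemma ln_conf_ge0 (t : nat) : (1 <= t)%N ->
  0 <= ln (pi ^+ 2 * t%:R ^+ 2 / (3 * delta)) :> K.
Proof.
move=> t1; apply: ln_ge0; have /andP[de0 de1] := de01.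
rewrite ler_pdivlMr ?mulr_gt0 // mul1r.
have t2 : 1 <= t%:R ^+ 2 :> K by rewrite exprn_ege1 // ler1n.
have p2 : 2 ^+ 2 <= pi ^+ 2 :> K by rewrite lerXn2r ?nnegrE ?pi_ge0 // pi_ge2.
apply: (@le_trans _ _ (pi ^+ 2 * 1)); first lra.
by apply: ler_wpM2l => //; exact: sqr_ge0.
Qed.

Lemma ln_conf_le (t : nat) : (1 <= t <= T)%N ->
  ln (pi ^+ 2 * t%:R ^+ 2 / (3 * delta)) <= (pi ^+ 2 + 2) * W.
Proof.
move=> /andP[t1 tT]; have /andP[de0 de1] := de01.
have pp : 0 < pi ^+ 2 :> K by rewrite exprn_gt0 // pi_gt0.
have tp : 0 < t%:R :> K by rewrite ltr0n.
have h : pi ^+ 2 * t%:R ^+ 2 / (3 * delta) <= pi ^+ 2 * T%:R ^+ 2 / delta.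
  apply: ler_pM.
  - by rewrite mulr_ge0 ?sqr_ge0.
  - by rewrite invr_ge0 mulr_ge0 // ltW.
  - by rewrite ler_pM2l // lerXn2r ?nnegrE // ler_nat.
  - by rewrite lef_pV2 ?posrE ?mulr_gt0 //; lra.
apply: (@le_trans _ _ (ln (pi ^+ 2 * T%:R ^+ 2 / delta))).
  rewrite ler_ln // posrE divr_gt0 ?mulr_gt0 ?exprn_gt0 ?pi_gt0 //.
rewrite lnM ?posrE ?invr_gt0 ?mulr_gt0 ?exprn_gt0 ?pi_gt0 // lnV ?posrE //.
rewrite lnM ?posrE ?exprn_gt0 ?pi_gt0 // (lnXn 2 T0).
have := ltW (ln_sublinear pp).
have : 0 <= pi ^+ 2 * (W - 1) by apply: mulr_ge0; [exact: ltW | have := W3; lra].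
rewrite mulrDl; move: lnT0 lnde0 lnu0; rewrite {3}WE.
set A := ln T%:R; set B := ln delta; set C := ln (1 - gam); set E := ln _.
set P := pi ^+ 2; lra.
Qed.

Lemma lambda_cap_ge0 : 0 <= lambda_cap R S g kmu.
Proof.
rewrite /lambda_cap addr_ge0 ?divr_ge0 ?(ltW k0) ?(ltW g0) //.
rewrite addr_ge0 //; first exact: ltW.
by rewrite mulr_ge0 ?sqr_ge0 // mulr_ge0 // ltW.
Qed.

Lemma conf_cap_gt0 : 0 < conf_cap R S g kmu.
Proof.
rewrite /conf_cap; apply: ltr_wpDr; last apply: ltr_wpDl.
- apply: mulr_ge0; last exact: ltW logdet_cap_gt0.
  by rewrite mulr_ge0 // ?addr_ge0 // mulr_ge0 // ltW.
- by rewrite mulr_ge0 ?sqr_ge0 // mulr_ge0 // lambda_cap_ge0.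
- apply: mulr_gt0; last by rewrite ltr_wpDl // sqr_ge0.
  rewrite mulr_gt0 ?mulr_gt0 // ltr_wpDr // divr_ge0 ?sqr_ge0 //.
  by rewrite mulr_ge0 // ltW.
Qed.

Lemma conf_radius_le (t : nat) : (1 <= t <= T)%N ->
  conf_radius d R S g kmu gam lam eta delta t
  <= Num.sqrt (conf_cap R S g kmu * (d%:R * W)).
Proof.
move=> h; rewrite /conf_radius ler_wsqrtr //.
have W0 : 0 <= W by have := W3; lra.
have W1 : 1 <= W by have := W3; lra.
have dW : W <= d%:R * W by rewrite ler_peMl.
have ddW : d%:R <= d%:R * W by rewrite ler_peMr // ltW.
have [_ _ _ lc] := domd_lambda_bounds R0 S0 g0 k0 c0 ck d0.
rewrite /conf_cap [leRHS]mulrDl [X in _ <= X + _]mulrDl; apply: lerD; first apply: lerD.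
- have -> : 4 * lambda_cap R S g kmu * S ^+ 2 * (d%:R * W)
    = 4 * (lambda_cap R S g kmu * (d%:R * W)) * S ^+ 2 by ring.
  rewrite ler_wpM2r ?sqr_ge0 // ler_pM2l //; apply: le_trans lc _.
  by rewrite ler_wpM2l ?lambda_cap_ge0.
- rewrite -[leRHS]mulrA; apply: ler_wpM2l.
    rewrite mulr_ge0 ?mulr_ge0 ?(ltW e0) // addr_ge0 // divr_ge0 ?sqr_ge0 //.
    by rewrite mulr_ge0 // ltW.
  apply: le_trans (ln_conf_le h) _; apply: ler_wpM2l => //.
  by rewrite addr_ge0 // sqr_ge0.
- have -> : 2 * eta * (3 * eta + 2^-1) * logdet_cap R S * (d%:R * W)
    = 2 * eta * (3 * eta + 2^-1) * d%:R * (logdet_cap R S * W) by ring.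
  apply: ler_wpM2l; last exact: logdet_le.
  rewrite mulr_ge0 // mulr_ge0 ?addr_ge0 ?mulr_ge0 //; exact: ltW.
Qed.

Lemma loss_cap_ge0 : 0 <= loss_cap R S g kmu.
Proof. by rewrite divr_ge0 ?(ltW g0) // !mulr_ge0 ?addr_ge0 ?mulr_ge0 // ltW. Qed.

Lemma log_sum_ge1 : 1 <= W.
Proof. by have := W3; lra. Qed.

Lemma regret_rate : exists D : nat, forall n : nat,
  2 * S * kmu * (D * n)%N%:R
  + kmu * (2 * Num.sqrt (conf_cap R S g kmu * (d%:R * W))
             * Num.sqrt (2 * g / cmu * (d%:R * (logdet_cap R S * W)
                                          * (1 + (1 - gam) * T%:R)) * T%:R)
           + T%:R * (2 * Num.sqrt (2 * eta * (loss_cap R S g kmu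
                                              * (gam ^+ D / (1 - gam))))
                     / Num.sqrt lam))
  <= regret_cap R S g kmu * W *
     (kmu / Num.sqrt cmu * d%:R * Num.sqrt T%:R
      + kmu / Num.sqrt cmu * d%:R * T%:R * Num.sqrt (1 - gam)
      + n%:R / (1 - gam)).
Proof.
have /andP[ga0 ga1] := gam01; have W1 := log_sum_ge1.
have Wp : 0 < W by exact: lt_le_trans W1.
pose y := 2 * ln T%:R - ln (1 - gam).
have y0 : 0 <= y by rewrite /y; move: lnT0 lnu0; set A := ln _; set B := ln _; lra.
have u01 : 0 < 1 - gam < 1 by rewrite u0 gtrBl.
have [D [D1 D2]] := discount_window u01 y0; exists D => n.
have DW : D%:R <= 2 * W / (1 - gam).
  apply: le_trans D1 _; rewrite ler_pM2r ?invr_gt0 // /y; move: lnT0 lnu0 lnde0.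
  by rewrite WE; set A := ln T%:R; set B := ln _; set C := ln _; lra.
have gD : gam ^+ D / (1 - gam) <= (T%:R ^+ 2)^-1.
  have yE : expR (- y) = (T%:R ^+ 2)^-1 * (1 - gam).
    rewrite /y opprB expRD lnK ?posrE // expRN mulrC; congr (_^-1 * _).
    by rewrite expRM_natl lnK ?posrE.
  by rewrite ler_pdivrMr // -yE -[X in X ^+ D](subKr 1).
set X := kmu / Num.sqrt cmu * d%:R; set q := Num.sqrt (1 - gam).
have sc0 : 0 < Num.sqrt cmu by rewrite sqrtr_gt0.
have sk0 : 0 < Num.sqrt kmu by rewrite sqrtr_gt0.
have X0 : 0 < X by rewrite mulr_gt0 // divr_gt0.
have kE : Num.sqrt kmu * Num.sqrt kmu = kmu by rewrite -expr2 sqr_sqrtr // ltW.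
have Xk : Num.sqrt kmu <= X.
  apply: (@le_trans _ _ (kmu / Num.sqrt cmu)).
    by rewrite ler_pdivlMr // -[leRHS]kE ler_pM2l // ler_wsqrtr.
  by rewrite ler_peMr // divr_ge0 // ltW.
have sT1 : 1 <= Num.sqrt T%:R :> K by rewrite -{1}sqrtr1 ler_wsqrtr // ler1n ltnW.
have h1 : 2 * S * kmu * (D * n)%N%:R <= 4 * S * kmu * W * (n%:R / (1 - gam)).
  rewrite natrM; have -> : 4 * S * kmu * W * (n%:R / (1 - gam))
    = 2 * S * kmu * (2 * W / (1 - gam) * n%:R) by ring.
  by rewrite ler_pM2l ?mulr_gt0 // ler_wpM2r.
pose a := Num.sqrt (2 * g * conf_cap R S g kmu * logdet_cap R S).
have h2 : kmu * (2 * Num.sqrt (conf_cap R S g kmu * (d%:R * W))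
             * Num.sqrt (2 * g / cmu * (d%:R * (logdet_cap R S * W)
                                          * (1 + (1 - gam) * T%:R)) * T%:R))
   <= 2 * a * W * (X * Num.sqrt T%:R + X * T%:R * q).
  have cc0 := conf_cap_gt0; have lc0 := logdet_cap_gt0.
  have dW0 : 0 <= d%:R * W by rewrite mulr_ge0 // ltW.
  rewrite -mulrA -sqrtrM ?mulr_ge0 ?(ltW cc0) ?(ltW Wp) //.
  have -> : conf_cap R S g kmu * (d%:R * W) * (2 * g / cmu
      * (d%:R * (logdet_cap R S * W) * (1 + (1 - gam) * T%:R)) * T%:R)
    = 2 * g * conf_cap R S g kmu * logdet_cap R S * ((d%:R * W) ^+ 2 * (cmu^-1
      * ((1 + (1 - gam) * T%:R) * T%:R))) by ring.
  rewrite sqrtrM; last by rewrite !mulr_ge0 // ltW.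
  rewrite -/a sqrtrM ?sqr_ge0 // sqrtr_sqr ger0_norm // sqrtrM ?invr_ge0 ?(ltW c0) //.
  rewrite sqrtrV ?(ltW c0) //.
  have -> : 2 * a * W * (X * Num.sqrt T%:R + X * T%:R * q)
    = kmu * (2 * (a * (d%:R * W * ((Num.sqrt cmu)^-1 * (Num.sqrt T%:R + T%:R * q))))).
    by rewrite /X; ring.
  rewrite ler_pM2l // ler_pM2l //; apply: ler_wpM2l; first exact: sqrtr_ge0.
  apply: ler_wpM2l => //; apply: ler_wpM2l; first by rewrite invr_ge0 ltW.
  by apply: sqrt_rate; exact: ltW.
pose b := Num.sqrt (2 * eta * loss_cap R S g kmu / (6 * eta * R * kmu * S / g)).
have h3 : kmu * (T%:R * (2 * Num.sqrt (2 * eta * (loss_cap R S g kmu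
                     * (gam ^+ D / (1 - gam)))) / Num.sqrt lam))
   <= 2 * b * Num.sqrt kmu * W * (X * Num.sqrt T%:R).
  have L0 := loss_cap_ge0.
  have eL0 : 0 <= 2 * eta * loss_cap R S g kmu.
    by apply: mulr_ge0 => //; apply: mulr_ge0 => //; exact: ltW.
  have [hl _ _ _] := domd_lambda_bounds R0 S0 g0 k0 c0 ck d0.
  have hs : T%:R * (2 * Num.sqrt (2 * eta * (loss_cap R S g kmu
                     * (gam ^+ D / (1 - gam)))) / Num.sqrt lam) <= 2 * b.
    have -> : 2 * b = T%:R * (2 * (Num.sqrt (2 * eta * loss_cap R S g kmu) / T%:R)
      / Num.sqrt (6 * eta * R * kmu * S / g)).
      rewrite /b sqrtrM // sqrtrV; last exact: ltW.
      by field; rewrite !gt_eqF // sqrtr_gt0.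
    rewrite ler_pM2l //; apply: ler_pM.
    - by rewrite mulr_ge0 // sqrtr_ge0.
    - by rewrite invr_ge0 sqrtr_ge0.
    - rewrite ler_pM2l // mulrA sqrtrM // ler_wpM2l ?sqrtr_ge0 //.
      rewrite -[leRHS]ger0_norm ?invr_ge0 ?(ltW T0) // -sqrtr_sqr ler_wsqrtr // exprVn //.
    - by rewrite lef_pV2 ?posrE ?sqrtr_gt0 // ler_wsqrtr.
  apply: le_trans (ler_wpM2l (ltW k0) hs) _.
  have b0 : 0 <= 2 * b by rewrite mulr_ge0 // sqrtr_ge0.
  have XT0 : 0 <= X * Num.sqrt T%:R by rewrite mulr_ge0 ?sqrtr_ge0 // ltW.
  have key : kmu <= Num.sqrt kmu * (W * (X * Num.sqrt T%:R)).
    rewrite -{1}kE ler_pM2l //; apply: (le_trans Xk).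
    apply: (@le_trans _ _ (X * Num.sqrt T%:R)); first by rewrite ler_peMr // ltW.
    by rewrite ler_peMl.
  have -> : 2 * b * Num.sqrt kmu * W * (X * Num.sqrt T%:R)
    = Num.sqrt kmu * (W * (X * Num.sqrt T%:R)) * (2 * b) by ring.
  by rewrite ler_wpM2r.
rewrite mulrDr; apply: le_trans (lerD h1 (lerD h2 h3)) _.
rewrite /regret_cap -/a -/b.
have A0 : 0 <= X * Num.sqrt T%:R by rewrite mulr_ge0 ?sqrtr_ge0 // ltW.
have B0 : 0 <= X * T%:R * q by apply: mulr_ge0; [apply: mulr_ge0; exact: ltW | exact: sqrtr_ge0].
have C0 : 0 <= n%:R / (1 - gam) by rewrite divr_ge0 // ltW.
have p1 : 0 <= 4 * S * kmu * W by rewrite !mulr_ge0 // ltW.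
have p2 : 0 <= 2 * a * W by rewrite !mulr_ge0 ?sqrtr_ge0 // ltW.
have p3 : 0 <= 2 * b * Num.sqrt kmu * W by rewrite !mulr_ge0 ?sqrtr_ge0 // ltW.
move: A0 B0 C0 p1 p2 p3; set A := X * Num.sqrt _; set B := X * _ * q; set C := n%:R / _.
move=> A0 B0 C0 p1 p2 p3.
have -> : (4 * S * kmu + 2 * a + 2 * b * Num.sqrt kmu) * W * (A + B + C)
  = 4 * S * kmu * W * (A + B + C) + (2 * a * W * (A + B + C)
    + 2 * b * Num.sqrt kmu * W * (A + B + C)) by ring.
by apply: lerD; [|apply: lerD]; apply: ler_wpM2l => //; lra.
Qed.

End Bounds.
End Rates.

Section TunedDiscount.
Context {K : realType}.
Variables (d T n : nat) (kmu cmu : K).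
Hypotheses (d0 : (1 <= d)%N) (T2 : (2 <= T)%N) (k0 : 0 < kmu) (c0 : 0 < cmu).
Local Notation gam := (tuned_gamma d T n kmu cmu).

Let T0 : 0 < T%:R :> K. Proof. by rewrite ltr0n ltnW. Qed.
Let Ti : T%:R^-1 <= 2^-1 :> K.
Proof. by rewrite lef_pV2 ?posrE // ler_nat. Qed.
Let Ti0 : 0 < T%:R^-1 :> K. Proof. by rewrite invr_gt0. Qed.

Lemma tuned_gamma_bounds : T%:R^-1 <= gam < 1.
Proof.
have ti := Ti; have ti0 := Ti0.
rewrite /tuned_gamma; set M := Num.max _ _.
have M0 : T%:R^-1 <= M by rewrite le_max lexx.
apply/andP; split; last by rewrite gtrBl lt_min (lt_le_trans Ti0 M0) andbT; lra.
by rewrite lerBrDr addrC -lerBrDr ge_min lexx.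
Qed.

Local Notation X := (kmu / Num.sqrt cmu * d%:R).
Local Notation rate := (X * Num.sqrt T%:R + X * T%:R * Num.sqrt (1 - gam)
                        + n%:R / (1 - gam)).

Let X0 : 0 < X. Proof. by rewrite mulr_gt0 ?divr_gt0 ?sqrtr_gt0 // ltr0n. Qed.

Let rho : K := n%:R / (X * T%:R).
Let rho0 : 0 <= rho. Proof. by rewrite divr_ge0 // mulr_ge0 // ltW. Qed.
Let nE : n%:R = X * T%:R * rho.
Proof. by rewrite /rho mulrC divfK // gt_eqF // mulr_gt0. Qed.

Let v : K := rho `^ 3^-1.
Let v0 : 0 <= v. Proof. exact: powR_ge0. Qed.
Let rhoE : rho = v ^+ 3.
Proof. by rewrite -powR_mulrn // /v -powRrM mulVf // powRr1. Qed.

Let uE : 1 - gam = Num.min (1 - T%:R^-1) (Num.max T%:R^-1 (v ^+ 2)).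
Proof.
rewrite /tuned_gamma subKr; congr (Num.min _ (Num.max _ _)).
rewrite -powR_mulrn // /v -powRrM; congr (_ `^ _); last by rewrite mulrC.
by rewrite /rho; field; rewrite !gt_eqF ?sqrtr_gt0 // ltr0n.
Qed.

Let sT0 : 0 < Num.sqrt T%:R :> K. Proof. by rewrite sqrtr_gt0. Qed.
Let sTE : Num.sqrt T%:R ^+ 2 = T%:R :> K. Proof. by rewrite sqr_sqrtr // ltW. Qed.

Let sTi : T%:R / Num.sqrt T%:R = Num.sqrt T%:R :> K.
Proof. by rewrite -{1}sTE expr2 mulfK // gt_eqF. Qed.
Let sT3 : (Num.sqrt T%:R)^-1 ^+ 3 * T%:R = (Num.sqrt T%:R)^-1 :> K.
Proof. by rewrite exprSr exprVn sTE mulrAC mulVf ?mul1r // gt_eqF. Qed.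

Lemma tuned_rate_few :
  n%:R < kmu * d%:R / Num.sqrt (cmu * T%:R) -> rate <= 10 * (X * Num.sqrt T%:R).
Proof.
have ti := Ti; have ti0 := Ti0.
have -> : kmu * d%:R / Num.sqrt (cmu * T%:R) = X / Num.sqrt T%:R.
  by rewrite sqrtrM ?(ltW c0) //; field; rewrite !gt_eqF ?sqrtr_gt0.
have XT0 : 0 < X * T%:R by exact: mulr_gt0.
move=> nlo; have uT : 1 - gam = T%:R^-1.
  rewrite uE; have h : v ^+ 2 <= T%:R^-1.
    have vs : v < (Num.sqrt T%:R)^-1.
      rewrite -(@ltr_pXn2r _ 3) ?nnegrE ?invr_ge0 ?(ltW sT0) // -rhoE.
      rewrite /rho ltr_pdivrMr //; apply: lt_le_trans nlo _.
      by rewrite mulrCA sT3.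
    apply: (@le_trans _ _ ((Num.sqrt T%:R)^-1 ^+ 2)).
      by rewrite lerXn2r ?nnegrE ?invr_ge0 ?(ltW sT0) // ltW.
    by rewrite exprVn sTE.
  by rewrite max_l // min_r //; lra.
rewrite uT invrK sqrtrV ?(ltW T0) //.
have -> : X * T%:R / Num.sqrt T%:R = X * Num.sqrt T%:R by rewrite -mulrA sTi.
have : n%:R * T%:R <= X * Num.sqrt T%:R.
  have -> : X * Num.sqrt T%:R = X / Num.sqrt T%:R * T%:R.
    by rewrite -[RHS]mulrA [_^-1 * T%:R]mulrC sTi.
  by rewrite ler_pM2r // ltW.
have : 0 <= X * Num.sqrt T%:R by rewrite mulr_ge0 // ltW.
by set A := X * _; lra.
Qed.

Let hiE : kmu * d%:R * T%:R / Num.sqrt cmu * (1 - T%:R^-1) `^ (3 / 2)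
  = X * T%:R * Num.sqrt (1 - T%:R^-1) ^+ 3.
Proof.
have ti := Ti; have ti0 := Ti0.
have h : 0 <= 1 - T%:R^-1 :> K by lra.
have -> : Num.sqrt (1 - T%:R^-1) ^+ 3 = (1 - T%:R^-1) `^ (3 / 2) :> K.
  by rewrite -powR12_sqrt // -powR_mulrn ?powR_ge0 // -powRrM mulrC.
by ring.
Qed.

Lemma tuned_rate_moderate :
  kmu * d%:R / Num.sqrt (cmu * T%:R) <= n%:R
    <= kmu * d%:R * T%:R / Num.sqrt cmu * (1 - T%:R^-1) `^ (3 / 2) ->
  rate <= 10 * (kmu `^ (2 / 3) / cmu `^ (1 / 3) * d%:R `^ (2 / 3)
                * n%:R `^ (1 / 3) * T%:R `^ (2 / 3)).
Proof.
have ti := Ti; have ti0 := Ti0.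
have -> : kmu * d%:R / Num.sqrt (cmu * T%:R) = X / Num.sqrt T%:R.
  by rewrite sqrtrM ?(ltW c0) //; field; rewrite !gt_eqF ?sqrtr_gt0.
rewrite hiE => /andP[lo hi].
have XT0 : 0 < X * T%:R by exact: mulr_gt0.
have s0 : 0 <= Num.sqrt (1 - T%:R^-1) :> K by exact: sqrtr_ge0.
have vlo : (Num.sqrt T%:R)^-1 <= v.
  rewrite -(@ler_pXn2r _ 3) ?nnegrE ?invr_ge0 ?(ltW sT0) // -rhoE.
  rewrite /rho ler_pdivlMr //; apply: le_trans lo.
  by rewrite mulrCA sT3.
have vhi : v <= Num.sqrt (1 - T%:R^-1).
  by rewrite -(@ler_pXn2r _ 3) ?nnegrE // -rhoE ler_pdivrMr // mulrC.
have v0' : 0 < v by apply: lt_le_trans vlo; rewrite invr_gt0.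
have u2 : 1 - gam = v ^+ 2.
  rewrite uE max_r; last first.
    by rewrite -sTE -exprVn lerXn2r ?nnegrE ?invr_ge0 // ltW.
  rewrite min_r // -[leRHS]sqr_sqrtr; last by lra.
  by rewrite lerXn2r ?nnegrE.
have -> : kmu `^ (2 / 3) / cmu `^ (1 / 3) * d%:R `^ (2 / 3)
                * n%:R `^ (1 / 3) * T%:R `^ (2 / 3) = X * T%:R * v.
  have cube (z : K) : 0 <= z -> (z `^ (1 / 3)) ^+ 3 = z.
    by move=> z0; rewrite -powR_mulrn ?powR_ge0 // -powRrM divfK // powRr1.
  have cube2 (z : K) : 0 <= z -> (z `^ (2 / 3)) ^+ 3 = z ^+ 2.
    by move=> z0; rewrite -powR_mulrn ?powR_ge0 // -powRrM divfK // powR_mulrn.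
  apply: (pexpIrn (n := 3)) => //.
  - by rewrite nnegrE !mulr_ge0 ?invr_ge0 ?powR_ge0.
  - by rewrite nnegrE mulr_ge0 // ltW.
  rewrite !exprMn exprVn !cube ?cube2 ?(ltW c0) ?(ltW k0) ?(ltW T0) // -rhoE nE.
  have -> : cmu^-1 = (Num.sqrt cmu)^-1 ^+ 2 by rewrite exprVn sqr_sqrtr // ltW.
  ring.
rewrite u2 sqrtr_sqr ger0_norm //.
have -> : n%:R / v ^+ 2 = X * T%:R * v.
  by rewrite nE rhoE; field; rewrite !gt_eqF ?sqrtr_gt0.
have : X * Num.sqrt T%:R <= X * T%:R * v.
  rewrite -[X * _ * v]mulrA ler_pM2l //; have := ler_wpM2l (ltW T0) vlo.
  by rewrite sTi.
have : 0 <= X * T%:R * v by rewrite mulr_ge0 // ltW.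
by set A := X * T%:R * v; lra.
Qed.

Lemma tuned_rate_many :
  kmu * d%:R * T%:R / Num.sqrt cmu * (1 - T%:R^-1) `^ (3 / 2) < n%:R ->
  rate <= 10 * n%:R.
Proof.
have ti := Ti; have ti0 := Ti0.
rewrite hiE => hi; set s := Num.sqrt (1 - _) in hi.
have XT0 : 0 < X * T%:R by exact: mulr_gt0.
have s0 : 0 <= s by exact: sqrtr_ge0.
have sE : s ^+ 2 = 1 - T%:R^-1 by rewrite sqr_sqrtr //; lra.
have vs : s < v.
  by rewrite -(@ltr_pXn2r _ 3) ?nnegrE // -rhoE ltr_pdivlMr // mulrC.
have u1 : 1 - gam = 1 - T%:R^-1.
  rewrite uE min_l // le_max; apply/orP; right.
  by rewrite -sE lerXn2r ?nnegrE // ltW.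
have s1 : 2^-1 <= s ^+ 2 by rewrite sE; lra.
have s2 : s <= 1 by rewrite -(@expr_le1 _ 2) // sE; lra.
have s3 : 2^-1 <= s by apply: le_trans s1 _; rewrite expr2 ler_piMr.
have hX : X * T%:R <= 4 * n%:R.
  have : 4^-1 <= s ^+ 3.
    have -> : 4^-1 = 2^-1 * 2^-1 :> K by field.
    by rewrite exprS; apply: ler_pM.
  move/(ler_wpM2l (ltW XT0)) => h; have := le_lt_trans h hi; lra.
have sT : Num.sqrt T%:R <= T%:R :> K.
  rewrite -[leRHS]sTE expr2 ler_peMl ?(ltW sT0) // -{1}sqrtr1 ler_wsqrtr //.
  by rewrite ler1n ltnW.
have a1 : X * Num.sqrt T%:R <= X * T%:R by rewrite ler_pM2l.
have a2 : X * T%:R * s <= X * T%:R by rewrite ler_piMr // ltW.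
have a3 : n%:R / (1 - T%:R^-1) <= 2 * n%:R :> K.
  rewrite ler_pdivrMr; last by lra.
  have := ler0n K n; have h : 2^-1 <= 1 - T%:R^-1 :> K by lra.
  by move=> n0; have := ler_wpM2l n0 h; lra.
by rewrite u1 -/s; lra.
Qed.

End TunedDiscount.

Section MeasurableTuning.
Context {K : realType} {disp : measure_display} {Om : measurableType disp}.

Lemma measurable_neq_vec (d : nat) (u v : Om -> 'cV[K]_d) :
  vec_measurable u -> vec_measurable v ->
  measurable_fun setT (fun w => (u w != v w)%:R : K).
Proof.
move=> mu mv; rewrite (_ : (fun w => _) =
  fun w => 1 - \prod_i if u w i 0 == v w i 0 then 1 else 0); last first.
  apply/funext => w; have [<-|ne] := eqVneq (u w) (v w).
    by rewrite big1 ?subrr // => i _; rewrite eqxx.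
  have [i ni] : exists i, u w i 0 != v w i 0.
    apply/existsP; apply: contraNT ne; rewrite negb_exists => /forallP h.
    by apply/eqP/matrixP => i j; rewrite ord1; apply/eqP; move: (h i); rewrite negbK.
  by rewrite (bigD1 i) //= (negbTE ni) mul0r subr0.
apply: measurable_funB => //; apply: measurable_prod => i _.
by apply: measurable_fun_ifT => //; apply: measurable_fun_eqr; [exact: mu | exact: mv].
Qed.

Lemma measurable_num_changes (d T : nat) (thstar : nat -> Om -> 'cV[K]_d) :
  (forall t, (1 <= t)%N -> vec_measurable (thstar t)) ->
  measurable_fun setT (fun w => (num_changes (thstar ^~ w) T)%:R : K).
Proof.
move=> mth; under eq_fun do rewrite /num_changes natr_sum big_add1 /=.
by apply: measurable_sum => t; apply: measurable_neq_vec; exact: mth.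
Qed.

Lemma measurable_tuned_gamma (d T : nat) (kmu cmu : K) (N : Om -> nat) :
  measurable_fun setT (fun w => (N w)%:R : K) ->
  measurable_fun setT (fun w => tuned_gamma d T (N w) kmu cmu).
Proof.
move=> mN; apply: measurable_funB => //; apply: measurable_minr => //.
apply: measurable_maxr => //; apply: (measurableT_comp (measurable_powR (2 / 3))).
by apply: measurable_funM => //; apply: measurable_funM.
Qed.

End MeasurableTuning.

Section RandomDiscount.
Context {K : realType} {disp : measure_display} {Omega : measurableType disp}.
Variables (P : probability Omega K) (d : nat).
Variables (R S g kmu cmu : K) (m h : K -> K)
  (nu : {measure set (measurableTypeR K) -> \bar K})
  (arms : nat -> Omega -> set 'cV[K]_d)
  (thstar xstar x : nat -> Omega -> 'cV[K]_d) (r : nat -> Omega -> K)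
  (theta1 : 'cV[K]_d) (theta : nat -> Omega -> 'cV[K]_d)
  (H : nat -> Omega -> 'M[K]_d) (delta : K) (T : nat) (gam : Omega -> K).
Hypotheses (R0 : 0 < R) (S0 : 0 < S) (g0 : 0 < g) (kmu0 : 0 < kmu) (cmu0 : 0 < cmu).
Hypotheses (d0 : (1 <= d)%N) (T2 : (2 <= T)%N) (delta01 : 0 < delta < 1).
Hypothesis model : glm_model R S g kmu cmu m h nu.
Hypothesis env : glb_environment P R S g m h nu arms thstar x r.
Hypothesis xstarP : forall t w, (1 <= t)%N ->
  is_argmax (arms t w) (fun y => m^`()%classic (dot y (thstar t w))) (xstar t w).
Hypothesis theta1S : ball2 S theta1.
Hypothesis gam0 : forall w, 0 < gam w < 1.
Hypothesis mgam : forall t,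
  measurable_fun (setT : set (g_sigma_algebraType (history_gens thstar x r t))) gam.
Hypothesis run : forall w, domd_glb_run R S g kmu m (gam w)
  (domd_lambda d R S g kmu cmu) (1 + R * S) delta T theta1
  (arms ^~ w) (x ^~ w) (r ^~ w) (theta ^~ w) (H ^~ w).

Lemma regret_whp : with_prob_ge P (1 - delta) (fun w =>
  dyn_regret m^`()%classic (thstar ^~ w) (xstar ^~ w) (x ^~ w) T
  <= regret_cap R S g kmu * log_sum T delta (gam w) *
     (kmu / Num.sqrt cmu * d%:R * Num.sqrt T%:R
      + kmu / Num.sqrt cmu * d%:R * T%:R * Num.sqrt (1 - gam w)
      + (num_changes (thstar ^~ w) T)%:R / (1 - gam w))).
Proof.
have z0S : - S <= 0 <= S by rewrite oppr_le0 ltW.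
have ck : cmu <= kmu by case/andP: (glm_link_bounds model z0S) => /le_trans; apply.
have [hl hR hc _] := domd_lambda_bounds R0 S0 g0 kmu0 cmu0 ck d0.
have lam0 : 0 < domd_lambda d R S g kmu cmu.
  by apply: lt_le_trans hc; rewrite divr_gt0.
have sc := class_C3_self_concordant (glm_C3 model) (glm_self_concordant model).
have [E [mE PE hE]] :=
  good_event R0 S0 g0 cmu0 delta01 model env erefl gam0 lam0 hR mgam run theta1S.
exists E; split => // w /hE good.
have [D hD] := regret_rate R0 S0 g0 kmu0 cmu0 ck d0 T2 delta01 (gam0 w).
apply: le_trans (hD (num_changes (thstar ^~ w) T)).
have W1 := log_sum_ge1 T2 delta01 (gam0 w).
have M0 : 0 <= R + g + 2 * S * kmu.
  by rewrite !addr_ge0 ?mulr_ge0 // ltW.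
apply: (trajectory_regret R0 S0 g0 cmu0 M0 d0 sc (glm_link_bounds model)
  (fun z hz => mean_bounded R0 S0 g0 model env hz) erefl (gam0 w) lam0 hl hc
  (run w) theta1S).
- by move=> t t1; exact: (glb_arms_bound env t1).
- by move=> t t1; exact: (glb_action env w t1).
- by move=> t t1; exact: (glb_param_bound env w t1).
- by move=> t t1; exact: xstarP.
- by move=> t tT; have [] := good t tT.
- by move=> t tT; have [] := good t tT.
- by move=> t /andP[t1 _]; exact: ln_conf_ge0.
- by move=> t _; exact: (logdet_le R0 S0 g0 kmu0 cmu0 ck d0 T2 delta01 (gam0 w)).
- apply: mulr_gt0; first exact: logdet_cap_gt0.
  exact: lt_le_trans ltr01 W1.
- by move=> t tT; exact: (conf_radius_le R0 S0 g0 kmu0 cmu0 ck d0 T2 delta01 (gam0 w) tT).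
- exact: ltnW.
Qed.

End RandomDiscount.

Lemma measurable_history_tuned_gamma (K : realType) (disp : measure_display)
    (Omega : measurableType disp) (d T : nat) (kmu cmu : K)
    (thstar x : nat -> Omega -> 'cV[K]_d) (r : nat -> Omega -> K) (t : nat) :
  measurable_fun (setT : set (g_sigma_algebraType (history_gens thstar x r t)))
    (fun w => tuned_gamma d T (num_changes (thstar ^~ w) T) kmu cmu).
Proof.
apply: measurable_tuned_gamma; apply: measurable_num_changes => s s1.
exact: history_measurable_thstar.
Qed.

Lemma polylog_sum (K : realType) (T : nat) (delta gam : K) :
  polylog ('X + 'X%:P + 'X%:P%:P) T delta gam = log_sum T delta gam.
Proof. by rewrite /polylog !hornerE. Qed.

(* World: MathComp-Analysis.  L (the polylogarithmic factor) is universal and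
   C depends only on R, S, g, kmu. *)
Theorem theorem3 (K : realType) :
  exists L : {poly {poly {poly K}}},
  forall R S g kmu : K, 0 < R -> 0 < S -> 0 < g -> 0 < kmu ->
  exists C : K,
  forall (d T : nat) (delta cmu : K) (m h : K -> K)
    (nu : {measure set (measurableTypeR K) -> \bar K})
    (disp : measure_display) (Omega : measurableType disp)
    (P : probability Omega K)
    (arms : nat -> Omega -> set 'cV[K]_d)
    (thstar xstar x : nat -> Omega -> 'cV[K]_d)
    (r : nat -> Omega -> K)
    (theta1 : 'cV[K]_d)
    (theta : nat -> Omega -> 'cV[K]_d) (H : nat -> Omega -> 'M[K]_d),
  (1 <= d)%N -> (2 <= T)%N -> 0 < delta < 1 -> 0 < cmu ->
  glm_model R S g kmu cmu m h nu ->
  glb_environment P R S g m h nu arms thstar x r ->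
  (forall t w, (1 <= t)%N ->
     is_argmax (arms t w) (fun y => m^`()%classic (dot y (thstar t w)))
       (xstar t w)) ->
  ball2 S theta1 ->
  let eta := 1 + R * S in
  let lambda := domd_lambda d R S g kmu cmu in
  let Reg := fun w =>
    dyn_regret m^`()%classic (thstar ^~ w) (xstar ^~ w) (x ^~ w) T in
  let Gamma := fun w => num_changes (thstar ^~ w) T in
  let run := fun (gamma : K) (w : Omega) =>
    domd_glb_run R S g kmu m gamma lambda eta delta T theta1
      (arms ^~ w) (x ^~ w) (r ^~ w) (theta ^~ w) (H ^~ w) in
  (forall gamma : K, T%:R^-1 <= gamma < 1 ->
     (forall w, run gamma w) ->
     with_prob_ge P (1 - delta) (fun w =>
       Reg w <= C * polylog L T delta gamma *
         (kmu / Num.sqrt cmu * d%:R * Num.sqrt T%:R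
          + kmu / Num.sqrt cmu * d%:R * T%:R * Num.sqrt (1 - gamma)
          + (Gamma w)%:R / (1 - gamma))))
  /\
  (let gamma := fun w => tuned_gamma d T (Gamma w) kmu cmu in
   (forall w, run (gamma w) w) ->
   with_prob_ge P (1 - delta) (fun w =>
     let lo := kmu * d%:R / Num.sqrt (cmu * T%:R) in
     let hi := kmu * d%:R * T%:R / Num.sqrt cmu * (1 - T%:R^-1) `^ (3 / 2) in
     let CL := C * polylog L T delta (gamma w) in
     [/\ (Gamma w)%:R < lo ->
           Reg w <= CL * (kmu / Num.sqrt cmu * d%:R * Num.sqrt T%:R),
         lo <= (Gamma w)%:R <= hi ->
           Reg w <= CL * (kmu `^ (2 / 3) / cmu `^ (1 / 3) * d%:R `^ (2 / 3)
                          * (Gamma w)%:R `^ (1 / 3) * T%:R `^ (2 / 3))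
       & hi < (Gamma w)%:R ->
           Reg w <= CL * (Gamma w)%:R])).
Proof.
exists ('X + 'X%:P + 'X%:P%:P) => R S g kmu R0 S0 g0 k0.
exists (10 * regret_cap R S g kmu) => d T delta cmu m h nu disp Omega P arms
  thstar xstar x r theta1 theta H d0 T2 de01 c0 model env xstarP th1 eta lambda
  Reg Gamma run.
have Ti0 : 0 < T%:R^-1 :> K by rewrite invr_gt0 ltr0n ltnW.
have cap0 := regret_cap_ge0 R0 S0 g0 k0.
have z0S : - S <= 0 <= S by rewrite oppr_le0 ltW.
have ck : cmu <= kmu by case/andP: (glm_link_bounds model z0S) => /le_trans; apply.
split.
  move=> gamma /andP[ga0 ga1] runw.
  have g01 w : 0 < (fun _ : Omega => gamma) w < 1 by rewrite ga1 andbT (lt_le_trans Ti0).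
  have [E [mE PE hE]] := regret_whp R0 S0 g0 k0 c0 d0 T2 de01 model env xstarP th1 g01
    (fun t => measurable_cst _) runw.
  exists E; split => // w /hE /le_trans; apply; rewrite polylog_sum.
  have W1 := log_sum_ge1 T2 de01 (g01 w).
  apply: ler_wpM2r.
    rewrite !addr_ge0 ?mulr_ge0 ?divr_ge0 ?invr_ge0 ?sqrtr_ge0 ?(ltW k0) //.
    by rewrite subr_ge0 ltW.
  rewrite ler_wpM2r //; last by rewrite ler_peMl ?ler1n.
  exact: le_trans ler01 W1.
move=> gamma runw.
have g01 w : 0 < gamma w < 1.
  have /andP[h1 h2] := tuned_gamma_bounds d (Gamma w) kmu cmu T2.
  by rewrite h2 andbT (lt_le_trans Ti0).
have [E [mE PE hE]] := regret_whp R0 S0 g0 k0 c0 d0 T2 de01 model env xstarP th1 g01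
    (@measurable_history_tuned_gamma K disp Omega d T kmu cmu thstar x r) runw.
exists E; split => // w /hE bound lo hi CL.
have CW : 0 <= regret_cap R S g kmu * log_sum T delta (gamma w).
  by apply: mulr_ge0 => //; apply: le_trans ler01 (log_sum_ge1 T2 de01 (g01 w)).
have step y : kmu / Num.sqrt cmu * d%:R * Num.sqrt T%:R
      + kmu / Num.sqrt cmu * d%:R * T%:R * Num.sqrt (1 - gamma w)
      + (num_changes (thstar ^~ w) T)%:R / (1 - gamma w) <= 10 * y ->
    Reg w <= CL * y.
  move=> hy; apply: (le_trans bound); apply: le_trans (ler_wpM2l CW hy) _.
  by rewrite /CL polylog_sum le_eqVlt; apply/orP; left; apply/eqP; ring.
split=> hG; apply: step.
- exact: tuned_rate_few.
- exact: tuned_rate_moderate.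
- exact: tuned_rate_many.
Qed.
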